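(* Let $M$ be a manifold endowed with a nondegenerate two-form $\varepsilon$ and an almost complex structure $J$; denote $J_+=J$ and $J_-=-\varepsilon^{-1}J^*\varepsilon$. Let $g$ and $b$ be the symmetric and skew-symmetric parts, respectively, of $\varepsilon J$. Then the following assertions are equivalent: (i) $(M,\varepsilon,J)$ is a tamed symplectic manifold. (ii) $(g,b,J_+,J_-)$ defines a generalized Kähler structure such that $J_++J_-$ is invertible. Moreover, up to a unique $B$-field transformation, any generalized Kähler structure, on $M$, with $J_++J_-$ invertible is obtained this way from a tamed symplectic structure.
   Context: Manifolds are connected and smooth. A bilinear form $\varepsilon$ is identified with the map $TM\to T^*M$, $\varepsilon(X)(Y)=\varepsilon(X,Y)$; $J^*:T^*M\to T^*M$ is the transpose of $J$; thus $\varepsilon J$ is the bilinear form $(X,Y)\mapsto\varepsilon(JX,Y)$. A tamed almost symplectic manifold $(M,\varepsilon,J)$ is a manifold with a nondegenerate two-form $\varepsilon$ and an almost complex structure $J$ such that $\varepsilon(JX,X)>0$ for any nonzero $X\in TM$. It is a tamed symplectic manifold if moreover $J$ and $\varepsilon^{-1}J^*\varepsilon$ are integrable and $d\varepsilon=0$. A generalized (almost) complex structure on $M$ is a complex subbundle $L$ of $T^{\mathbb C}M\oplus(T^{\mathbb C}M)^*$, maximal isotropic for $\langle X+\alpha,Y+\beta\rangle=\tfrac12(\alpha(Y)+\beta(X))$, with $L\cap\overline L=0$ (and, for a generalized complex structure, with sections closed under the Courant bracket $[X+\alpha,Y+\beta]=[X,Y]+\tfrac12 d(\iota_X\beta-\iota_Y\alpha)+\iota_Xd\beta-\iota_Yd\alpha$).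 It corresponds to the section $\mathcal J$ of $\mathrm{End}(TM\oplus T^*M)$ with $\mathrm i$-eigenbundle $L$. A generalized (almost) Kähler structure $(L_1,L_2)$ is a pair of generalized (almost) complex structures whose $\mathcal J_1,\mathcal J_2$ commute and $\mathcal J_1\mathcal J_2$ is negative definite with respect to $\langle\cdot,\cdot\rangle$. Generalized almost Kähler structures correspond bijectively to quadruples $(g,b,J_+,J_-)$, with $g$ a Riemannian metric, $b$ a two-form and $J_\pm$ almost Hermitian structures on $(M,g)$, via $L_1=L^+\oplus L^-$, $L_2=L^+\oplus\overline{L^-}$, $L^\pm=\{X+(b\pm g)(X)\mid X\in V^\pm\}$, $V^\pm$ the $\mathrm i$-eigenbundles of $J_\pm$. For a real closed two-form $B$, the $B$-field transformation is $\exp(B)(X+\alpha)=X+\iota_XB+\alpha$, applied to both $L_1,L_2$. *)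

(* Defs.v *)
(* Smooth manifolds are not in the libraries, so the part of the tensor
   calculus that is needed is set up here.

   Row-vector conventions (those of mxalgebra and of [jacobian]): tangent
   vectors X and covectors alpha are rows, alpha(X) = alpha X^T; an
   endomorphism J acts by X |-> X J, so composites are written in the reverse
   order; a bilinear form E is E(X, Y) = X E Y^T, i.e. the map TM -> T*M
   attached to it is X |-> X E; the transpose of J acts on covectors by
   alpha |-> alpha J^T.  An element X + alpha of TM (+) T*M is the row
   [row_mx X alpha]. *)
From HB Require Import structures.
From mathcomp Require Import all_boot all_order all_algebra.
From mathcomp Require Import all_classical all_reals all_analysis.
From mathcomp Require Import complex.

Set Implicit Arguments.
Unset Strict Implicit.
Unset Printing Implicit Defensive.
Import Order.TTheory GRing.Theory Num.Theory numFieldNormedType.Exports.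
Local Open Scope classical_set_scope.
Local Open Scope ring_scope.

(* C^infty: for A open, f is smooth on A iff all its iterated directional
   derivatives are (Frechet) differentiable at every point of A. *)
Fixpoint differentiable_upto (R : realType) (V W : normedModType R) (k : nat)
    (A : set V) (f : V -> W) : Prop :=
  (forall x, A x -> differentiable f x) /\
  match k with
  | 0 => True
  | k'.+1 => forall v, differentiable_upto k' A (fun x => 'D_v f x)
  end.

Definition smooth_on (R : realType) (V W : normedModType R)
  (A : set V) (f : V -> W) : Prop := forall k, differentiable_upto k A f.

Record chart (R : realType) (n : nat) (M : topologicalType) := Chart {
  chart_dom : set M;
  chart_fun :> M -> 'rV[R]_n;
  chart_inv : 'rV[R]_n -> M;
  chart_dom_open : open chart_dom;
  chart_img_open : open (chart_fun @` chart_dom);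
  chart_cont : {within chart_dom, continuous chart_fun};
  chart_inv_cont : {within chart_fun @` chart_dom, continuous chart_inv};
  chart_funK : forall p, chart_dom p -> chart_inv (chart_fun p) = p }.

(* [chart_at p] is a choice of a chart around p.  It serves to identify T_pM
   with R^n, so that a field is a function on M: the value of a field at p is
   its expression at p in the chart [chart_at p]. *)
Record manifold (R : realType) (n : nat) := Manifold {
  carrier :> topologicalType;
  manifold_hausdorff : hausdorff_space carrier;
  manifold_second_countable : @second_countable carrier;
  manifold_connected : connected [set: carrier];
  manifold_nonempty : [set: carrier] !=set0;
  atlas : set (chart R n carrier);
  chart_at : carrier -> chart R n carrier;
  chart_at_atlas : forall p, atlas (chart_at p);
  chart_at_dom : forall p, chart_dom (chart_at p) p;
  transition_smooth : forall c c', atlas c -> atlas c' ->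
    smooth_on (c @` (chart_dom c `&` chart_dom c')) (c' \o chart_inv c) }.

Section EuclideanCalculus.
Variables (R : realType) (n : nat).
Implicit Types (x : 'rV[R]_n) (X Y a : 'rV[R]_n -> 'rV[R]_n).

Definition basis_vec (i : 'I_n) : 'rV[R]_n := delta_mx 0 i.

Definition lie_bracket_Rn X Y x : 'rV[R]_n := 'D_(X x) Y x - 'D_(Y x) X x.

(* iota_X a, for a one-form a *)
Definition contract_Rn X a x : R := (a x *m (X x)^T) 0 0.

Definition d0_Rn (f : 'rV[R]_n -> R) x : 'rV[R]_n :=
  \row_j 'D_(basis_vec j) f x.

(* iota_X da: its j-th component is
   da(X, e_j) = sum_i X_i (partial_i a_j - partial_j a_i). *)
Definition contract_d1_Rn X a x : 'rV[R]_n :=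
  'D_(X x) a x - \row_j ('D_(basis_vec j) a x *m (X x)^T) 0 0.

(* the component dE(e_i, e_j, e_k), for a two-form E *)
Definition d2_Rn (E : 'rV[R]_n -> 'M[R]_n) x (i j k : 'I_n) : R :=
  'D_(basis_vec i) (fun y => E y j k) x
  + 'D_(basis_vec j) (fun y => E y k i) x
  + 'D_(basis_vec k) (fun y => E y i j) x.

Definition courant_Rn (u v : 'rV[R]_n -> 'rV[R]_(n + n)) x : 'rV[R]_(n + n) :=
  let X y := lsubmx (u y) in let a y := rsubmx (u y) in
  let Y y := lsubmx (v y) in let b y := rsubmx (v y) in
  row_mx (lie_bracket_Rn X Y x)
    (2^-1 *: d0_Rn (fun y => contract_Rn X b y - contract_Rn Y a y) x
     + contract_d1_Rn X b x - contract_d1_Rn Y a x).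

End EuclideanCalculus.

Section Fields.
Variables (R : realType) (n : nat) (M : manifold R n).
Implicit Types (c : chart R n M) (p q : M) (U : set M).

(* Jacobian, at q, of the change of coordinates from chart_at q to c; the
   inverse matrix is [jac_from]. *)
Definition jac_to c q : 'M[R]_n :=
  'J (c \o chart_inv (chart_at q)) (chart_at q q).
Definition jac_from c q : 'M[R]_n :=
  'J (chart_at q \o chart_inv c) (c q).

(* Expressions in the chart c of a vector field, an endomorphism field, a
   bilinear form, and m sections of TM (+) T*M. *)
Definition vec_in c (X : M -> 'rV[R]_n) (x : 'rV[R]_n) : 'rV[R]_n :=
  let q := chart_inv c x in X q *m jac_to c q.
Definition endo_in c (A : M -> 'M[R]_n) (x : 'rV[R]_n) : 'M[R]_n :=
  let q := chart_inv c x in jac_from c q *m A q *m jac_to c q.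
Definition form_in c (E : M -> 'M[R]_n) (x : 'rV[R]_n) : 'M[R]_n :=
  let q := chart_inv c x in jac_from c q *m E q *m (jac_from c q)^T.
Definition gen_in (m : nat) c (u : M -> 'M[R]_(m, n + n)) (x : 'rV[R]_n)
    : 'M[R]_(m, n + n) :=
  let q := chart_inv c x in
  u q *m block_mx (jac_to c q) 0 0 (jac_from c q)^T.

Definition smooth_vec U (X : M -> 'rV[R]_n) : Prop := forall c, atlas c ->
  smooth_on (c @` (U `&` chart_dom c)) (vec_in c X).
Definition smooth_endo (A : M -> 'M[R]_n) : Prop := forall c, atlas c ->
  smooth_on (c @` chart_dom c) (endo_in c A).
Definition smooth_form (E : M -> 'M[R]_n) : Prop := forall c, atlas c ->
  smooth_on (c @` chart_dom c) (form_in c E).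
Definition smooth_gen (m : nat) U (u : M -> 'M[R]_(m, n + n)) : Prop :=
  forall c, atlas c -> smooth_on (c @` (U `&` chart_dom c)) (gen_in c u).

Definition two_form (E : M -> 'M[R]_n) : Prop :=
  smooth_form E /\ forall p, (E p)^T = - E p.
Definition nondegenerate_form (E : M -> 'M[R]_n) : Prop :=
  forall p, E p \in unitmx.
Definition closed_form (E : M -> 'M[R]_n) : Prop :=
  forall p i j k, d2_Rn (form_in (chart_at p) E) (chart_at p p) i j k = 0.

Definition lie_bracket (X Y : M -> 'rV[R]_n) p : 'rV[R]_n :=
  lie_bracket_Rn (vec_in (chart_at p) X) (vec_in (chart_at p) Y)
    (chart_at p p).

Definition almost_complex (J : M -> 'M[R]_n) : Prop :=
  smooth_endo J /\ forall p, J p *m J p = - 1%:M.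

Definition nijenhuis (J : M -> 'M[R]_n) (X Y : M -> 'rV[R]_n) p : 'rV[R]_n :=
  let JX q := X q *m J q in let JY q := Y q *m J q in
  lie_bracket JX JY p - lie_bracket JX Y p *m J p
  - lie_bracket X JY p *m J p - lie_bracket X Y p.

(* Integrability is vanishing of the Nijenhuis tensor, tested on local vector
   fields. *)
Definition integrable_acs (J : M -> 'M[R]_n) : Prop :=
  forall U X Y, open U -> smooth_vec U X -> smooth_vec U Y ->
    forall p, U p -> nijenhuis J X Y p = 0.

Definition riemannian_metric (g : M -> 'M[R]_n) : Prop :=
  [/\ smooth_form g, forall p, (g p)^T = g p
    & forall p (X : 'rV[R]_n), X != 0 -> 0 < (X *m g p *m X^T) 0 0].

Definition almost_hermitian (g J : M -> 'M[R]_n) : Prop :=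
  almost_complex J /\
  forall p (X Y : 'rV[R]_n),
    ((X *m J p) *m g p *m (Y *m J p)^T) 0 0 = (X *m g p *m Y^T) 0 0.

Definition tamed_almost_symplectic (eps J : M -> 'M[R]_n) : Prop :=
  [/\ two_form eps, nondegenerate_form eps, almost_complex J
    & forall p (X : 'rV[R]_n), X != 0 ->
        0 < ((X *m J p) *m eps p *m X^T) 0 0].

(* eps^-1 o J^* o eps *)
Definition conj_endo (eps J : M -> 'M[R]_n) p : 'M[R]_n :=
  eps p *m (J p)^T *m invmx (eps p).

Definition tamed_symplectic (eps J : M -> 'M[R]_n) : Prop :=
  [/\ tamed_almost_symplectic eps J, integrable_acs J,
      integrable_acs (conj_endo eps J) & closed_form eps].

End Fields.

Section Generalized.
Variables (R : realType) (n : nat) (M : manifold R n).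
Local Notation C := R[i].
Local Notation iC := ('i%C : C).

Definition toC (m k : nat) (A : 'M[R]_(m, k)) : 'M[C]_(m, k) :=
  map_mx (real_complex R) A.
Definition mxRe (m k : nat) (A : 'M[C]_(m, k)) : 'M[R]_(m, k) :=
  map_mx (@complex.Re R) A.
Definition mxIm (m k : nat) (A : 'M[C]_(m, k)) : 'M[R]_(m, k) :=
  map_mx (@complex.Im R) A.
Definition mxconj (m k : nat) (A : 'M[C]_(m, k)) : 'M[C]_(m, k) :=
  map_mx (@conjc R) A.

(* <X + alpha, Y + beta> = (alpha(Y) + beta(X)) / 2 *)
Definition pairing (F : fieldType) (u v : 'rV[F]_(n + n)) : F :=
  2^-1 * ((rsubmx u *m (lsubmx v)^T) 0 0 + (rsubmx v *m (lsubmx u)^T) 0 0).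

Definition courant (u v : M -> 'rV[R]_(n + n)) (p : M) : 'rV[R]_(n + n) :=
  courant_Rn (gen_in (chart_at p) u) (gen_in (chart_at p) v) (chart_at p p).

(* complex bilinear extension *)
Definition courantC (u v : M -> 'rV[C]_(n + n)) (p : M) : 'rV[C]_(n + n) :=
  let u0 q := mxRe (u q) in let u1 q := mxIm (u q) in
  let v0 q := mxRe (v q) in let v1 q := mxIm (v q) in
  toC (courant u0 v0 p - courant u1 v1 p)
  + iC *: toC (courant u0 v1 p + courant u1 v0 p).

Definition smooth_genC (m : nat) (U : set M) (u : M -> 'M[C]_(m, n + n))
    : Prop :=
  smooth_gen U (fun q => mxRe (u q)) /\ smooth_gen U (fun q => mxIm (u q)).

(* A family of complex subspaces of the fibres of (TM (+) T*M)^C is given by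
   matrices whose row spaces are these subspaces; it is only meaningful up to
   equality of row spaces. *)
Definition subspaces := M -> 'M[C]_(n + n).
Implicit Types L : subspaces.

Definition same_subspaces L L' : Prop := forall p, (L p == L' p)%MS.

Definition subbundle L : Prop :=
  exists r : nat, forall p, exists (U : set M) (s : M -> 'M[C]_(r, n + n)),
    [/\ open U, U p, smooth_genC U s
      & forall q, U q -> row_free (s q) /\ (s q == L q)%MS].

Definition isotropic (A : 'M[C]_(n + n)) : Prop :=
  forall u v : 'rV[C]_(n + n), (u <= A)%MS -> (v <= A)%MS -> pairing u v = 0.

Definition maximal_isotropic (A : 'M[C]_(n + n)) : Prop :=
  isotropic A /\
  forall A' : 'M[C]_(n + n), isotropic A' -> (A <= A')%MS -> (A' <= A)%MS.

Definition gen_almost_complex L : Prop :=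
  [/\ subbundle L, forall p, maximal_isotropic (L p)
    & forall p, (L p :&: mxconj (L p))%MS = 0].

Definition section_on (U : set M) L (u : M -> 'rV[C]_(n + n)) : Prop :=
  smooth_genC U u /\ forall q, U q -> (u q <= L q)%MS.

(* Closedness is about (local) smooth sections; as a bracket of smooth sections
   is smooth, only membership in L is required of the bracket. *)
Definition courant_closed L : Prop :=
  forall U u v, open U -> section_on U L u -> section_on U L v ->
    forall p, U p -> (courantC u v p <= L p)%MS.

Definition gen_complex L : Prop := gen_almost_complex L /\ courant_closed L.

(* JJ is the (real) endomorphism field of TM (+) T*M with i-eigenbundle L;
   when L is generalized almost complex it is determined by L. *)
Definition endo_of (JJ : M -> 'M[R]_(n + n)) L : Prop :=
  forall p, JJ p *m JJ p = - 1%:M /\ (eigenspace (toC (JJ p)) iC == L p)%MS.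

Definition gen_kahler L1 L2 : Prop :=
  [/\ gen_complex L1, gen_complex L2
    & exists JJ1 JJ2 : M -> 'M[R]_(n + n),
      [/\ endo_of JJ1 L1, endo_of JJ2 L2,
          forall p, JJ1 p *m JJ2 p = JJ2 p *m JJ1 p
        & forall p (v : 'rV[R]_(n + n)), v != 0 ->
            pairing (v *m (JJ1 p *m JJ2 p)) v < 0]].

Definition hermitian_quadruple (g b Jp Jm : M -> 'M[R]_n) : Prop :=
  [/\ riemannian_metric g, two_form b, almost_hermitian g Jp
    & almost_hermitian g Jm].

(* { X + E(X) | X in the i-eigenbundle of J } *)
Definition graph_on_eigen (E J : M -> 'M[R]_n) (p : M) : 'M[C]_(n, n + n) :=
  eigenspace (toC (J p)) iC *m row_mx 1%:M (toC (E p)).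

Definition Lplus (g b Jp : M -> 'M[R]_n) : M -> 'M[C]_(n, n + n) :=
  graph_on_eigen (fun p => b p + g p) Jp.
Definition Lminus (g b Jm : M -> 'M[R]_n) : M -> 'M[C]_(n, n + n) :=
  graph_on_eigen (fun p => b p - g p) Jm.

Definition quad_L1 (g b Jp Jm : M -> 'M[R]_n) : subspaces :=
  fun p => (Lplus g b Jp p + Lminus g b Jm p)%MS.
Definition quad_L2 (g b Jp Jm : M -> 'M[R]_n) : subspaces :=
  fun p => (Lplus g b Jp p + mxconj (Lminus g b Jm p))%MS.

Definition quad_gen_kahler (g b Jp Jm : M -> 'M[R]_n) : Prop :=
  hermitian_quadruple g b Jp Jm /\
  gen_kahler (quad_L1 g b Jp Jm) (quad_L2 g b Jp Jm).

(* L1 and L2 are the bundles attached to the quadruple (g, b, Jp, Jm). *)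
Definition given_by_quadruple L1 L2 (g b Jp Jm : M -> 'M[R]_n) : Prop :=
  [/\ hermitian_quadruple g b Jp Jm,
      same_subspaces L1 (quad_L1 g b Jp Jm)
    & same_subspaces L2 (quad_L2 g b Jp Jm)].

(* exp(B)(X + alpha) = X + iota_X B + alpha *)
Definition expB (B : M -> 'M[R]_n) L : subspaces :=
  fun p => L p *m toC (block_mx 1%:M (B p) 0 1%:M).

Definition J_plus (eps J : M -> 'M[R]_n) : M -> 'M[R]_n := J.
Definition J_minus (eps J : M -> 'M[R]_n) : M -> 'M[R]_n :=
  fun p => - conj_endo eps J p.
(* The matrix of eps J is J *m eps in the row-vector convention. *)
Definition sym_part (eps J : M -> 'M[R]_n) : M -> 'M[R]_n :=
  fun p => 2^-1 *: (J p *m eps p + (J p *m eps p)^T).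
Definition skew_part (eps J : M -> 'M[R]_n) : M -> 'M[R]_n :=
  fun p => 2^-1 *: (J p *m eps p - (J p *m eps p)^T).

End Generalized.

(* Main.v *)
(* Write A for the part of b + g left after removing J+ eps, i.e.
   b + g = A + J+ eps and b - g = A - J- eps.  On the i-eigenvectors of J+
   the form b + g is A + i eps, and so is b - g on those of -J-.  Hence L2 is the
   graph of the complex two-form A + i eps, and it is closed under the Courant
   bracket iff dA = 0 and d eps = 0.  For the form eps J one has A = 0; in general -A is the
   B-field that is needed, and eps is forced by (J+ + J-) eps = 2g.

   If L1 and L2 are closed, so are L+ = L1 n L2 and conj(L-) = L2 n conj(L1);
   the vector parts of the brackets of the sections over JX + iX give the
   Nijenhuis tensors of J+ and J-.  Conversely L+ and L- are closed when J+ and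
   J- are integrable and eps is closed, being graphs of i eps and -i eps over
   involutive eigenbundles.  As <[u, v], w> is cyclic on isotropic sections, it
   vanishes also for u, v, w taken from both of L+ and L-, and L1 = L+ (+) L- is
   maximal isotropic, hence closed.

   All identities are checked at a point p in the chart [chart_at p], where the
   components of a field at p are its value; only the first derivatives of the
   fields enter. *)
Require Import Defs.
From HB Require Import structures.
From mathcomp Require Import all_boot all_order all_algebra.
From mathcomp Require Import all_classical all_reals all_analysis.
From mathcomp Require Import complex.
From mathcomp Require Import ring.

Set Implicit Arguments.
Unset Strict Implicit.
Unset Printing Implicit Defensive.
Import Order.TTheory GRing.Theory Num.Theory numFieldNormedType.Exports.
Local Open Scope classical_set_scope.
Local Open Scope ring_scope.

(** Closedness is read off from the pairing of a Courant bracket with a constant test vector: this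
    pairing involves only first derivatives of the two sections, is trilinear over the complex
    constants, and decides membership in a maximal isotropic subspace. Cyclicity needs a third
    section where only a vector is given; projecting constants to the eigenbundles of J+ and J-
    extends the vector to one. A section of L1 must also be split differentiably into its parts in
    L+ and L-. If X and Y are their vector parts, the covector part is i eps(X - Y), so the
    nondegeneracy of eps recovers X and Y from it and X + Y.

    Maximal isotropy, smooth local frames and the commuting endomorphisms come from one
    construction: the real endomorphism that acts as J+ on the graph of b + g and as K on the graph
    of b - g. Its i-eigenbundle is L1 for K = J- and L2 for K = -J-. The two graphs are orthogonal,
    with pairings of opposite signs, which makes the product of the two endomorphisms negative
    definite.

    Uniqueness of the B-field comes from recovering the whole quadruple from L1 n L2 and L2 n
    conj(L1). *)

Lemma half_double (F : numFieldType) (V : lmodType F) (a : V) : 2^-1 *: (a + a) = a.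
Proof. by rewrite -mulr2n -[a *+ 2]scaler_nat scalerA mulVf ?scale1r // pnatr_eq0. Qed.

(** * Smooth functions *)

Section SmoothCalculus.
Variables (R : realType) (V : normedModType R).
Implicit Types (A : set V) (x v : V) (k : nat).

Lemma differentiable_mxP (m n : nat) (f : V -> 'M[R]_(m, n)) x :
  differentiable f x <-> forall i j, differentiable (fun y => f y i j) x.
Proof.
split=> [df i j|df].
  exact: (differentiable_comp df (differentiable_coord (f x) i j)).
rewrite (_ : f = \sum_(i < m) \sum_(j < n) (fun y => f y i j *: delta_mx i j)).
  by do 2!apply: differentiable_sum => ?; exact: differentiableZl.
apply/funext => y; rewrite [LHS]matrix_sum_delta fct_sumE.
by apply: eq_bigr => i _; rewrite fct_sumE.
Qed.

Lemma derive_mxE (m n : nat) (f : V -> 'M[R]_(m, n)) x v i j :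
  differentiable f x -> ('D_v f x) i j = 'D_v (fun y => f y i j) x.
Proof. by move=> df; rewrite derive_mx ?mxE//; exact: diff_derivable. Qed.

(** The difference [g - f] vanishes near [x], hence is [0 + o(id)] there, and this expansion makes
    it differentiable with zero differential. *)
Lemma differentiable_near_eq (W : normedModType R) (f g : V -> W) x :
  (\near x, f x = g x) -> differentiable f x -> differentiable g x.
Proof.
move=> fg df; rewrite (_ : g = f + (g - f)); last by rewrite addrC subrK.
apply: differentiableD => //; set h := g - f.
have h0 : \near x, h x = 0.
  by near=> y; rewrite /h !fctE (near fg y)// subrr.
have hE : h \o shift x = cst (h x) + \0 +o_ 0 id.
  apply/eqaddoP => e e0; move: (h0); rewrite (near_shift 0) subr0.
  apply: filterS => y /= hy.
  by rewrite !fctE /= hy (nbhs_singleton h0) !(add0r, oppr0, addr0) normr0 mulr_ge0// ltW.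
have cst0 : continuous (\0 : V -> W) by move=> ?; exact: cvg_cst.
by apply/diff_locallyP; rewrite (diff_unique cst0 hE).
Unshelve. all: by end_near. Qed.

Lemma differentiable_upto_le A (W : normedModType R) k l (f : V -> W) :
  (l <= k)%N -> differentiable_upto k A f -> differentiable_upto l A f.
Proof.
elim: k l f => [|k IH] [|l] f //= lk [df dDf]; split=> // v; exact: IH.
Qed.

(** Openness of [A] turns agreement on [A] into agreement near each of its points, so the
    derivatives agree on [A] as well and the induction goes on. *)
Lemma differentiable_upto_eq A (W : normedModType R) k (f g : V -> W) :
  open A -> {in A, f =1 g} ->
  differentiable_upto k A f -> differentiable_upto k A g.
Proof.
move=> oA; elim: k f g => [|k IH] f g fg /= [df dDf].
  split=> // x Ax; apply: (differentiable_near_eq _ (df x Ax)).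
  by apply: filterS (open_nbhs_nbhs (conj oA Ax)) => y Ay; rewrite fg ?inE.
have fgn x : A x -> \near x, f x = g x.
  by move=> Ax; apply: filterS (open_nbhs_nbhs (conj oA Ax)) => y Ay; rewrite fg ?inE.
split=> [x Ax|v]; first by apply: differentiable_near_eq (df x Ax); exact: fgn.
by apply: IH (dDf v) => x; rewrite inE => Ax; apply: near_eq_derive; exact: fgn.
Qed.

Lemma differentiable_upto_sub A B (W : normedModType R) k (f : V -> W) :
  B `<=` A -> differentiable_upto k A f -> differentiable_upto k B f.
Proof.
move=> BA; elim: k f => [|k IH] f /= [df dDf]; split.
- by move=> x /BA/df.
- by [].
- by move=> x /BA/df.
- by move=> v; exact: IH.
Qed.

Lemma differentiable_upto_mxP A (m n k : nat) (f : V -> 'M[R]_(m, n)) :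
  open A ->
  differentiable_upto k A f <->
  forall i j, differentiable_upto k A (fun x => f x i j).
Proof.
move=> oA; elim: k f => [|k IH] f /=.
  split=> [[df _] i j|df]; first by split=> // x /df/differentiable_mxP.
  by split=> // x Ax; apply/differentiable_mxP => i j; have [/(_ x Ax)] := df i j.
split=> [[df dDf] i j|df].
  split=> [x /df/differentiable_mxP//|v].
  apply: differentiable_upto_eq ((IH _).1 (dDf v) i j) => // x; rewrite inE => /df dfx.
  exact: derive_mxE.
have dfx x : A x -> differentiable f x.
  by move=> Ax; apply/differentiable_mxP => i j; have [/(_ x Ax)] := df i j.
split=> // v; apply/IH => i j; have [_ /(_ v)] := df i j.
apply: differentiable_upto_eq => // x; rewrite inE => /dfx ?.
by rewrite derive_mxE.
Qed.

Lemma differentiable_upto_cst A (W : normedModType R) k (a : W) :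
  differentiable_upto k A (fun=> a : W).
Proof.
elim: k a => [|k IH] a /=; split=> // v.
by rewrite (_ : 'D_v _ = fun=> 0) //; apply/funext => x; exact: derive_cst.
Qed.

Lemma differentiable_uptoD A (W : normedModType R) k (f g : V -> W) :
  open A -> differentiable_upto k A f -> differentiable_upto k A g ->
  differentiable_upto k A (fun x => f x + g x).
Proof.
move=> oA; elim: k f g => [|k IH] f g /= [df dDf] [dg dDg].
  by split=> // x Ax; apply: differentiableD; [exact: df|exact: dg].
split=> [x Ax|v]; first by apply: differentiableD; [exact: df|exact: dg].
apply: differentiable_upto_eq (IH _ _ (dDf v) (dDg v)) => // x; rewrite inE => Ax.
by rewrite deriveD //; apply: diff_derivable; [exact: df|exact: dg].
Qed.

Lemma differentiable_upto_sum A (W : normedModType R) k (I : Type) (r : seq I)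
    (P : pred I) (f : I -> V -> W) :
  open A -> (forall i, P i -> differentiable_upto k A (f i)) ->
  differentiable_upto k A (fun x => \sum_(i <- r | P i) f i x).
Proof.
move=> oA df; elim: r => [|i r IH].
  rewrite (_ : (fun _ => _) = fun=> 0); first exact: differentiable_upto_cst.
  by apply/funext => x; rewrite big_nil.
rewrite (_ : (fun _ => _) = fun x => (if P i then f i x else 0) +
    \sum_(i <- r | P i) f i x).
  apply: differentiable_uptoD => //; case Pi: (P i); first exact: df.
  exact: differentiable_upto_cst.
by apply/funext => x; rewrite big_cons; case: ifP => //; rewrite add0r.
Qed.

(** The Leibniz rule multiplies the derivative of one factor by the other factor itself, so both
    factors are also needed at order [k], one less than what is given. *)
Lemma differentiable_uptoM A k (f g : V -> R) :
  open A -> differentiable_upto k A f -> differentiable_upto k A g ->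
  differentiable_upto k A (fun x => f x * g x).
Proof.
move=> oA; elim: k f g => [|k IH] f g /= [df dDf] [dg dDg].
  by split=> // x Ax; apply: differentiableM; [exact: df|exact: dg].
split=> [x Ax|v]; first by apply: differentiableM; [exact: df|exact: dg].
have fk : differentiable_upto k A f by apply: (@differentiable_upto_le _ _ k.+1).
have gk : differentiable_upto k A g by apply: (@differentiable_upto_le _ _ k.+1).
apply: differentiable_upto_eq
  (differentiable_uptoD oA (IH _ _ fk (dDg v)) (IH _ _ gk (dDf v))) => // x.
rewrite inE => Ax.
by rewrite deriveM //; apply: diff_derivable; [exact: df|exact: dg].
Qed.

Lemma differentiable_upto_prod A k (I : Type) (r : seq I)
    (P : pred I) (f : I -> V -> R) :
  open A -> (forall i, P i -> differentiable_upto k A (f i)) ->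
  differentiable_upto k A (fun x => \prod_(i <- r | P i) f i x).
Proof.
move=> oA df; elim: r => [|i r IH].
  rewrite (_ : (fun _ => _) = fun=> 1); first exact: differentiable_upto_cst.
  by apply/funext => x; rewrite big_nil.
rewrite (_ : (fun _ => _) = fun x => (if P i then f i x else 1) *
    \prod_(i <- r | P i) f i x).
  apply: differentiable_uptoM => //; case Pi: (P i); first exact: df.
  exact: differentiable_upto_cst.
by apply/funext => x; rewrite big_cons; case: ifP => //; rewrite mul1r.
Qed.

(** The derivative of [1 / f] is [-(1 / f)^2 f']: the induction hypothesis applied to [1 / f] at
    order [k] and the product rule yield order [k.+1]. *)
Lemma differentiable_uptoV A k (f : V -> R) :
  open A -> (forall x, A x -> f x != 0) -> differentiable_upto k A f ->
  differentiable_upto k A (fun x => (f x)^-1).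
Proof.
move=> oA f0; elim: k f f0 => [|k IH] f f0 /= [df dDf].
  by split=> // x Ax; apply: differentiableV; [exact: df|exact: f0].
split=> [x Ax|v]; first by apply: differentiableV; [exact: df|exact: f0].
have fk : differentiable_upto k A f by apply: (@differentiable_upto_le _ _ k.+1).
have Vk := IH _ f0 fk.
have := differentiable_uptoM oA (differentiable_upto_cst A k (-1 : R))
  (differentiable_uptoM oA (differentiable_uptoM oA Vk Vk) (dDf v)).
apply: differentiable_upto_eq => // x; rewrite inE => Ax.
rewrite deriveV ?f0//; last exact/diff_derivable/df.
by rewrite mulN1r scaleNr /GRing.scale /= -exprVn expr2.
Qed.

Lemma smooth_on_eq A (W : normedModType R) (f g : V -> W) :
  open A -> {in A, f =1 g} -> smooth_on A f -> smooth_on A g.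
Proof. by move=> oA fg sf k; exact: differentiable_upto_eq (sf k). Qed.

Lemma smooth_on_sub A B (W : normedModType R) (f : V -> W) :
  B `<=` A -> smooth_on A f -> smooth_on B f.
Proof. by move=> BA sf k; exact: differentiable_upto_sub (sf k). Qed.

Lemma smooth_on_cst A (W : normedModType R) (a : W) :
  smooth_on A (fun=> a : W).
Proof. by move=> k; exact: differentiable_upto_cst. Qed.

Lemma smooth_on_differentiable A (W : normedModType R) (f : V -> W) x :
  smooth_on A f -> A x -> differentiable f x.
Proof. by move=> /(_ 0)[/= df _] /df. Qed.

Lemma smooth_on_derive A (W : normedModType R) (f : V -> W) v :
  smooth_on A f -> smooth_on A (fun x => 'D_v f x).
Proof. by move=> sf k; have [_ /(_ v)] := sf k.+1. Qed.

Lemma smooth_on_mxP A (m n : nat) (f : V -> 'M[R]_(m, n)) :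
  open A -> smooth_on A f <-> forall i j, smooth_on A (fun x => f x i j).
Proof.
by move=> oA; split=> [sf i j k|sf k]; [|apply/differentiable_upto_mxP => // i j];
  [exact: ((differentiable_upto_mxP _ _ oA).1 (sf k))|exact: sf].
Qed.

Lemma smooth_onD A (W : normedModType R) (f g : V -> W) :
  open A -> smooth_on A f -> smooth_on A g -> smooth_on A (fun x => f x + g x).
Proof. by move=> oA sf sg k; exact: differentiable_uptoD. Qed.

Lemma smooth_on_det A (n : nat) (f : V -> 'M[R]_n) :
  open A -> smooth_on A f -> smooth_on A (fun x => \det (f x)).
Proof.
move=> oA /(smooth_on_mxP _ oA) sf k.
apply: differentiable_upto_sum => // s _; apply: differentiable_uptoM => //.
  exact: differentiable_upto_cst.
by apply: differentiable_upto_prod => // i _; exact: sf.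
Qed.

Lemma smooth_on_mulmx A (m n p : nat) (f : V -> 'M[R]_(m, n)) (g : V -> 'M[R]_(n, p)) :
  open A -> smooth_on A f -> smooth_on A g -> smooth_on A (fun x => f x *m g x).
Proof.
move=> oA /(smooth_on_mxP _ oA) sf /(smooth_on_mxP _ oA) sg.
apply/smooth_on_mxP => // i j k.
rewrite (_ : (fun _ => _) = fun x => \sum_l f x i l * g x l j); last first.
  by apply/funext => x; rewrite mxE.
apply: differentiable_upto_sum => // l _.
by apply: differentiable_uptoM => //; [exact: sf|exact: sg].
Qed.

Lemma smooth_onZ A (m n : nat) (f : V -> 'M[R]_(m, n)) a :
  open A -> smooth_on A f -> smooth_on A (fun x => a *: f x).
Proof.
move=> oA sf; rewrite (_ : (fun _ => _) = fun x => a%:M *m f x); last first.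
  by apply/funext => x; rewrite mul_scalar_mx.
by apply: smooth_on_mulmx => //; exact: smooth_on_cst.
Qed.

Lemma smooth_onN A (m n : nat) (f : V -> 'M[R]_(m, n)) :
  open A -> smooth_on A f -> smooth_on A (fun x => - f x).
Proof.
move=> oA sf; rewrite (_ : (fun _ => _) = fun x => -1 *: f x); last first.
  by apply/funext => x; rewrite scaleN1r.
exact: smooth_onZ.
Qed.

Lemma smooth_on_trmx A (m n : nat) (f : V -> 'M[R]_(m, n)) :
  open A -> smooth_on A f -> smooth_on A (fun x => (f x)^T).
Proof.
move=> oA /(smooth_on_mxP _ oA) sf; apply/smooth_on_mxP => // i j.
by rewrite (_ : (fun _ => _) = fun x => f x j i) //; apply/funext => x; rewrite mxE.
Qed.

Lemma smooth_on_row_mx A (m n p : nat) (f : V -> 'M[R]_(m, n)) (g : V -> 'M[R]_(m, p)) :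
  open A -> smooth_on A f -> smooth_on A g -> smooth_on A (fun x => row_mx (f x) (g x)).
Proof.
move=> oA /(smooth_on_mxP _ oA) sf /(smooth_on_mxP _ oA) sg.
apply/smooth_on_mxP => // i j.
rewrite (_ : (fun _ => _) = fun x => match fintype.split j with
    inl l => f x i l | inr l => g x i l end); last by apply/funext => x; rewrite mxE.
by case: (fintype.split j) => l.
Qed.

Lemma smooth_on_col_mx A (m n p : nat) (f : V -> 'M[R]_(m, p)) (g : V -> 'M[R]_(n, p)) :
  open A -> smooth_on A f -> smooth_on A g -> smooth_on A (fun x => col_mx (f x) (g x)).
Proof.
move=> oA sf sg; rewrite (_ : (fun _ => _) =
  fun x => (row_mx (f x)^T (g x)^T)^T); last first.
  by apply/funext => x; rewrite tr_row_mx !trmxK.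
by apply: smooth_on_trmx => //; apply: smooth_on_row_mx => //; apply: smooth_on_trmx.
Qed.

Lemma smooth_on_block_mx A (m1 m2 n1 n2 : nat) (f1 : V -> 'M[R]_(m1, n1))
    (f2 : V -> 'M[R]_(m1, n2)) (f3 : V -> 'M[R]_(m2, n1)) (f4 : V -> 'M[R]_(m2, n2)) :
  open A -> smooth_on A f1 -> smooth_on A f2 -> smooth_on A f3 -> smooth_on A f4 ->
  smooth_on A (fun x => block_mx (f1 x) (f2 x) (f3 x) (f4 x)).
Proof.
by move=> oA ? ? ? ?; apply: smooth_on_col_mx => //; apply: smooth_on_row_mx.
Qed.

(** Cramer's rule: on the set of invertibility the inverse is the adjugate over the determinant, and
    cofactors are, up to sign, determinants of submatrices of [f]. *)
Lemma smooth_on_invmx A (n : nat) (f : V -> 'M[R]_n) :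
  open A -> (forall x, A x -> f x \in unitmx) -> smooth_on A f ->
  smooth_on A (fun x => invmx (f x)).
Proof.
move=> oA fu sf; apply: (@smooth_on_eq _ _ (fun x => (\det (f x))^-1 *: \adj (f x))) => //.
  by move=> x; rewrite inE => /fu fx; rewrite /invmx fx.
apply/smooth_on_mxP => // i j k.
rewrite (_ : (fun _ => _) = fun x => (\det (f x))^-1 * cofactor (f x) j i); last first.
  by apply/funext => x; rewrite !mxE.
apply: differentiable_uptoM => //.
  apply: differentiable_uptoV => // [x /fu|]; last exact: smooth_on_det.
  by rewrite unitmxE unitfE.
apply: differentiable_uptoM => //; first exact: differentiable_upto_cst.
apply: smooth_on_det => //; apply/smooth_on_mxP => // a b.
rewrite (_ : (fun _ => _) = fun x => f x (lift j a) (lift i b)); last first.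
  by apply/funext => x; rewrite !mxE.
exact: ((smooth_on_mxP _ oA).1 sf).
Qed.

End SmoothCalculus.

(** * Chain rule and composition of smooth maps *)

Section SmoothComposition.
Variables (R : realType) (V : normedModType R) (n : nat).

Lemma derive_rV_comp (W : normedModType R) (phi : V -> 'rV[R]_n) (f : 'rV[R]_n -> W) x v :
  differentiable phi x -> differentiable f (phi x) ->
  'D_v (f \o phi) x = \sum_i ('D_v phi x) 0 i *: 'D_(basis_vec R i) f (phi x).
Proof.
move=> dphi df.
have -> : 'D_v (f \o phi) x = 'd f (phi x) ('D_v phi x).
  by rewrite (deriveE _ (differentiable_comp dphi df)) diff_comp //= (deriveE _ dphi).
rewrite [X in diff _ _ X]row_sum_delta linear_sum.
by apply: eq_bigr => i _; rewrite linearZ /= (deriveE _ df).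
Qed.

(** Induction on the order with [f] varying: by the chain rule a derivative of [f \o phi] is a sum
    of components of a derivative of [phi] times partial derivatives of [f] composed with [phi], and
    these partial derivatives are again smooth on [B]. *)
Lemma smooth_on_comp (A : set V) (B : set 'rV[R]_n) (m p : nat)
    (phi : V -> 'rV[R]_n) (f : 'rV[R]_n -> 'M[R]_(m, p)) :
  open A -> open B -> (forall x, A x -> B (phi x)) ->
  smooth_on A phi -> smooth_on B f -> smooth_on A (f \o phi).
Proof.
move=> oA oB AB sphi sf k; elim: k f sf => [|k IH] f sf /=; split=> //.
- move=> x Ax; apply: differentiable_comp.
    exact: (smooth_on_differentiable sphi).
  exact: (smooth_on_differentiable sf (AB _ Ax)).
- move=> x Ax; apply: differentiable_comp.
    exact: (smooth_on_differentiable sphi).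
  exact: (smooth_on_differentiable sf (AB _ Ax)).
move=> v; apply: (@differentiable_upto_eq _ _ _ _ _ (fun x => \sum_i ('D_v phi x) 0 i *:
   'D_(basis_vec R i) f (phi x))) => //.
  move=> x; rewrite inE => Ax; rewrite derive_rV_comp //.
    exact: (smooth_on_differentiable sphi).
  exact: (smooth_on_differentiable sf (AB _ Ax)).
apply: differentiable_upto_sum => // i _.
have sD := IH _ (smooth_on_derive (basis_vec R i) sf).
have sphi_i := (differentiable_upto_mxP _ _ oA).1 (smooth_on_derive v sphi k).
apply/differentiable_upto_mxP => // a b.
rewrite (_ : (fun _ => _) = fun x => ('D_v phi x) 0 i *
    ('D_(basis_vec R i) f \o phi) x a b); last by apply/funext => x; rewrite mxE.
by apply: differentiable_uptoM => //; exact: ((differentiable_upto_mxP _ _ oA).1 sD).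
Qed.

End SmoothComposition.

(** * Jacobian matrices *)

Section Jacobian.
Variables (R : realType) (m n p : nat).
Implicit Types (f : 'rV[R]_m -> 'rV[R]_n) (x : 'rV[R]_m).

Lemma jacobianE f x i j : differentiable f x ->
  ('J f x) i j = ('D_(basis_vec R i) f x) 0 j.
Proof. by move=> df; rewrite deriveEjacobian // /basis_vec -rowE [RHS]mxE. Qed.

Lemma smooth_on_jacobian A f : open A -> smooth_on A f ->
  smooth_on A (fun x => 'J f x).
Proof.
move=> oA sf; apply/smooth_on_mxP => // i j.
have := (smooth_on_mxP _ oA).1 (smooth_on_derive (basis_vec R i) sf) 0 j.
apply: smooth_on_eq => // x; rewrite inE => Ax; rewrite jacobianE //.
exact: smooth_on_differentiable Ax.
Qed.

Lemma jacobian_comp f (g : 'rV[R]_n -> 'rV[R]_p) x :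
  differentiable f x -> differentiable g (f x) ->
  'J (g \o f) x = 'J f x *m 'J g (f x).
Proof.
move=> df dg; apply/row_matrixP => i; rewrite !rowE mulmxA.
by rewrite /jacobian !mul_rV_lin1 diff_comp.
Qed.

Lemma jacobian_near_eq f g x : differentiable f x ->
  (\near x, f x = g x) -> 'J f x = 'J g x.
Proof.
move=> df fg; have dg := differentiable_near_eq fg df.
apply/matrixP => i j; apply: etrans (jacobianE i j df) _.
apply: etrans (esym (jacobianE i j dg)).
by rewrite (near_eq_derive _ fg).
Qed.

Lemma jacobian_id x : 'J (@id 'rV[R]_m) x = 1%:M.
Proof.
apply/row_matrixP => i; rewrite !rowE -deriveEjacobian // mulmx1.
exact: derive_id.
Qed.

End Jacobian.

(** * Changes of charts *)

(* Locked, since unification would otherwise unfold Jacobians. *)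
HB.lock Definition chart_change (R : realType) (n : nat) (M : manifold R n)
    (c c' : chart R n M) (q : M) : 'M[R]_n :=
  'J (c' \o chart_inv c) (c q).

Section Charts.
Variables (R : realType) (n : nat) (M : manifold R n).
Implicit Types (c : chart R n M) (p q : M) (U : set M).

Local Opaque jacobian.

(** Around a point of the image, the preimage of [U] under [chart_inv c] is a neighbourhood by
    continuity, and its intersection with the open image of the chart domain lies in the image of
    [U]. *)
Lemma open_chart_img c U : open U -> open (c @` (U `&` chart_dom c)).
Proof.
move=> oU; rewrite openE => _ [q [Uq cq] <-]; rewrite /interior.
have oc := @chart_img_open _ _ _ c.
have cx : (c @` chart_dom c) (c q) by exists q.
have ci : {for c q, continuous (chart_inv c)}.
  have := chart_inv_cont (c := c); rewrite continuous_open_subspace // => /(_ (c q)).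
  by apply; rewrite inE.
have nU : nbhs (c q) (chart_inv c @^-1` U).
  by apply: ci; rewrite chart_funK //; exact: open_nbhs_nbhs.
apply: filterS2 nU (open_nbhs_nbhs (conj oc cx)) => y Uy [q' cq' qy].
by exists q' => //; split=> //; move: Uy; rewrite /= -qy chart_funK.
Qed.

Lemma open_chart_img2 c c' : open (c @` (chart_dom c `&` chart_dom c')).
Proof. by rewrite setIC; apply: open_chart_img; exact: chart_dom_open. Qed.

Lemma chart_changeE c c' q : chart_change c c' q = 'J (c' \o chart_inv c) (c q).
Proof. by rewrite unlock. Qed.

Lemma jac_toE c q : jac_to c q = chart_change (chart_at q) c q.
Proof. by rewrite unlock. Qed.

Lemma jac_fromE c q : jac_from c q = chart_change c (chart_at q) q.
Proof. by rewrite unlock. Qed.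

Lemma chart_change_differentiable c c' q : atlas c -> atlas c' ->
  chart_dom c q -> chart_dom c' q -> differentiable (c' \o chart_inv c) (c q).
Proof.
move=> ac ac' cq cq'; apply: (smooth_on_differentiable (transition_smooth ac ac')).
by exists q.
Qed.

(** The chain rule, in the order of row vectors. The composite of the two transition maps agrees
    with the third one only near [c q], which is enough for Jacobians. *)
Lemma chart_change_comp c c' c'' q : atlas c -> atlas c' -> atlas c'' ->
  chart_dom c q -> chart_dom c' q -> chart_dom c'' q ->
  chart_change c c' q *m chart_change c' c'' q = chart_change c c'' q.
Proof.
move=> ac ac' ac'' cq cq' cq''; rewrite !chart_changeE.
have df := chart_change_differentiable ac ac' cq cq'.
have dg := chart_change_differentiable ac' ac'' cq' cq''.
have E : (c' \o chart_inv c) (c q) = c' q by rewrite /= chart_funK.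
have dg' : differentiable (c'' \o chart_inv c') ((c' \o chart_inv c) (c q)).
  by rewrite E.
have := jacobian_comp df dg'; rewrite E => <-.
apply: jacobian_near_eq; first exact: differentiable_comp.
have cx : (c @` (chart_dom c `&` chart_dom c')) (c q) by exists q.
apply: filterS (open_nbhs_nbhs (conj (@open_chart_img2 c c') cx)) => _ [q' [dq dq'] <-].
by rewrite /= !chart_funK.
Qed.

Lemma chart_change_id c q : atlas c -> chart_dom c q -> chart_change c c q = 1%:M.
Proof.
move=> ac cq; rewrite chart_changeE -(jacobian_id (c q)).
apply: jacobian_near_eq; first exact: chart_change_differentiable.
have cx : (c @` (chart_dom c)) (c q) by exists q.
apply: filterS (open_nbhs_nbhs (conj (@chart_img_open _ _ _ c) cx)) => _ [q' dq <-].
by rewrite /= chart_funK.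
Qed.

Lemma chart_changeK c c' q : atlas c -> atlas c' ->
  chart_dom c q -> chart_dom c' q ->
  chart_change c c' q *m chart_change c' c q = 1%:M.
Proof. by move=> ac ac' cq cq'; rewrite (chart_change_comp ac ac' ac) // chart_change_id. Qed.

Lemma smooth_chart_change c c' : atlas c -> atlas c' ->
  smooth_on (c @` (chart_dom c `&` chart_dom c'))
    (fun x => chart_change c c' (chart_inv c x)).
Proof.
move=> ac ac'; have oA := @open_chart_img2 c c'.
apply: (@smooth_on_eq _ _ _ _ (fun x => 'J (c' \o chart_inv c) x)) oA _
  (smooth_on_jacobian oA (transition_smooth ac ac')) => x.
by rewrite inE => -[q [cq _] <-]; rewrite chart_changeE chart_funK.
Qed.

Lemma smooth_chart_change_inv c c' : atlas c -> atlas c' ->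
  smooth_on (c @` (chart_dom c `&` chart_dom c'))
    (fun x => chart_change c' c (chart_inv c x)).
Proof.
move=> ac ac'; have oA := @open_chart_img2 c c'.
apply: (@smooth_on_eq _ _ _ _ ((fun x => chart_change c' c (chart_inv c' x)) \o
  (c' \o chart_inv c)) _ oA); last first.
  apply: smooth_on_comp oA (@open_chart_img2 c' c) _
    (transition_smooth ac ac') (smooth_chart_change ac' ac).
  by move=> _ [q [cq cq'] <-] /=; rewrite chart_funK //; exists q.
by move=> x; rewrite inE => -[q [cq cq'] <-] /=; rewrite !chart_funK.
Qed.

(** Vectors change by the Jacobian, covectors by the transpose of the Jacobian in the opposite
    direction, that is, by the inverse transpose. *)
Definition gen_change c c' q : 'M[R]_(n + n) :=
  block_mx (chart_change c c' q) 0 0 (chart_change c' c q)^T.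

Lemma gen_change_comp c c' c'' q : atlas c -> atlas c' -> atlas c'' ->
  chart_dom c q -> chart_dom c' q -> chart_dom c'' q ->
  gen_change c c' q *m gen_change c' c'' q = gen_change c c'' q.
Proof.
move=> ac ac' ac'' cq cq' cq''; rewrite /gen_change mulmx_block.
rewrite !(mulmx0, mul0mx, addr0, add0r) -trmx_mul.
by rewrite (chart_change_comp ac ac' ac'' cq cq' cq'') (chart_change_comp ac'' ac' ac cq'' cq' cq).
Qed.

Lemma gen_change_id c q : atlas c -> chart_dom c q -> gen_change c c q = 1%:M.
Proof.
by move=> ac cq; rewrite /gen_change chart_change_id // trmx1 -scalar_mx_block.
Qed.

Lemma gen_changeK c c' q : atlas c -> atlas c' ->
  chart_dom c q -> chart_dom c' q ->
  gen_change c c' q *m gen_change c' c q = 1%:M.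
Proof. by move=> ac ac' cq cq'; rewrite (gen_change_comp ac ac' ac) // gen_change_id. Qed.

(** The sections whose components in the chart [c] are the constant rows of [T]; the change of
    charts is there because the values of a field at [q] refer to [chart_at q]. *)
Definition const_gen m c (T : 'M[R]_(m, n + n)) q : 'M[R]_(m, n + n) :=
  T *m gen_change c (chart_at q) q.

Lemma gen_in_const m c c' (T : 'M[R]_(m, n + n)) q : atlas c -> atlas c' ->
  chart_dom c q -> chart_dom c' q ->
  gen_in c' (const_gen c T) (c' q) = T *m gen_change c c' q.
Proof.
move=> ac ac' cq cq'; rewrite /gen_in (chart_funK cq') jac_toE jac_fromE -mulmxA; congr (_ *m _).
exact: (gen_change_comp ac (chart_at_atlas q) ac' cq (chart_at_dom q) cq').
Qed.

Lemma smooth_const_gen m c (T : 'M[R]_(m, n + n)) U : atlas c -> open U ->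
  U `<=` chart_dom c -> smooth_gen U (const_gen c T).
Proof.
move=> ac oU Uc c' ac'; have oA := @open_chart_img c' _ oU.
apply: (@smooth_on_eq _ _ _ _ (fun x => T *m gen_change c c' (chart_inv c' x)) _ oA).
  move=> x; rewrite inE => -[q [/Uc cq cq'] <-].
  by rewrite (gen_in_const _ ac ac' cq cq') (chart_funK cq').
have sub : c' @` (U `&` chart_dom c') `<=` c' @` (chart_dom c' `&` chart_dom c).
  by move=> _ [q [/Uc cq cq'] <-]; exists q.
apply: smooth_on_mulmx => //; first exact: smooth_on_cst.
apply: smooth_on_block_mx => //; try exact: smooth_on_cst.
  by apply: smooth_on_sub sub _; exact: smooth_chart_change_inv.
by apply: smooth_on_trmx => //; apply: smooth_on_sub sub _; exact: smooth_chart_change.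
Qed.

Lemma jac_toK c q : atlas c -> chart_dom c q -> jac_to c q *m jac_from c q = 1%:M.
Proof.
move=> ac cq; rewrite jac_toE jac_fromE.
by apply: chart_changeK => //; [exact: chart_at_atlas|exact: chart_at_dom].
Qed.

Lemma jac_fromK c q : atlas c -> chart_dom c q -> jac_from c q *m jac_to c q = 1%:M.
Proof.
move=> ac cq; rewrite jac_toE jac_fromE.
by apply: chart_changeK => //; [exact: chart_at_atlas|exact: chart_at_dom].
Qed.

Section Coordinates.
Variables (c : chart R n M) (q : M) (ac : atlas c) (cq : chart_dom c q).

(** Reduces coordinate identities to matrix identities: all that is kept of the two Jacobians is
    that they are inverse to each other. *)
Lemma in_chartP (P : 'M[R]_n -> 'M[R]_n -> Prop) :
  (forall A B, A *m B = 1%:M -> B *m A = 1%:M -> P A B) ->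
  P (jac_to c q) (jac_from c q).
Proof. by apply; [exact: jac_toK|exact: jac_fromK]. Qed.

Lemma vec_in_mul X A : vec_in c (fun q => X q *m A q) (c q) =
  vec_in c X (c q) *m endo_in c A (c q).
Proof.
rewrite /vec_in /endo_in chart_funK //; pattern (jac_to c q), (jac_from c q).
by apply: in_chartP => P Q PQ QP; rewrite !mulmxA -(mulmxA _ P) PQ mulmx1.
Qed.

Lemma endo_in_mul A B : endo_in c (fun q => A q *m B q) (c q) =
  endo_in c A (c q) *m endo_in c B (c q).
Proof.
rewrite /endo_in chart_funK //; pattern (jac_to c q), (jac_from c q).
by apply: in_chartP => P Q PQ QP; rewrite !mulmxA -(mulmxA _ P) PQ mulmx1.
Qed.

Lemma endo_in_scalar a : endo_in c (fun=> a%:M) (c q) = a%:M.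
Proof.
rewrite /endo_in chart_funK //; pattern (jac_to c q), (jac_from c q).
by apply: in_chartP => P Q PQ QP; rewrite mul_mx_scalar -scalemxAl QP scalemx1.
Qed.

Lemma endo_inD A B : endo_in c (fun q => A q + B q) (c q) =
  endo_in c A (c q) + endo_in c B (c q).
Proof. by rewrite /endo_in mulmxDr mulmxDl. Qed.

Lemma endo_inN A : endo_in c (fun q => - A q) (c q) = - endo_in c A (c q).
Proof. by rewrite /endo_in mulmxN mulNmx. Qed.

Lemma endo_in_unit A : A q \in unitmx -> endo_in c A (c q) \in unitmx.
Proof.
rewrite /endo_in chart_funK //; pattern (jac_to c q), (jac_from c q).
apply: in_chartP => P Q PQ QP uA; have [uP uQ] := mulmx1_unit PQ.
by rewrite !unitmx_mul uP uQ uA.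
Qed.

Lemma endo_in_inv A : A q \in unitmx ->
  endo_in c (fun q => invmx (A q)) (c q) = invmx (endo_in c A (c q)).
Proof.
rewrite /endo_in chart_funK //; pattern (jac_to c q), (jac_from c q).
apply: in_chartP => P Q PQ QP uA; have [uP uQ] := mulmx1_unit PQ.
have E : Q *m A q *m P \in unitmx by rewrite !unitmx_mul uP uQ uA.
apply: (can_inj (mulKmx E)); rewrite mulmxV // !mulmxA -(mulmxA _ P).
by rewrite PQ mulmx1 -(mulmxA _ (A q)) mulmxV // mulmx1.
Qed.

Lemma form_in_mul A E : form_in c (fun q => A q *m E q) (c q) =
  endo_in c A (c q) *m form_in c E (c q).
Proof.
rewrite /endo_in /form_in chart_funK //; pattern (jac_to c q), (jac_from c q).
by apply: in_chartP => P Q PQ QP; rewrite !mulmxA -(mulmxA _ P) PQ mulmx1.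
Qed.

Lemma form_inD E F : form_in c (fun q => E q + F q) (c q) =
  form_in c E (c q) + form_in c F (c q).
Proof. by rewrite /form_in mulmxDr mulmxDl. Qed.

Lemma form_inN E : form_in c (fun q => - E q) (c q) = - form_in c E (c q).
Proof. by rewrite /form_in mulmxN mulNmx. Qed.

Lemma form_inB E F : form_in c (fun q => E q - F q) (c q) =
  form_in c E (c q) - form_in c F (c q).
Proof. by rewrite form_inD form_inN. Qed.

Lemma form_inZ a E : form_in c (fun q => a *: E q) (c q) = a *: form_in c E (c q).
Proof. by rewrite /form_in -scalemxAr -scalemxAl. Qed.

Lemma form_in_tr E : form_in c (fun q => (E q)^T) (c q) = (form_in c E (c q))^T.
Proof. by rewrite /form_in !trmx_mul trmxK mulmxA. Qed.

Lemma form_in_unit E : E q \in unitmx -> form_in c E (c q) \in unitmx.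
Proof.
rewrite /form_in chart_funK //; pattern (jac_to c q), (jac_from c q).
apply: in_chartP => P Q PQ QP uE; have [uP uQ] := mulmx1_unit PQ.
by rewrite !unitmx_mul unitmx_tr uQ uE.
Qed.

Lemma endo_in_conj E J : E q \in unitmx ->
  endo_in c (conj_endo E J) (c q) =
  form_in c E (c q) *m (endo_in c J (c q))^T *m invmx (form_in c E (c q)).
Proof.
move=> uE; apply: (can_inj (mulmxK (form_in_unit uE))).
rewrite mulmxKV ?form_in_unit // /endo_in /form_in /conj_endo chart_funK //.
pattern (jac_to c q), (jac_from c q); apply: in_chartP => P Q PQ QP.
rewrite !trmx_mul !mulmxA -(mulmxA _ P) PQ mulmx1 mulmxKV //.
by rewrite -(mulmxA _ Q^T P^T) -trmx_mul PQ trmx1 mulmx1.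
Qed.

End Coordinates.

Lemma vec_in_chart_at p X : vec_in (chart_at p) X (chart_at p p) = X p.
Proof.
have cp := chart_at_dom p; rewrite /vec_in chart_funK //.
by rewrite jac_toE chart_change_id ?mulmx1 //; exact: chart_at_atlas.
Qed.

End Charts.

(** * Complex derivatives and the Courant bracket *)

Section ComplexMatrices.
Variable R : realType.
Local Notation C := R[i].

Definition cplx m k (A B : 'M[R]_(m, k)) : 'M[C]_(m, k) :=
  \matrix_(i, j) (A i j +i* B i j)%C.

Lemma ReD (x y : C) : complex.Re (x + y) = complex.Re x + complex.Re y.
Proof. by case: x y => [a b] [c d]. Qed.

Lemma ImD (x y : C) : complex.Im (x + y) = complex.Im x + complex.Im y.
Proof. by case: x y => [a b] [c d]. Qed.

Lemma Re_sum (I : Type) (r : seq I) (P : pred I) (F : I -> C) :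
  complex.Re (\sum_(i <- r | P i) F i) = \sum_(i <- r | P i) complex.Re (F i).
Proof. exact: (big_morph _ ReD). Qed.

Lemma Im_sum (I : Type) (r : seq I) (P : pred I) (F : I -> C) :
  complex.Im (\sum_(i <- r | P i) F i) = \sum_(i <- r | P i) complex.Im (F i).
Proof. exact: (big_morph _ ImD). Qed.

Section Shape.
Variables m k : nat.
Implicit Types A B : 'M[R]_(m, k).

Lemma mxRe_cplx A B : mxRe (cplx A B) = A.
Proof. by apply/matrixP => i j; rewrite !mxE. Qed.

Lemma mxIm_cplx A B : mxIm (cplx A B) = B.
Proof. by apply/matrixP => i j; rewrite !mxE. Qed.

Lemma cplx_ReIm (A : 'M[C]_(m, k)) : cplx (mxRe A) (mxIm A) = A.
Proof. by apply/matrixP => i j; rewrite !mxE; case: (A i j). Qed.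

Lemma cplxE A B : cplx A B = toC A + 'i%C *: toC B.
Proof.
apply/matrixP => i j; rewrite !mxE; apply/eqP; rewrite eq_complex /=.
by rewrite !(mul0r, mulr0, mul1r, subr0, addr0, add0r) !eqxx.
Qed.

Lemma toCE A : toC A = cplx A 0.
Proof. by apply/matrixP => i j; rewrite !mxE. Qed.

Lemma cplxD A B A' B' : cplx A B + cplx A' B' = cplx (A + A') (B + B').
Proof. by apply/matrixP => i j; rewrite !mxE. Qed.

Lemma cplxN A B : - cplx A B = cplx (- A) (- B).
Proof. by apply/matrixP => i j; rewrite !mxE. Qed.

Lemma cplxi A B : 'i%C *: cplx A B = cplx (- B) A.
Proof.
apply/matrixP => i j; rewrite !mxE; apply/eqP; rewrite eq_complex /=.
by rewrite !mul0r !mul1r sub0r add0r !eqxx.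
Qed.

Lemma cplxZ (t : R) A B : (t%:C)%C *: cplx A B = cplx (t *: A) (t *: B).
Proof.
apply/matrixP => i j; rewrite !mxE; apply/eqP; rewrite eq_complex /=.
by rewrite !mul0r subr0 addr0 !eqxx.
Qed.

Lemma mxconj_cplx A B : mxconj (cplx A B) = cplx A (- B).
Proof. by apply/matrixP => i j; rewrite !mxE. Qed.

Lemma cplx_tr A B : (cplx A B)^T = cplx A^T B^T.
Proof. by apply/matrixP => i j; rewrite !mxE. Qed.

Lemma cplx_inj A B A' B' : cplx A B = cplx A' B' -> A = A' /\ B = B'.
Proof.
move=> E; split; first by rewrite -(mxRe_cplx A B) E mxRe_cplx.
by rewrite -(mxIm_cplx A B) E mxIm_cplx.
Qed.

End Shape.

Lemma cplxM m k p (A B : 'M[R]_(m, k)) (A' B' : 'M[R]_(k, p)) :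
  cplx A B *m cplx A' B' = cplx (A *m A' - B *m B') (A *m B' + B *m A').
Proof.
apply/matrixP => i j; rewrite !mxE; apply/eqP; rewrite eq_complex /=.
rewrite Re_sum Im_sum -sumrB -big_split /=.
by apply/andP; split; apply/eqP; apply: eq_bigr => l _; rewrite !mxE.
Qed.

Lemma cplx_row m k p (A B : 'M[R]_(m, k)) (A' B' : 'M[R]_(m, p)) :
  row_mx (cplx A B) (cplx A' B') = cplx (row_mx A A') (row_mx B B').
Proof.
apply/matrixP => i j; rewrite !mxE; case: (fintype.split j) => l; by rewrite !mxE.
Qed.

End ComplexMatrices.

Section RealDerivatives.
Variables (R : realType) (n : nat).
Implicit Types (x v : 'rV[R]_n).

Lemma derive_basis (W : normedModType R) (f : 'rV[R]_n -> W) x v :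
  differentiable f x -> 'D_v f x = \sum_i v 0 i *: 'D_(basis_vec R i) f x.
Proof.
move=> df; rewrite (deriveE _ df) [X in diff _ _ X]row_sum_delta linear_sum.
by apply: eq_bigr => i _; rewrite linearZ /= (deriveE _ df).
Qed.

Lemma differentiable_mulmx m k p (f : 'rV[R]_n -> 'M[R]_(m, k))
    (g : 'rV[R]_n -> 'M[R]_(k, p)) x :
  differentiable f x -> differentiable g x ->
  differentiable (fun y => f y *m g y) x.
Proof.
move=> /differentiable_mxP df /differentiable_mxP dg.
apply/differentiable_mxP => i j.
rewrite (_ : (fun _ => _) = \sum_l ((fun y => f y i l) * (fun y => g y l j))).
  by apply: differentiable_sum => l; exact: differentiableM.
by apply/funext => y; rewrite mxE fct_sumE.
Qed.

Lemma derive_mulmx m k p (f : 'rV[R]_n -> 'M[R]_(m, k))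
    (g : 'rV[R]_n -> 'M[R]_(k, p)) x v :
  differentiable f x -> differentiable g x ->
  'D_v (fun y => f y *m g y) x = 'D_v f x *m g x + f x *m 'D_v g x.
Proof.
move=> df dg; apply/matrixP => i j.
rewrite derive_mxE; last exact: differentiable_mulmx.
have /differentiable_mxP dfE := df; have /differentiable_mxP dgE := dg.
have -> : (fun y => (f y *m g y) i j) =
    \sum_l ((fun y => f y i l) * (fun y => g y l j)).
  by apply/funext => y; rewrite mxE fct_sumE.
rewrite derive_sum; last first.
  by move=> l; apply/diff_derivable/differentiableM.
rewrite [RHS]mxE !mxE -big_split /=; apply: eq_bigr => l _.
rewrite deriveM; [|exact/diff_derivable|exact/diff_derivable].
rewrite (derive_mxE _ _ _ df) (derive_mxE _ _ _ dg) /GRing.scale /= addrC.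
by congr (_ + _); rewrite mulrC.
Qed.

Lemma differentiable_trmx m k (f : 'rV[R]_n -> 'M[R]_(m, k)) x :
  differentiable f x -> differentiable (fun y => (f y)^T) x.
Proof.
move=> /differentiable_mxP df; apply/differentiable_mxP => i j.
by rewrite (_ : (fun _ => _) = fun y => f y j i) //; apply/funext => y; rewrite mxE.
Qed.

Lemma derive_trmx m k (f : 'rV[R]_n -> 'M[R]_(m, k)) x v :
  differentiable f x -> 'D_v (fun y => (f y)^T) x = ('D_v f x)^T.
Proof.
move=> df; apply/matrixP => i j; rewrite derive_mxE; last exact: differentiable_trmx.
rewrite [RHS]mxE (derive_mxE _ _ _ df); congr ('D_v _ x).
by apply/funext => y; rewrite mxE.
Qed.

End RealDerivatives.

Definition cderive (R : realType) n m k v (f : 'rV[R]_n -> 'M[R[i]]_(m, k)) x : 'M[R[i]]_(m, k) :=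
  cplx ('D_v (fun y => mxRe (f y)) x) ('D_v (fun y => mxIm (f y)) x).

(** The Courant bracket differentiates along the vector parts of its arguments, which are complex
    for sections of the complexified bundle; hence the C-linear extension to complex directions. *)
HB.lock Definition dC (R : realType) (n m k : nat) (X : 'rV[R[i]]_n)
    (f : 'rV[R]_n -> 'M[R[i]]_(m, k)) (x : 'rV[R]_n) : 'M[R[i]]_(m, k) :=
  \sum_i X 0 i *: cderive (basis_vec R i) f x.

Section ComplexDerivatives.
Variables (R : realType) (n : nat).
Local Notation C := R[i].
Implicit Types (x v : 'rV[R]_n) (X Y : 'rV[C]_n).

Definition cdifferentiable m k (f : 'rV[R]_n -> 'M[C]_(m, k)) x :=
  differentiable (fun y => mxRe (f y)) x /\ differentiable (fun y => mxIm (f y)) x.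

Lemma dCE m k X (f : 'rV[R]_n -> 'M[C]_(m, k)) x :
  dC X f x = \sum_i X 0 i *: cderive (basis_vec R i) f x.
Proof. by rewrite unlock. Qed.

Lemma cdifferentiableE m k (a b : 'rV[R]_n -> 'M[R]_(m, k)) x :
  differentiable a x -> differentiable b x -> cdifferentiable (fun y => cplx (a y) (b y)) x.
Proof.
move=> da db; split.
  by rewrite (_ : (fun _ => _) = a) //; apply/funext => y; rewrite mxRe_cplx.
by rewrite (_ : (fun _ => _) = b) //; apply/funext => y; rewrite mxIm_cplx.
Qed.

Lemma cderiveE m k v (a b : 'rV[R]_n -> 'M[R]_(m, k)) x :
  cderive v (fun y => cplx (a y) (b y)) x = cplx ('D_v a x) ('D_v b x).
Proof.
rewrite /cderive; congr (cplx ('D_v _ x) ('D_v _ x)); apply/funext => y.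
  by rewrite mxRe_cplx.
by rewrite mxIm_cplx.
Qed.

Section Shape.
Variables (m k : nat) (x : 'rV[R]_n).
Implicit Types (f g : 'rV[R]_n -> 'M[C]_(m, k)).

Lemma cdifferentiable_cst (A : 'M[C]_(m, k)) : cdifferentiable (fun=> A) x.
Proof. by split; exact: differentiable_cst. Qed.

Lemma pd_cst v (A : 'M[C]_(m, k)) : cderive v (fun=> A) x = 0.
Proof.
by rewrite /cderive !derive_cst; apply/matrixP => i j; rewrite !mxE.
Qed.

Lemma cdifferentiableD f g : cdifferentiable f x -> cdifferentiable g x ->
  cdifferentiable (fun y => f y + g y) x.
Proof.
move=> [f0 f1] [g0 g1].
rewrite (_ : (fun _ => _) = fun y => cplx (mxRe (f y) + mxRe (g y)) (mxIm (f y) + mxIm (g y))).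
  by apply: cdifferentiableE; exact: differentiableD.
by apply/funext => y; rewrite -cplxD !cplx_ReIm.
Qed.

Lemma pdD v f g : cdifferentiable f x -> cdifferentiable g x ->
  cderive v (fun y => f y + g y) x = cderive v f x + cderive v g x.
Proof.
move=> [f0 f1] [g0 g1].
rewrite (_ : (fun _ => _) = fun y => cplx (mxRe (f y) + mxRe (g y)) (mxIm (f y) + mxIm (g y))).
  rewrite cderiveE cplxD; congr cplx; by rewrite deriveD //; exact/diff_derivable.
by apply/funext => y; rewrite -cplxD !cplx_ReIm.
Qed.

Lemma cdifferentiable_tr f : cdifferentiable f x -> cdifferentiable (fun y => (f y)^T) x.
Proof.
move=> [f0 f1].
rewrite (_ : (fun _ => _) = fun y => cplx (mxRe (f y))^T (mxIm (f y))^T).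
  by apply: cdifferentiableE; exact: differentiable_trmx.
by apply/funext => y; rewrite -cplx_tr cplx_ReIm.
Qed.

Lemma pd_tr v f : cdifferentiable f x -> cderive v (fun y => (f y)^T) x = (cderive v f x)^T.
Proof.
move=> [f0 f1].
rewrite (_ : (fun _ => _) = fun y => cplx (mxRe (f y))^T (mxIm (f y))^T).
  by rewrite cderiveE !derive_trmx // cplx_tr.
by apply/funext => y; rewrite -cplx_tr cplx_ReIm.
Qed.

Lemma pd_near_eq v f g : (\near x, f x = g x) -> cderive v f x = cderive v g x.
Proof.
by move=> fg; rewrite /cderive; congr cplx; apply: near_eq_derive; apply: filterS fg => y ->.
Qed.

End Shape.

Lemma cplxM_ReIm m k p (A : 'M[C]_(m, k)) (B : 'M[C]_(k, p)) :
  A *m B = cplx (mxRe A *m mxRe B - mxIm A *m mxIm B)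
                (mxRe A *m mxIm B + mxIm A *m mxRe B).
Proof. by rewrite -cplxM !cplx_ReIm. Qed.

Lemma cdifferentiable_mulmx m k p (f : 'rV[R]_n -> 'M[C]_(m, k))
    (g : 'rV[R]_n -> 'M[C]_(k, p)) x :
  cdifferentiable f x -> cdifferentiable g x -> cdifferentiable (fun y => f y *m g y) x.
Proof.
move=> [f0 f1] [g0 g1]; under eq_fun do rewrite cplxM_ReIm.
apply: cdifferentiableE.
  by apply: differentiableB; exact: differentiable_mulmx.
by apply: differentiableD; exact: differentiable_mulmx.
Qed.

Lemma pd_mulmx m k p v (f : 'rV[R]_n -> 'M[C]_(m, k))
    (g : 'rV[R]_n -> 'M[C]_(k, p)) x :
  cdifferentiable f x -> cdifferentiable g x ->
  cderive v (fun y => f y *m g y) x = cderive v f x *m g x + f x *m cderive v g x.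
Proof.
move=> [f0 f1] [g0 g1].
have -> : (fun y => f y *m g y) = fun y =>
    cplx (mxRe (f y) *m mxRe (g y) - mxIm (f y) *m mxIm (g y))
         (mxRe (f y) *m mxIm (g y) + mxIm (f y) *m mxRe (g y)).
  by apply/funext => y; rewrite cplxM_ReIm.
rewrite cderiveE -[in RHS](cplx_ReIm (f x)) -[in RHS](cplx_ReIm (g x)) !cplxM cplxD.
congr cplx.
  rewrite deriveB; try by apply/diff_derivable/differentiable_mulmx.
  by rewrite !derive_mulmx // opprD addrACA.
rewrite deriveD; try by apply/diff_derivable/differentiable_mulmx.
by rewrite !derive_mulmx // addrACA.
Qed.

Lemma dC_mulmx m k p X (f : 'rV[R]_n -> 'M[C]_(m, k))
    (g : 'rV[R]_n -> 'M[C]_(k, p)) x :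
  cdifferentiable f x -> cdifferentiable g x ->
  dC X (fun y => f y *m g y) x = dC X f x *m g x + f x *m dC X g x.
Proof.
move=> df dg; rewrite !dCE mulmx_suml mulmx_sumr -big_split /=; apply: eq_bigr => i _.
by rewrite pd_mulmx // scalerDr scalemxAl scalemxAr.
Qed.

Lemma dCD m k X (f g : 'rV[R]_n -> 'M[C]_(m, k)) x :
  cdifferentiable f x -> cdifferentiable g x ->
  dC X (fun y => f y + g y) x = dC X f x + dC X g x.
Proof.
move=> df dg; rewrite !dCE -big_split /=; apply: eq_bigr => i _.
by rewrite pdD // scalerDr.
Qed.

Lemma dC_cst m k X (A : 'M[C]_(m, k)) x : dC X (fun=> A) x = 0.
Proof. by rewrite !dCE big1 // => i _; rewrite pd_cst scaler0. Qed.

Lemma dC_tr m k X (f : 'rV[R]_n -> 'M[C]_(m, k)) x :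
  cdifferentiable f x -> dC X (fun y => (f y)^T) x = (dC X f x)^T.
Proof.
move=> df; rewrite !dCE linear_sum; apply: eq_bigr => i _.
by rewrite pd_tr // linearZ.
Qed.

Lemma dC_near_eq m k X (f g : 'rV[R]_n -> 'M[C]_(m, k)) x :
  (\near x, f x = g x) -> dC X f x = dC X g x.
Proof. by move=> fg; rewrite !dCE; apply: eq_bigr => i _; rewrite (pd_near_eq _ fg). Qed.

Lemma dC_linear m k (f : 'rV[R]_n -> 'M[C]_(m, k)) x a X Y :
  dC (a *: X + Y) f x = a *: dC X f x + dC Y f x.
Proof.
rewrite !dCE scaler_sumr -big_split; apply: eq_bigr => i _.
by rewrite !mxE scalerDl scalerA.
Qed.

Lemma dC_toC m k v (f : 'rV[R]_n -> 'M[C]_(m, k)) x :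
  cdifferentiable f x -> dC (toC v) f x = cderive v f x.
Proof.
move=> [f0 f1]; rewrite /cderive !(derive_basis _ f0) (derive_basis _ f1) dCE.
have -> (a b : 'I_n -> 'M[R]_(m, k)) :
    cplx (\sum_i a i) (\sum_i b i) = \sum_i cplx (a i) (b i).
  apply/matrixP => i j; rewrite summxE !mxE !summxE.
  by apply/eqP; rewrite eq_complex Re_sum Im_sum /=; apply/andP; split;
    apply/eqP; apply: eq_bigr => l _; rewrite mxE.
by apply: eq_bigr => i _; rewrite -cplxZ mxE.
Qed.

Lemma dC_mulmxr m k p X (f : 'rV[R]_n -> 'M[C]_(m, k)) (A : 'M[C]_(k, p)) x :
  cdifferentiable f x -> dC X (fun y => f y *m A) x = dC X f x *m A.
Proof.
move=> df; rewrite (dC_mulmx _ df (cdifferentiable_cst _ A)).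
by rewrite dC_cst mulmx0 addr0.
Qed.

Lemma dC_mulmxl m k p X (f : 'rV[R]_n -> 'M[C]_(k, p)) (A : 'M[C]_(m, k)) x :
  cdifferentiable f x -> dC X (fun y => A *m f y) x = A *m dC X f x.
Proof.
move=> df; rewrite (dC_mulmx _ (cdifferentiable_cst _ A) df).
by rewrite dC_cst mul0mx add0r.
Qed.

End ComplexDerivatives.

(** * The doubled pairing as a matrix product *)

Definition swap_mx (F : fieldType) n : 'M[F]_(n + n) := block_mx 0 1%:M 1%:M 0.

(* Twice the pairing, as a matrix. *)
HB.lock Definition dpair (F : fieldType) (n m k : nat)
    (u : 'M[F]_(m, n + n)) (v : 'M[F]_(k, n + n)) : 'M[F]_(m, k) :=
  u *m swap_mx F n *m v^T.

Section DoublePairing.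
Variables (F : fieldType) (n : nat).

Lemma dpair_row m k (a b : 'M[F]_(m, n)) (c d : 'M[F]_(k, n)) :
  dpair (row_mx a b) (row_mx c d) = a *m d^T + b *m c^T.
Proof.
rewrite !unlock mul_row_block !mulmx0 !mulmx1 addr0 add0r tr_row_mx mul_row_col.
by rewrite addrC.
Qed.

Lemma dpairE m k (u : 'M[F]_(m, n + n)) (v : 'M[F]_(k, n + n)) :
  dpair u v = lsubmx u *m (rsubmx v)^T + rsubmx u *m (lsubmx v)^T.
Proof. by rewrite -{1}(hsubmxK u) -{1}(hsubmxK v) dpair_row. Qed.

Lemma dpair_tr m k (u : 'M[F]_(m, n + n)) (v : 'M[F]_(k, n + n)) :
  (dpair u v)^T = dpair v u.
Proof. by rewrite !dpairE linearD /= !trmx_mul !trmxK addrC. Qed.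

Lemma dpairC (u v : 'rV[F]_(n + n)) : dpair u v = dpair v u.
Proof. by rewrite -dpair_tr; apply/matrixP => i j; rewrite mxE !ord1. Qed.

Lemma dpairDl m k (u u' : 'M[F]_(m, n + n)) (v : 'M[F]_(k, n + n)) :
  dpair (u + u') v = dpair u v + dpair u' v.
Proof. by rewrite !unlock !mulmxDl. Qed.

Lemma dpairNl m k (u : 'M[F]_(m, n + n)) (v : 'M[F]_(k, n + n)) :
  dpair (- u) v = - dpair u v.
Proof. by rewrite !unlock !mulNmx. Qed.

Lemma dpairBl m k (u u' : 'M[F]_(m, n + n)) (v : 'M[F]_(k, n + n)) :
  dpair (u - u') v = dpair u v - dpair u' v.
Proof. by rewrite dpairDl dpairNl. Qed.

Lemma dpairZl m k a (u : 'M[F]_(m, n + n)) (v : 'M[F]_(k, n + n)) :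
  dpair (a *: u) v = a *: dpair u v.
Proof. by rewrite !unlock -!scalemxAl. Qed.

Lemma dpairDr m k (u : 'M[F]_(m, n + n)) (v v' : 'M[F]_(k, n + n)) :
  dpair u (v + v') = dpair u v + dpair u v'.
Proof. by rewrite !unlock linearD mulmxDr. Qed.

Lemma dpairZr m k a (u : 'M[F]_(m, n + n)) (v : 'M[F]_(k, n + n)) :
  dpair u (a *: v) = a *: dpair u v.
Proof. by rewrite !unlock linearZ -scalemxAr. Qed.

Lemma pairing_dpair (u v : 'rV[F]_(n + n)) : pairing u v = 2^-1 * dpair u v 0 0.
Proof.
have -> : dpair u v 0 0 = (lsubmx u *m (rsubmx v)^T) 0 0 + (rsubmx u *m (lsubmx v)^T) 0 0.
  by rewrite dpairE [LHS]mxE.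
rewrite /pairing addrC; congr (_ * (_ + _)).
have -> : rsubmx v *m (lsubmx u)^T = (lsubmx u *m (rsubmx v)^T)^T by rewrite trmx_mul trmxK.
by rewrite [LHS]mxE.
Qed.

(** Nondegeneracy: [swap_mx] is an involution, hence invertible. This is how a bracket is identified
    from its pairings. *)
Lemma dpair_inj m (u v : 'M[F]_(m, n + n)) :
  (forall w : 'rV[F]_(n + n), dpair u w = dpair v w) -> u = v.
Proof.
have SS : swap_mx F n *m swap_mx F n = 1%:M.
  by rewrite /swap_mx mulmx_block !mulmx0 !mul0mx !mulmx1 !addr0 !add0r -scalar_mx_block.
move=> E; have {}E : u *m swap_mx F n = v *m swap_mx F n.
  apply/matrixP => i j; have /matrixP/(_ i 0) := E (delta_mx 0 j).
  by rewrite !unlock trmx_delta -!colE !mxE.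
by rewrite -[u]mulmx1 -[v]mulmx1 -SS !mulmxA E.
Qed.

Lemma lsubmx_mul m (u : 'M[F]_(m, n + n)) : lsubmx u = u *m col_mx 1%:M 0.
Proof. by rewrite -{2}[u]hsubmxK mul_row_col mulmx1 mulmx0 addr0. Qed.

Lemma rsubmx_mul m (u : 'M[F]_(m, n + n)) : rsubmx u = u *m col_mx 0 1%:M.
Proof. by rewrite -{2}[u]hsubmxK mul_row_col mulmx1 mulmx0 add0r. Qed.

Lemma lsubmxD m (u v : 'M[F]_(m, n + n)) : lsubmx (u + v) = lsubmx u + lsubmx v.
Proof. by rewrite !lsubmx_mul mulmxDl. Qed.

Lemma rsubmxD m (u v : 'M[F]_(m, n + n)) : rsubmx (u + v) = rsubmx u + rsubmx v.
Proof. by rewrite !rsubmx_mul mulmxDl. Qed.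

End DoublePairing.

Section ToC.
Variables (R : realType) (m k : nat).
Implicit Types A B : 'M[R]_(m, k).

Lemma toCD A B : toC (A + B) = toC A + toC B. Proof. exact: map_mxD. Qed.
Lemma toCN A : toC (- A) = - toC A. Proof. exact: map_mxN. Qed.
Lemma toCB A B : toC (A - B) = toC A - toC B. Proof. by rewrite toCD toCN. Qed.
Lemma toCM p A (B : 'M[R]_(k, p)) : toC (A *m B) = toC A *m toC B.
Proof. exact: map_mxM. Qed.
Lemma toCZ a A : toC (a *: A) = (a%:C)%C *: toC A. Proof. exact: map_mxZ. Qed.
Lemma toC_tr A : toC A^T = (toC A)^T. Proof. by apply/matrixP => i j; rewrite !mxE. Qed.
Lemma toC1 : toC (1%:M : 'M[R]_m) = 1%:M. Proof. exact: map_mx1. Qed.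
Lemma toC0 : toC (0 : 'M[R]_(m, k)) = 0. Proof. exact: map_mx0. Qed.
Lemma toC_row p A (B : 'M[R]_(m, p)) : toC (row_mx A B) = row_mx (toC A) (toC B).
Proof. exact: map_row_mx. Qed.

End ToC.

Lemma toC_lsub (R : realType) m k p (A : 'M[R]_(m, k + p)) : toC (lsubmx A) = lsubmx (toC A).
Proof. exact: map_lsubmx. Qed.

Lemma toC_rsub (R : realType) m k p (A : 'M[R]_(m, k + p)) : toC (rsubmx A) = rsubmx (toC A).
Proof. exact: map_rsubmx. Qed.

Lemma toC_dpair (R : realType) n m k (u : 'M[R]_(m, n + n)) (v : 'M[R]_(k, n + n)) :
  toC (dpair u v) = dpair (toC u) (toC v).
Proof. by rewrite !dpairE toCD !toCM !toC_tr !toC_lsub !toC_rsub. Qed.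

(** * The Courant bracket tested by the pairing *)

Section CourantPairing.
Variables (R : realType) (n : nat).
Local Notation C := R[i].

Section Real.
Implicit Types (u v : 'rV[R]_n -> 'rV[R]_(n + n)) (x : 'rV[R]_n) (w : 'rV[R]_(n + n)).

(* <[u, v], w>, doubled: the Courant bracket tested against a constant [w]. *)
Definition courant_form_Rn u v x w : 'M[R]_1 :=
  dpair ('D_(lsubmx (u x)) v x - 'D_(lsubmx (v x)) u x) w +
  2^-1 *: (dpair ('D_(lsubmx w) u x) (v x) - dpair ('D_(lsubmx w) v x) (u x)).

Lemma derive_mulmx_cst m k p (f : 'rV[R]_n -> 'M[R]_(m, k)) (A : 'M[R]_(k, p)) x h :
  differentiable f x -> 'D_h (fun y => f y *m A) x = 'D_h f x *m A.
Proof.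
move=> df; rewrite (derive_mulmx _ df (differentiable_cst A _)).
by rewrite derive_cst mulmx0 addr0.
Qed.

Lemma differentiable_lsub u x : differentiable u x -> differentiable (fun y => lsubmx (u y)) x.
Proof.
move=> du; under eq_fun do rewrite lsubmx_mul.
exact: (differentiable_mulmx du (differentiable_cst _ _)).
Qed.

Lemma differentiable_rsub u x : differentiable u x -> differentiable (fun y => rsubmx (u y)) x.
Proof.
move=> du; under eq_fun do rewrite rsubmx_mul.
exact: (differentiable_mulmx du (differentiable_cst _ _)).
Qed.

Lemma derive_lsub u x h : differentiable u x ->
  'D_h (fun y => lsubmx (u y)) x = lsubmx ('D_h u x).
Proof.
by move=> du; under eq_fun do rewrite lsubmx_mul; rewrite derive_mulmx_cst // lsubmx_mul.
Qed.

Lemma derive_rsub u x h : differentiable u x ->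
  'D_h (fun y => rsubmx (u y)) x = rsubmx ('D_h u x).
Proof.
by move=> du; under eq_fun do rewrite rsubmx_mul; rewrite derive_mulmx_cst // rsubmx_mul.
Qed.

Lemma d0_Rn_pair (H : 'rV[R]_n -> 'M[R]_1) x (Z : 'rV[R]_n) : differentiable H x ->
  d0_Rn (fun y => H y 0 0) x *m Z^T = 'D_Z H x.
Proof.
move=> dH; apply/matrixP => i j; rewrite !ord1 (derive_basis _ dH) mxE summxE.
by apply: eq_bigr => l _; rewrite !mxE (derive_mxE _ _ _ dH) mulrC.
Qed.

Lemma contract_pair (b : 'rV[R]_n -> 'rV[R]_n) x (X Z : 'rV[R]_n) : differentiable b x ->
  (\row_j ('D_(basis_vec R j) b x *m X^T) 0 0) *m Z^T = 'D_Z b x *m X^T.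
Proof.
move=> db; apply/matrixP => i j; rewrite !ord1 (derive_basis _ db) mulmx_suml mxE summxE.
apply: eq_bigr => l _; rewrite -scalemxAl [RHS]mxE mulrC.
by congr (_ * _); rewrite mxE.
Qed.

Lemma row_dotC (a b : 'rV[R]_n) : a *m b^T = b *m a^T.
Proof.
apply: (can_inj (@trmxK _ 1 1)); rewrite trmx_mul trmxK.
by apply/matrixP => i j; rewrite !ord1 [RHS]mxE.
Qed.

(** Let Z be the vector part of [w]. The derivatives along Z come from half the differential of b(X)
    - a(Y), expanded by the Leibniz rule, and from the contractions of db and da; together they
    leave half of the skew expression <d_Z u, v> - <d_Z v, u>. The derivatives along X and Y give
    the other term directly. *)
Lemma courant_Rn_pair u v x w : differentiable u x -> differentiable v x ->
  dpair (courant_Rn u v x) w = courant_form_Rn u v x w.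
Proof.
move=> du dv; rewrite /courant_Rn /courant_form_Rn.
have dX := differentiable_lsub du; have da := differentiable_rsub du.
have dY := differentiable_lsub dv; have db := differentiable_rsub dv.
rewrite !(dpairE _ w) row_mxKl row_mxKr !mulmxDl -scalemxAl.
set Z := lsubmx w; set g := rsubmx w.
have dH : differentiable (fun y => rsubmx (v y) *m (lsubmx (u y))^T -
    rsubmx (u y) *m (lsubmx (v y))^T) x.
  by apply: differentiableB; apply: differentiable_mulmx => //; exact: differentiable_trmx.
have -> : d0_Rn (fun y => contract_Rn (fun y => lsubmx (u y)) (fun y => rsubmx (v y)) y -
    contract_Rn (fun y => lsubmx (v y)) (fun y => rsubmx (u y)) y) x *m Z^T =
    'D_Z (fun y => rsubmx (v y) *m (lsubmx (u y))^T - rsubmx (u y) *m (lsubmx (v y))^T) x.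
  rewrite -(d0_Rn_pair Z dH); congr (d0_Rn _ x *m _).
  apply/funext => y; rewrite /contract_Rn [RHS]mxE; by congr (_ + _); rewrite [RHS]mxE.
rewrite deriveB; try by apply/diff_derivable/differentiable_mulmx => //; exact: differentiable_trmx.
rewrite !(derive_mulmx, derive_trmx) //; try exact: differentiable_trmx.
rewrite /lie_bracket_Rn /contract_d1_Rn !(mulmxBl, mulmxDl, mulNmx) !contract_pair //.
rewrite !(derive_lsub _ du) !(derive_lsub _ dv) !(derive_rsub _ du) !(derive_rsub _ dv).
move: ('D_(lsubmx (u x)) v x) ('D_(lsubmx (v x)) u x) => P Q.
move: ('D_Z u x) ('D_Z v x) (u x) (v x) => S T p q.
rewrite !dpairE !(lsubmx_mul (P - Q)) !(rsubmx_mul (P - Q)) !mulmxBl -!lsubmx_mul -!rsubmx_mul.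
rewrite (row_dotC (rsubmx q)) (row_dotC (rsubmx p)).
do ![set t := _ *m _; move: t => ?].
apply/matrixP => i j; rewrite !mxE; by field.
Qed.

End Real.

(** The rearrangement behind linearity of [courant_form], stated once because the same shape arises
    for a section and for the test vector. *)
Lemma scaled_difference (K : comNzRingType) (V : lmodType K) (a h : K)
    (t0 t1 t2 t3 t4 t5 t6 t7 : V) :
  a *: t0 + t1 - (a *: t2 + t3) + h *: (a *: t4 + t5 - (a *: t6 + t7)) =
  a *: (t0 - t2 + h *: (t4 - t6)) + (t1 - t3 + h *: (t5 - t7)).
Proof.
rewrite opprD addrACA -scalerBr opprD (addrACA (a *: t4)) -scalerBr [in X in _ + X]scalerDr.
by rewrite (scalerA h) (mulrC h) -scalerA addrACA -scalerDr.
Qed.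

Section Complex.
Implicit Types (u v : 'rV[R]_n -> 'rV[C]_(n + n)) (x : 'rV[R]_n) (w : 'rV[C]_(n + n)).

Definition courant_form u v x w : 'M[C]_1 :=
  dpair (dC (lsubmx (u x)) v x - dC (lsubmx (v x)) u x) w +
  2^-1 *: (dpair (dC (lsubmx w) u x) (v x) - dpair (dC (lsubmx w) v x) (u x)).

Lemma courant_formC u v x w : courant_form v u x w = - courant_form u v x w.
Proof.
rewrite /courant_form -(opprB (dC (lsubmx (u x)) v x)) dpairNl.
by rewrite -[X in _ *: X]opprB scalerN -opprD.
Qed.

Lemma dC_linear_fun m k X (f g : 'rV[R]_n -> 'M[C]_(m, k)) a x :
  cdifferentiable f x -> cdifferentiable g x ->
  dC X (fun y => a *: f y + g y) x = a *: dC X f x + dC X g x.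
Proof.
move=> df dg; under eq_fun do rewrite -mul_scalar_mx.
rewrite dCD ?dC_mulmxl ?mul_scalar_mx //.
exact: (cdifferentiable_mulmx (cdifferentiable_cst _ _) df).
Qed.

Lemma courant_form_linearl u u' v x w a :
  cdifferentiable u x -> cdifferentiable u' x ->
  courant_form (fun y => a *: u y + u' y) v x w =
  a *: courant_form u v x w + courant_form u' v x w.
Proof.
move=> du du'; rewrite /courant_form !linearP /= !dC_linear !dC_linear_fun //.
rewrite !(dpairDl, dpairNl, dpairZl, dpairDr, dpairZr).
exact: scaled_difference.
Qed.

Lemma courant_form_linearr u v v' x w a :
  cdifferentiable v x -> cdifferentiable v' x ->
  courant_form u (fun y => a *: v y + v' y) x w =
  a *: courant_form u v x w + courant_form u v' x w.
Proof.
move=> dv dv'; rewrite courant_formC courant_form_linearl //.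
by rewrite (courant_formC u v) (courant_formC u v') scalerN -opprD opprK.
Qed.

Lemma courant_form_linear u v x w w' a :
  courant_form u v x (a *: w + w') =
  a *: courant_form u v x w + courant_form u v x w'.
Proof.
rewrite /courant_form !linearP /= !dC_linear.
rewrite !(dpairDl, dpairNl, dpairZl, dpairDr, dpairZr).
exact: scaled_difference.
Qed.

Lemma cdifferentiable_toC m k (f : 'rV[R]_n -> 'M[R]_(m, k)) x :
  differentiable f x -> cdifferentiable (fun y => toC (f y)) x.
Proof.
move=> df; under eq_fun do rewrite toCE.
exact: (cdifferentiableE df (differentiable_cst _ _)).
Qed.

Lemma dC_toC_fun m k (f : 'rV[R]_n -> 'M[R]_(m, k)) x X :
  differentiable f x -> dC (toC X) (fun y => toC (f y)) x = toC ('D_X f x).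
Proof.
move=> df; rewrite dC_toC; last exact: cdifferentiable_toC.
by under eq_fun do rewrite toCE; rewrite cderiveE derive_cst toCE.
Qed.

Lemma courant_form_toC (u v : 'rV[R]_n -> 'rV[R]_(n + n)) x (w : 'rV[R]_(n + n)) :
  differentiable u x -> differentiable v x ->
  courant_form (fun y => toC (u y)) (fun y => toC (v y)) x (toC w) =
  toC (courant_form_Rn u v x w).
Proof.
move=> du dv; rewrite /courant_form /courant_form_Rn.
rewrite -!toC_lsub !dC_toC_fun // toCD toCZ toCB !toC_dpair toCB.
by rewrite fmorphV rmorphMn.
Qed.

(** Both sides are complex bilinear in the sections and linear in [w]. Splitting everything into
    real and imaginary parts reduces the claim to real sections and real test vectors, where it is
    [courant_Rn_pair]. *)
Lemma courant_form_cplx (u0 u1 v0 v1 : 'rV[R]_n -> 'rV[R]_(n + n)) x w :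
  differentiable u0 x -> differentiable u1 x ->
  differentiable v0 x -> differentiable v1 x ->
  dpair (toC (courant_Rn u0 v0 x - courant_Rn u1 v1 x) +
    'i%C *: toC (courant_Rn u0 v1 x + courant_Rn u1 v0 x)) w =
  courant_form (fun y => cplx (u0 y) (u1 y)) (fun y => cplx (v0 y) (v1 y)) x w.
Proof.
move=> du0 du1 dv0 dv1.
have cu0 := cdifferentiable_toC du0; have cu1 := cdifferentiable_toC du1.
have cv0 := cdifferentiable_toC dv0; have cv1 := cdifferentiable_toC dv1.
have E (a b : 'rV[R]_n -> 'rV[R]_(n + n)) :
    (fun y => cplx (a y) (b y)) = (fun y => 'i%C *: toC (b y) + toC (a y)).
  by apply/funext => y; rewrite cplxE addrC.
have Er (z : 'rV[R]_(n + n)) : dpair (toC (courant_Rn u0 v0 x - courant_Rn u1 v1 x) +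
    'i%C *: toC (courant_Rn u0 v1 x + courant_Rn u1 v0 x)) (toC z) =
  courant_form (fun y => cplx (u0 y) (u1 y)) (fun y => cplx (v0 y) (v1 y)) x (toC z).
  rewrite !E courant_form_linearl // !courant_form_linearr // !courant_form_toC //.
  rewrite -(courant_Rn_pair _ du0 dv0) -(courant_Rn_pair _ du0 dv1).
  rewrite -(courant_Rn_pair _ du1 dv0) -(courant_Rn_pair _ du1 dv1).
  move: (courant_Rn u0 v0 x) (courant_Rn u0 v1 x) (courant_Rn u1 v0 x) (courant_Rn u1 v1 x).
  move=> c00 c01 c10 c11; rewrite !toC_dpair toCB toCD !(dpairDl, dpairNl, dpairZl).
  rewrite [in RHS]scalerDr scalerA -expr2 sqr_i scaleN1r [in LHS]scalerDr.
  by rewrite [RHS]addrC (addrC _ (dpair (toC c00) (toC z))) addrACA.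
have -> : w = 'i%C *: toC (mxIm w) + toC (mxRe w) by rewrite addrC -cplxE cplx_ReIm.
by rewrite courant_form_linear -!Er dpairDr dpairZr.
Qed.

End Complex.

End CourantPairing.

(** * Linear algebra at a point *)

Section ComplexStructure.
Variables (R : realType).
Local Notation C := R[i].
Local Notation iC := ('i%C : C).

Lemma mulii : iC * iC = -1. Proof. by rewrite -expr2 sqr_i. Qed.

Lemma conj_i : conjc iC = - iC.
Proof. by apply/eqP; rewrite eq_complex /= oppr0 !eqxx. Qed.

Lemma conj_Ni : conjc (- iC) = iC.
Proof. by apply/eqP; rewrite eq_complex /= opprK oppr0 !eqxx. Qed.

Lemma oppmx1 (F : pzRingType) k : - 1%:M = (- 1)%:M :> 'M[F]_k.
Proof. by rewrite -scaleN1r scalemx1. Qed.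

Lemma mxconjK m k : involutive (@mxconj R m k).
Proof. by move=> A; apply/matrixP => i j; rewrite !mxE conjcK. Qed.

Lemma mxconjM m k p (A : 'M[C]_(m, k)) (B : 'M[C]_(k, p)) :
  mxconj (A *m B) = mxconj A *m mxconj B.
Proof. exact: map_mxM. Qed.

Lemma mxconjZ m k a (A : 'M[C]_(m, k)) : mxconj (a *: A) = conjc a *: mxconj A.
Proof. exact: map_mxZ. Qed.

Lemma mxconjD m k (A B : 'M[C]_(m, k)) : mxconj (A + B) = mxconj A + mxconj B.
Proof. exact: map_mxD. Qed.

Lemma mxconj_toC m k (A : 'M[R]_(m, k)) : mxconj (toC A) = toC A.
Proof. by apply/matrixP => i j; rewrite !mxE conjc_real. Qed.

Lemma mxconj_sub m1 m2 k (A : 'M[C]_(m1, k)) (B : 'M[C]_(m2, k)) :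
  (mxconj A <= mxconj B)%MS = (A <= B)%MS.
Proof. exact: map_submx. Qed.

Lemma sub_mxconj m1 m2 k (A : 'M[C]_(m1, k)) (B : 'M[C]_(m2, k)) :
  (A <= mxconj B)%MS = (mxconj A <= B)%MS.
Proof. by rewrite -[A in LHS]mxconjK mxconj_sub. Qed.

Lemma lsub_mxconj m k p (A : 'M[C]_(m, k + p)) : lsubmx (mxconj A) = mxconj (lsubmx A).
Proof. by rewrite /mxconj map_lsubmx. Qed.

Lemma rsub_mxconj m k p (A : 'M[C]_(m, k + p)) : rsubmx (mxconj A) = mxconj (rsubmx A).
Proof. by rewrite /mxconj map_rsubmx. Qed.

Lemma row_free_rV0 (F : fieldType) m k (A : 'M[F]_(m, k)) :
  (forall v : 'rV_m, v *m A = 0 -> v = 0) -> row_free A.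
Proof.
move=> h; rewrite -kermx_eq0; apply/rowV0P => v /sub_kermxP; exact: h.
Qed.

Lemma eq_oppr0 m k (A : 'M[C]_(m, k)) : A = - A -> A = 0.
Proof.
move/eqP; rewrite -subr_eq0 opprK -mulr2n -scaler_nat scaler_eq0 pnatr_eq0 /=.
by move/eqP.
Qed.

Variable n : nat.
Section Endo.
Variables (JJ : 'M[R]_n) (JJ2 : JJ *m JJ = - 1%:M).

Local Notation L := (eigenspace (toC JJ) iC).

Lemma toC_JJ2 : toC JJ *m toC JJ = - 1%:M.
Proof. by rewrite -toCM JJ2 toCN toC1. Qed.

Definition eig_proj m (w : 'M[C]_(m, n)) := 2^-1 *: (w - iC *: (w *m toC JJ)).
Definition eig_coproj m (w : 'M[C]_(m, n)) := 2^-1 *: (w + iC *: (w *m toC JJ)).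

Lemma eig_projD m (w : 'M[C]_(m, n)) : w = eig_proj w + eig_coproj w.
Proof.
rewrite /eig_proj /eig_coproj -scalerDr addrACA addNr addr0.
by rewrite half_double.
Qed.

Lemma eig_projE m (w : 'M[C]_(m, n)) : eig_proj w *m toC JJ = iC *: eig_proj w.
Proof.
rewrite /eig_proj -scalemxAl scalerA mulrC -scalerA; congr (_ *: _).
rewrite mulmxBl -scalemxAl -mulmxA toC_JJ2 mulmxN mulmx1 scalerN opprK.
by rewrite scalerBr scalerA mulii scaleN1r opprK addrC.
Qed.

Lemma eig_coprojE m (w : 'M[C]_(m, n)) : eig_coproj w *m toC JJ = - iC *: eig_coproj w.
Proof.
rewrite /eig_coproj -scalemxAl scalerA mulrC -scalerA; congr (_ *: _).
rewrite mulmxDl -scalemxAl -mulmxA toC_JJ2 mulmxN mulmx1 scalerN.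
by rewrite scaleNr scalerDr scalerA mulii scaleN1r opprD opprK addrC.
Qed.

Lemma sub_mxconj_eig m (w : 'M[C]_(m, n)) :
  (w <= mxconj L)%MS <-> w *m toC JJ = - iC *: w.
Proof.
rewrite sub_mxconj; split => [/eigenspaceP|] E.
  rewrite -[w]mxconjK -[toC JJ]mxconj_toC -mxconjM E mxconjZ.
  by rewrite conj_i mxconjK.
by apply/eigenspaceP; rewrite -[toC JJ]mxconj_toC -mxconjM E mxconjZ conj_Ni.
Qed.

Lemma eig_cap_conj : (L :&: mxconj L)%MS = 0.
Proof.
apply/eqP/rowV0P => v; rewrite sub_capmx => /andP[/eigenspaceP E /sub_mxconj_eig].
rewrite E scaleNr => /eq_oppr0/eqP; rewrite scaler_eq0 => /orP[|/eqP//].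
by rewrite eq_complex /= oner_eq0 andbF.
Qed.

(** The eigenspace and its conjugate are complementary, and conjugation preserves the rank. *)
Lemma rank_eig : (\rank L + \rank L)%N = n.
Proof.
have rc : \rank (mxconj L) = \rank L by exact: mxrank_map.
have := mxrank_sum_cap L (mxconj L); rewrite eig_cap_conj mxrank0 addn0 rc => <-.
apply/eqP; rewrite -[_ == _]/(row_full _) -sub1mx.
rewrite [X in (X <= _)%MS]eig_projD; apply: addmx_sub_adds.
  by apply/eigenspaceP; exact: eig_projE.
by apply/sub_mxconj_eig; exact: eig_coprojE.
Qed.

End Endo.

End ComplexStructure.

Section Isotropy.
Variables (R : realType) (n : nat).
Local Notation C := R[i].
Local Notation iC := ('i%C : C).
Variables (JJ : 'M[R]_(n + n)) (JJ2 : JJ *m JJ = - 1%:M).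
Hypothesis JJo : dpair JJ JJ = dpair 1%:M 1%:M.
Local Notation L := (eigenspace (toC JJ) iC).

Lemma dpair_mul (F : fieldType) m k p q (a : 'M[F]_(p, m)) (u : 'M[F]_(m, n + n))
    (b : 'M[F]_(q, k)) (v : 'M[F]_(k, n + n)) :
  dpair (a *m u) (b *m v) = a *m dpair u v *m b^T.
Proof. by rewrite !unlock trmx_mul !mulmxA. Qed.

Lemma dpair_JJ (u v : 'rV[C]_(n + n)) : dpair (u *m toC JJ) (v *m toC JJ) = dpair u v.
Proof.
rewrite dpair_mul -toC_dpair JJo toC_dpair toC1 -dpair_mul.
by rewrite !mulmx1.
Qed.

(** Orthogonality of [JJ] gives <u, v> = a^2 <u, v> = -<u, v>. The scalar is left general because
    both eigenvalues, [i] and [-i], are needed. *)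
Lemma isotropic_eigen a (u v : 'rV[C]_(n + n)) : a * a = -1 ->
  u *m toC JJ = a *: u -> v *m toC JJ = a *: v -> dpair u v = 0.
Proof.
move=> aa Eu Ev; apply: eq_oppr0.
by rewrite -{1}dpair_JJ Eu Ev dpairZl dpairZr scalerA aa scaleN1r.
Qed.

Lemma isotropic_eig : isotropic L.
Proof.
move=> u v /eigenspaceP Eu /eigenspaceP Ev; rewrite pairing_dpair.
by rewrite (isotropic_eigen (mulii R) Eu Ev) mxE mulr0.
Qed.

(** The eigenspace contains its own orthogonal. The component [w1] of [w] in the conjugate
    eigenspace pairs to zero with that eigenspace by isotropy, and with [L] because both [w] and
    [w - w1] do; hence it vanishes. *)
Lemma perp_eig (w : 'rV[C]_(n + n)) :
  (forall v : 'rV_(n + n), (v <= L)%MS -> dpair w v = 0) -> (w <= L)%MS.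
Proof.
move=> wL; set w1 := eig_coproj JJ w.
suff w10 : w1 = 0.
  by rewrite (eig_projD JJ w) -/w1 w10 addr0; apply/eigenspaceP; exact: eig_projE.
apply: dpair_inj => v; rewrite [RHS](_ : _ = 0); last by rewrite unlock !mul0mx.
rewrite (eig_projD JJ v) dpairDr.
have -> : dpair w1 (eig_coproj JJ v) = 0.
  apply: (@isotropic_eigen (- iC)); rewrite ?eig_coprojE //.
  by rewrite mulrNN mulii.
have -> : w1 = w - eig_proj JJ w.
  by apply/eqP; rewrite eq_sym subr_eq addrC -eig_projD.
rewrite dpairDl dpairNl wL; last by apply/eigenspaceP; exact: eig_projE.
rewrite (isotropic_eigen (mulii R)) ?eig_projE //.
by rewrite subrr add0r.
Qed.

Lemma maximal_isotropic_eig : maximal_isotropic L.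
Proof.
split=> [|A' iA' LA']; first exact: isotropic_eig.
apply/rV_subP => w wA'; apply: perp_eig => v /submx_trans/(_ LA') vA'.
apply/matrixP => i j; rewrite !ord1 [RHS]mxE.
have := iA' w v wA' vA'; rewrite pairing_dpair => /eqP; rewrite mulf_eq0 invr_eq0.
by rewrite pnatr_eq0 /= => /eqP.
Qed.

End Isotropy.

(** * The endomorphism attached to two graphs *)

Section Quadruple.
Variables (R : realType) (n : nat).
Local Notation C := R[i].
Local Notation iC := ('i%C : C).

(** The two row blocks are bases of the graphs of [E] and [F], so this is the change of frame
    adapted to the sum of the graphs, which is direct when [F - E] is invertible. *)
Definition two_graphs (E F : 'M[R]_n) : 'M[R]_(n + n) := block_mx 1%:M E 1%:M F.

Lemma two_graphs_unit (E F : 'M[R]_n) : F - E \in unitmx -> two_graphs E F \in unitmx.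
Proof.
move=> u; have : block_mx 1%:M 0 (- 1%:M) 1%:M *m two_graphs E F \in unitmx.
  rewrite /two_graphs mulmx_block !(mul0mx, mul1mx, mulNmx, addr0) addNr.
  by rewrite unitmxE det_ublock det1 mul1r -unitmxE addrC.
by rewrite unitmx_mul => /andP[].
Qed.

(* The endomorphism acting as [Jp] on the graph of [E] and as [K] on that of [F]. *)
Definition quad_endo (E F Jp K : 'M[R]_n) : 'M[R]_(n + n) :=
  invmx (two_graphs E F) *m block_mx Jp 0 0 K *m two_graphs E F.

Lemma mem_graph m (E J : 'M[R]_n) (w : 'M[C]_(m, n + n)) :
  (w <= eigenspace (toC J) iC *m row_mx 1%:M (toC E))%MS <->
  (lsubmx w *m toC J = iC *: lsubmx w /\ rsubmx w = lsubmx w *m toC E).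
Proof.
split=> [/submxP[D ->]|[/eigenspaceP/submxP[D DE] Er]].
  rewrite mulmxA mul_mx_row mulmx1 row_mxKl row_mxKr; split=> //.
  by apply/eigenspaceP; exact: submxMl.
apply/submxP; exists D; rewrite mulmxA -DE mul_mx_row mulmx1 -Er.
by rewrite hsubmxK.
Qed.

Lemma mem_two_graphs m (E F J K : 'M[R]_n) (w : 'M[C]_(m, n + n)) :
  (w <= (eigenspace (toC J) iC *m row_mx 1%:M (toC E))%MS +
        (eigenspace (toC K) iC *m row_mx 1%:M (toC F)))%MS <->
  exists X Y, [/\ X *m toC J = iC *: X, Y *m toC K = iC *: Y
    & w = X *m row_mx 1%:M (toC E) + Y *m row_mx 1%:M (toC F)].
Proof.
split=> [/sub_addsmxP[[a b] /= ->]|[X [Y [/eigenspaceP EX /eigenspaceP EY ->]]]].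
  exists (a *m eigenspace (toC J) iC), (b *m eigenspace (toC K) iC).
  split; [by apply/eigenspaceP/submxMl|by apply/eigenspaceP/submxMl|].
  by rewrite !mulmxA.
by apply: addmx_sub_adds; exact: submxMr.
Qed.

Lemma toC_two_graphs (E F : 'M[R]_n) :
  toC (two_graphs E F) = col_mx (row_mx 1%:M (toC E)) (row_mx 1%:M (toC F)).
Proof. by rewrite /two_graphs /block_mx /toC map_col_mx !map_row_mx map_mx1. Qed.

Section Invertible.
Variables (E F Jp K : 'M[R]_n).
Hypotheses (FE : F - E \in unitmx) (Jp2 : Jp *m Jp = - 1%:M) (K2 : K *m K = - 1%:M).

Let Tu := two_graphs_unit FE.

Lemma quad_endoE : two_graphs E F *m quad_endo E F Jp K =
  block_mx Jp 0 0 K *m two_graphs E F.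
Proof. by rewrite /quad_endo !mulmxA mulmxV // mul1mx. Qed.

Lemma quad_endo_mul Jp' K' : quad_endo E F Jp K *m quad_endo E F Jp' K' =
  quad_endo E F (Jp *m Jp') (K *m K').
Proof.
rewrite {2}/quad_endo !mulmxA -(mulmxA _ (two_graphs E F)) mulmxV // mulmx1.
rewrite -(mulmxA _ (block_mx Jp 0 0 K) (block_mx Jp' 0 0 K')) mulmx_block.
by rewrite !(mulmx0, mul0mx, addr0, add0r).
Qed.

Lemma quad_endo_scalar a : quad_endo E F a%:M a%:M = a%:M.
Proof.
by rewrite /quad_endo -scalar_mx_block mul_mx_scalar -scalemxAl mulVmx // scalemx1.
Qed.

Lemma quad_endo2 : quad_endo E F Jp K *m quad_endo E F Jp K = - 1%:M.
Proof.
by rewrite quad_endo_mul Jp2 K2 !oppmx1 quad_endo_scalar.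
Qed.

(** In the frame adapted to the two graphs the endomorphism is block diagonal, so an eigenvector is
    a sum of eigenvectors of the two blocks. *)
Lemma quad_endo_eig : (eigenspace (toC (quad_endo E F Jp K)) iC ==
  (eigenspace (toC Jp) iC *m row_mx 1%:M (toC E))%MS +
  (eigenspace (toC K) iC *m row_mx 1%:M (toC F)))%MS.
Proof.
have TE : toC (two_graphs E F) *m toC (quad_endo E F Jp K) =
    block_mx (toC Jp) 0 0 (toC K) *m toC (two_graphs E F).
  by rewrite -toCM quad_endoE toCM /toC map_block_mx !map_mx0.
have Tu' : toC (two_graphs E F) \in unitmx by rewrite /toC map_unitmx.
apply/andP; split; apply/rV_subP => w.
  move/eigenspaceP => Ew; apply/mem_two_graphs.
  set z := w *m invmx (toC (two_graphs E F)).
  have wz : w = z *m toC (two_graphs E F) by rewrite mulmxKV.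
  have : z *m block_mx (toC Jp) 0 0 (toC K) = iC *: z.
    apply: (can_inj (mulmxK Tu')); rewrite -mulmxA -TE mulmxA -wz Ew.
    by rewrite -scalemxAl -wz.
  rewrite -[z in X in X -> _]hsubmxK mul_row_block !(mulmx0, addr0, add0r) scale_row_mx.
  move=> /eq_row_mx[E1 E2]; exists (lsubmx z), (rsubmx z); split=> //.
  by rewrite wz toC_two_graphs -{1}[z]hsubmxK mul_row_col.
move/mem_two_graphs => [X [Y [EX EY ->]]]; apply/eigenspaceP.
rewrite -mul_row_col -toC_two_graphs -mulmxA TE mulmxA mul_row_block.
by rewrite !(mulmx0, addr0, add0r) EX EY -scale_row_mx -scalemxAl.
Qed.

End Invertible.

Section Hermitian.
Variables (g b Jp Jm : 'M[R]_n).
Hypotheses (gu : g \in unitmx) (gT : g^T = g) (bT : b^T = - b).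
Local Notation E := (b + g).
Local Notation F := (b - g).

Lemma graphs_sub_unit : F - E \in unitmx.
Proof.
have -> : F - E = (- 2%:R) *: g.
  by rewrite opprD addrACA subrr add0r -opprD -mulr2n -scaler_nat scaleNr.
by rewrite unitmxZ // unitfE oppr_eq0 pnatr_eq0.
Qed.

(** The skew form b cancels everywhere: the two graphs are orthogonal, and on vector parts the
    doubled pairing is 2g on the graph of b + g and -2g on that of b - g. *)
Lemma dpair_two_graphs : dpair (two_graphs E F) (two_graphs E F) =
  block_mx (2%:R *: g) 0 0 (- 2%:R *: g).
Proof.
have Er : (b + g)^T = - b + g by rewrite linearD /= bT gT.
have Fr : (b - g)^T = - b - g by rewrite linearB /= bT gT.
rewrite /two_graphs dpairE /block_mx.
have -> : lsubmx (col_mx (row_mx (1%:M : 'M[R]_n) E) (row_mx 1%:M F)) = col_mx 1%:M 1%:M.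
  by rewrite lsubmx_mul mul_col_mx -!lsubmx_mul !row_mxKl.
have -> : rsubmx (col_mx (row_mx (1%:M : 'M[R]_n) E) (row_mx 1%:M F)) = col_mx E F.
  by rewrite rsubmx_mul mul_col_mx -!rsubmx_mul !row_mxKr.
rewrite !tr_col_mx !trmx1 Er Fr !mul_col_row !mul1mx !mulmx1 add_block_mx.
rewrite /block_mx; congr (col_mx (row_mx _ _) (row_mx _ _)).
- by rewrite addrACA addNr add0r -mulr2n scaler_nat.
- by rewrite addrACA addNr addNr addr0.
- by rewrite addrACA addNr subrr addr0.
- by rewrite addrACA addNr add0r -opprD -mulr2n scaleNr scaler_nat.
Qed.

Lemma quad_endo_orthogonal K : Jp *m g *m Jp^T = g -> K *m g *m K^T = g ->
  dpair (quad_endo E F Jp K) (quad_endo E F Jp K) = dpair 1%:M 1%:M.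
Proof.
move=> hp hk; have Tu := two_graphs_unit graphs_sub_unit.
have TT : dpair (two_graphs E F *m quad_endo E F Jp K) (two_graphs E F *m quad_endo E F Jp K)
    = dpair (two_graphs E F *m 1%:M) (two_graphs E F *m 1%:M).
  rewrite quad_endoE ?graphs_sub_unit // dpair_mul mulmx1 dpair_two_graphs.
  rewrite tr_block_mx !trmx0 !mulmx_block !(mulmx0, mul0mx, addr0, add0r).
  by rewrite -!scalemxAr -!scalemxAl hp hk.
move: TT; rewrite !dpair_mul => TT.
apply: (can_inj (mulKmx Tu)); apply: (can_inj (@trmxK _ _ _)).
rewrite !trmx_mul; apply: (can_inj (mulKmx Tu)).
by move: TT => /(congr1 trmx); rewrite !trmx_mul !trmxK !mulmxA.
Qed.

(** The blocks [- 1] and [1] are those of the product of the two endomorphisms: J+ J+ = -1 on the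
    graph of b + g, where the pairing is positive, and J- (-J-) = 1 on that of b - g, where it is
    negative. *)
Lemma quad_endo_negative : (forall X : 'rV[R]_n, X != 0 -> 0 < (X *m g *m X^T) 0 0) ->
  forall v : 'rV[R]_(n + n), v != 0 ->
  pairing (v *m quad_endo E F (- 1%:M) 1%:M) v < 0.
Proof.
move=> gpos v v0; have Tu := two_graphs_unit graphs_sub_unit.
set z := v *m invmx (two_graphs E F).
have vz : v = z *m two_graphs E F by rewrite mulmxKV.
rewrite pairing_dpair vz -mulmxA quad_endoE ?graphs_sub_unit // mulmxA.
rewrite dpair_mul dpair_two_graphs -[z]hsubmxK mul_row_block.
rewrite !(mulmx0, mulmx1, mulmxN, addr0, add0r) mul_row_block !(mulmx0, addr0, add0r).
rewrite tr_row_mx mul_row_col !mulNmx -!scalemxAr -!scalemxAl scaleNr -opprD.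
rewrite -scalerDr mxE mxE mulrN mulrA mulVf ?pnatr_eq0 // mul1r oppr_lt0.
have gnn (X : 'rV[R]_n) : 0 <= (X *m g *m X^T) 0 0.
  by have [->|/gpos/ltW//] := eqVneq X 0; rewrite !mul0mx mxE.
have [z1|z1] := eqVneq (lsubmx z) 0; last first.
  by rewrite mxE ltr_pwDl ?gpos.
have [z2|z2] := eqVneq (rsubmx z) 0; last by rewrite mxE ltr_wpDl ?gpos.
by move: v0; rewrite vz -[z]hsubmxK z1 z2 row_mx0 mul0mx eqxx.
Qed.

End Hermitian.

End Quadruple.

(** * Courant bracket of sections of graphs *)

Section LocalCourant.
Variables (R : realType) (n : nat).
Local Notation C := R[i].
Local Notation iC := ('i%C : C).
Implicit Types (x : 'rV[R]_n).

Lemma mx11_tr (T : Type) (A : 'M[T]_1) : A^T = A.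
Proof. by apply/matrixP => i j; rewrite mxE !ord1. Qed.

Lemma dCZ m k X a (f : 'rV[R]_n -> 'M[C]_(m, k)) x :
  cdifferentiable f x -> dC X (fun y => a *: f y) x = a *: dC X f x.
Proof.
by move=> df; under eq_fun do rewrite -mul_scalar_mx; rewrite dC_mulmxl // mul_scalar_mx.
Qed.

Lemma cdifferentiableZ m k a (f : 'rV[R]_n -> 'M[C]_(m, k)) x :
  cdifferentiable f x -> cdifferentiable (fun y => a *: f y) x.
Proof.
move=> df; under eq_fun do rewrite -mul_scalar_mx.
exact: cdifferentiable_mulmx (cdifferentiable_cst _ _) df.
Qed.

Lemma dCN m k X (f : 'rV[R]_n -> 'M[C]_(m, k)) x :
  cdifferentiable f x -> dC X (fun y => - f y) x = - dC X f x.
Proof.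
by move=> df; under eq_fun do rewrite -scaleN1r; rewrite dCZ // scaleN1r.
Qed.

Lemma dC_dirZ m k a X (f : 'rV[R]_n -> 'M[C]_(m, k)) x :
  dC (a *: X) f x = a *: dC X f x.
Proof.
rewrite !dCE scaler_sumr; apply: eq_bigr => i _.
by rewrite mxE scalerA.
Qed.

Definition graph_mx (W : 'M[C]_n) : 'M[C]_(n, n + n) := row_mx 1%:M W.

Lemma graph_mxE (W : 'M[C]_n) : graph_mx W = row_mx 1%:M 0 + W *m row_mx 0 1%:M.
Proof. by rewrite mul_mx_row mulmx0 mulmx1 add_row_mx addr0 add0r. Qed.

Lemma lsub_graph m (X : 'M[C]_(m, n)) W : lsubmx (X *m graph_mx W) = X.
Proof. by rewrite mul_mx_row mulmx1 row_mxKl. Qed.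

Lemma rsub_graph m (X : 'M[C]_(m, n)) W : rsubmx (X *m graph_mx W) = X *m W.
Proof. by rewrite mul_mx_row mulmx1 row_mxKr. Qed.

Lemma cdifferentiable_graph (W : 'rV[R]_n -> 'M[C]_n) x :
  cdifferentiable W x -> cdifferentiable (fun y => graph_mx (W y)) x.
Proof.
move=> dW; under eq_fun do rewrite graph_mxE.
apply: cdifferentiableD (cdifferentiable_cst _ _) _.
exact: cdifferentiable_mulmx dW (cdifferentiable_cst _ _).
Qed.

Lemma dC_graph_mx h (W : 'rV[R]_n -> 'M[C]_n) x :
  cdifferentiable W x -> dC h (fun y => graph_mx (W y)) x = row_mx 0 (dC h W x).
Proof.
move=> dW; under eq_fun do rewrite graph_mxE.
rewrite (dCD _ (cdifferentiable_cst _ _)).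
  by rewrite dC_cst add0r dC_mulmxr // mul_mx_row mulmx0 mulmx1.
exact: cdifferentiable_mulmx dW (cdifferentiable_cst _ _).
Qed.

Lemma dC_graph h (X : 'rV[R]_n -> 'rV[C]_n) (W : 'rV[R]_n -> 'M[C]_n) x :
  cdifferentiable X x -> cdifferentiable W x ->
  dC h (fun y => X y *m graph_mx (W y)) x =
  dC h X x *m graph_mx (W x) + row_mx 0 (X x *m dC h W x).
Proof.
move=> dX dW; rewrite (dC_mulmx _ dX (cdifferentiable_graph dW)) dC_graph_mx //.
by rewrite (mul_mx_row (X x)) mulmx0.
Qed.

Lemma dpair_graph (X Y : 'rV[C]_n) (W : 'M[C]_n) : W^T = - W ->
  dpair (X *m graph_mx W) (Y *m graph_mx W) = 0.
Proof.
move=> Wsk; rewrite dpair_mul dpair_row trmx1 mulmx1 mul1mx Wsk addNr.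
by rewrite mulmx0 mul0mx.
Qed.

Lemma courant_form_near_eq (u u' v v' : 'rV[R]_n -> 'rV[C]_(n + n)) x w :
  (\near x, u x = u' x) -> (\near x, v x = v' x) ->
  courant_form u v x w = courant_form u' v' x w.
Proof.
move=> uu vv; rewrite /courant_form !(dC_near_eq _ uu) !(dC_near_eq _ vv).
by rewrite (nbhs_singleton uu) (nbhs_singleton vv).
Qed.

(** The exterior derivative dW(X, Y, Z) evaluated on constant vector fields: the cyclic sum of the
    terms (d_X W)(Y, Z). *)
Definition d_form (W : 'rV[R]_n -> 'M[C]_n) x (X Y Z : 'rV[C]_n) : 'M[C]_1 :=
  Y *m dC X W x *m Z^T + Z *m dC Y W x *m X^T + X *m dC Z W x *m Y^T.

Lemma dC_skew h (W : 'rV[R]_n -> 'M[C]_n) x : cdifferentiable W x ->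
  (\near x, (W x)^T = - W x) -> (dC h W x)^T = - dC h W x.
Proof. by move=> dW Wsk; rewrite -dC_tr // (dC_near_eq _ Wsk) dCN. Qed.

(* The Courant bracket of two sections of the graph of a two-form W is
   (X + W X, Y + W Y) |-> [X, Y] + W [X, Y] + dW(X, Y, -). *)
Lemma courant_form_graph (X Y : 'rV[R]_n -> 'rV[C]_n) (W : 'rV[R]_n -> 'M[C]_n) x w :
  cdifferentiable X x -> cdifferentiable Y x -> cdifferentiable W x ->
  (\near x, (W x)^T = - W x) ->
  courant_form (fun y => X y *m graph_mx (W y)) (fun y => Y y *m graph_mx (W y)) x w =
  dpair ((dC (X x) Y x - dC (Y x) X x) *m graph_mx (W x)) w +
  d_form W x (X x) (Y x) (lsubmx w).
Proof.
move=> dX dY dW Wsk; rewrite /courant_form !lsub_graph !dC_graph //.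
have sk h := dC_skew h dW Wsk; have Wx := nbhs_singleton Wsk.
set Z := lsubmx w.
have flip (a c : 'rV[C]_n) h : a *m dC h W x *m c^T = - (c *m dC h W x *m a^T).
  by rewrite -[LHS]mx11_tr !trmx_mul trmxK sk mulNmx mulmxN mulmxA.
(* In the terms <d_Z u, v> and <d_Z v, u> the graph is isotropic, so only the part containing the
   derivative of [W] survives. *)
rewrite !(dpairDl (_ *m graph_mx _)) !dpair_graph // !add0r.
have cross (a c : 'rV[C]_n) : dpair (row_mx 0 a) (c *m graph_mx (W x)) = a *m c^T.
  by rewrite mul_mx_row mulmx1 dpair_row mul0mx add0r.
have crossw (a : 'rV[C]_n) : dpair (row_mx 0 a) w = a *m Z^T.
  by rewrite dpairE row_mxKl row_mxKr mul0mx add0r.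
rewrite !cross (flip (Y x) (X x)) opprK half_double mulmxBl !dpairBl.
rewrite (dpairDl (_ *m _)) (dpairDl (dC (Y x) X x *m _)) !crossw.
rewrite (flip (X x) Z) opprD opprK /d_form.
by rewrite [X in X + _ = _]addrACA -!addrA.
Qed.

(** * The Nijenhuis tensor and involutive eigenbundles *)

Section Involutive.
Variables (J : 'rV[R]_n -> 'M[R]_n) (x : 'rV[R]_n).
Hypotheses (dJ : differentiable J x) (J2 : \near x, J x *m J x = - 1%:M).

(* The Nijenhuis tensor on constant vector fields. *)
Definition nijenhuis_form (a b : 'rV[C]_n) : 'rV[C]_n :=
  let JC y := toC (J y) in
  b *m dC (a *m JC x) JC x - a *m dC (b *m JC x) JC x
  + a *m dC b JC x *m JC x - b *m dC a JC x *m JC x.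

Lemma nijenhuis_formC a b : nijenhuis_form b a = - nijenhuis_form a b.
Proof.
rewrite /nijenhuis_form -!addrA !opprD !opprK addrA [RHS]addrA.
by rewrite (addrC (- _) (a *m _)) (addrC (- _) (b *m _ *m _)).
Qed.

Lemma nijenhuis_form_linear s a a' b :
  nijenhuis_form (s *: a + a') b = s *: nijenhuis_form a b + nijenhuis_form a' b.
Proof.
rewrite /nijenhuis_form mulmxDl -scalemxAl !dC_linear !(mulmxDl, mulmxDr).
rewrite -!scalemxAr -!scalemxAl.
move: (b *m dC (a *m toC (J x)) (fun y => toC (J y)) x)
 (b *m dC (a' *m toC (J x)) (fun y => toC (J y)) x)
 (a *m dC (b *m toC (J x)) (fun y => toC (J y)) x)
 (a' *m dC (b *m toC (J x)) (fun y => toC (J y)) x)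
 (a *m dC b (fun y => toC (J y)) x *m toC (J x))
 (a' *m dC b (fun y => toC (J y)) x *m toC (J x))
 (b *m dC a (fun y => toC (J y)) x *m toC (J x))
 (b *m dC a' (fun y => toC (J y)) x *m toC (J x)) => t0 t1 t2 t3 t4 t5 t6 t7.
rewrite !scalerBr !scalerDr scalerN !opprD.
rewrite (addrACA (s *: t0)) (addrACA (s *: t0 - s *: t2)).
by rewrite (addrACA (s *: t0 - s *: t2 + s *: t4)).
Qed.

(** Differentiating ZJ = iZ gives (d_h Z) J = i d_h Z - Z (d_h J), and likewise for W. The claim
    thus amounts to W (d_Z J) = Z (d_W J), and on i-eigenvectors the Nijenhuis form equals 2i times
    the difference of these two sides. *)
Lemma involutive_eig (Z W : 'rV[R]_n -> 'rV[C]_n) :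
  (forall a b, nijenhuis_form a b = 0) ->
  cdifferentiable Z x -> cdifferentiable W x ->
  (\near x, Z x *m toC (J x) = iC *: Z x) ->
  (\near x, W x *m toC (J x) = iC *: W x) ->
  (dC (Z x) W x - dC (W x) Z x) *m toC (J x) = iC *: (dC (Z x) W x - dC (W x) Z x).
Proof.
move=> N dZ dW ZJ WJ; have cJ := cdifferentiable_toC dJ.
have DJ h (U : 'rV[R]_n -> 'rV[C]_n) : cdifferentiable U x ->
    (\near x, U x *m toC (J x) = iC *: U x) ->
    dC h U x *m toC (J x) = iC *: dC h U x - U x *m dC h (fun y => toC (J y)) x.
  move=> dU UJ; have := dC_near_eq h UJ.
  by rewrite (dC_mulmx _ dU cJ) dCZ // => <-; rewrite addrK.
(* From the derivative of J^2 = -1: J anticommutes with its own derivatives. *)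
have JDJ h : dC h (fun y => toC (J y)) x *m toC (J x) =
    - (toC (J x) *m dC h (fun y => toC (J y)) x).
  have JJ : \near x, toC (J x) *m toC (J x) = - 1%:M.
    by apply: filterS J2 => y Jy; rewrite -toCM Jy toCN toC1.
  have := dC_near_eq h JJ.
  by rewrite (dC_mulmx _ cJ cJ) dC_cst => /eqP; rewrite addr_eq0 => /eqP.
rewrite mulmxBl !DJ // scalerBr.
set Dz := dC (Z x) (fun y => toC (J y)) x; set Dw := dC (W x) (fun y => toC (J y)) x.
have zJ := nbhs_singleton ZJ; have wJ := nbhs_singleton WJ.
suff -> : W x *m Dz = Z x *m Dw by rewrite opprB addrA subrK.
have ZDJ : Z x *m Dw *m toC (J x) = - (iC *: (Z x *m Dw)).
  by rewrite -mulmxA JDJ mulmxN mulmxA zJ -scalemxAl.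
have WDJ : W x *m Dz *m toC (J x) = - (iC *: (W x *m Dz)).
  by rewrite -mulmxA JDJ mulmxN mulmxA wJ -scalemxAl.
have := N (Z x) (W x); rewrite /nijenhuis_form zJ wJ !dC_dirZ -/Dz -/Dw ZDJ WDJ.
rewrite -!scalemxAr opprK -addrA [- _ + _]addrC -scalerBr -scalerDr.
move/eqP; rewrite scaler_eq0 => /orP[|/eqP E].
  by rewrite eq_complex /= oner_eq0 andbF.
apply/eqP; rewrite -subr_eq0; apply/eqP; apply: eq_oppr0.
by apply/eqP; rewrite -addr_eq0 E.
Qed.

End Involutive.


Lemma courant_formDl (u u' v : 'rV[R]_n -> 'rV[C]_(n + n)) x w :
  cdifferentiable u x -> cdifferentiable u' x ->
  courant_form (fun y => u y + u' y) v x w = courant_form u v x w + courant_form u' v x w.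
Proof.
move=> du du'; have := courant_form_linearl v w 1 du du'; rewrite scale1r => <-.
by congr (courant_form _ v x w); apply/funext => y; rewrite scale1r.
Qed.

Lemma courant_formDr (u v v' : 'rV[R]_n -> 'rV[C]_(n + n)) x w :
  cdifferentiable v x -> cdifferentiable v' x ->
  courant_form u (fun y => v y + v' y) x w = courant_form u v x w + courant_form u v' x w.
Proof.
move=> dv dv'; have := courant_form_linearr u w 1 dv dv'; rewrite scale1r => <-.
by congr (courant_form u _ x w); apply/funext => y; rewrite scale1r.
Qed.

Lemma courant_formD (u v : 'rV[R]_n -> 'rV[C]_(n + n)) x w w' :
  courant_form u v x (w + w') = courant_form u v x w + courant_form u v x w'.
Proof. by have := courant_form_linear u v x w w' 1; rewrite !scale1r. Qed.

Section CyclicForm.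
Variable x : 'rV[R]_n.
Implicit Types u v w : 'rV[R]_n -> 'rV[C]_(n + n).

(* By isotropy <d_X u, v> is skew in (u, v), so both sides reduce to
   <d_X v, w> + <d_Y w, u> + <d_Z u, v>. *)
Lemma courant_form_cyclic u v w :
  cdifferentiable u x -> cdifferentiable v x -> cdifferentiable w x ->
  (\near x, dpair (u x) (v x) = 0) -> (\near x, dpair (v x) (w x) = 0) ->
  (\near x, dpair (w x) (u x) = 0) ->
  courant_form u v x (w x) = courant_form v w x (u x).
Proof.
have D0 h (a b : 'rV[R]_n -> 'rV[C]_(n + n)) : cdifferentiable a x -> cdifferentiable b x ->
    (\near x, dpair (a x) (b x) = 0) -> dpair (dC h b x) (a x) = - dpair (dC h a x) (b x).
  move=> da db ab; have := dC_near_eq h ab; rewrite dC_cst.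
  rewrite (_ : (fun y => _) = fun y => (a y *m swap_mx C n) *m (b y)^T); last first.
    by apply/funext => y; rewrite dpair.unlock.
  rewrite dC_mulmx; [|exact: cdifferentiable_mulmx (cdifferentiable_cst _ _)
                    |exact: cdifferentiable_tr].
  rewrite (dC_mulmxr _ _ da) dC_tr //.
  rewrite (_ : dC h a x *m _ *m _ = dpair (dC h a x) (b x)); last by rewrite dpair.unlock.
  rewrite (_ : a x *m _ *m _ = dpair (a x) (dC h b x)); last by rewrite dpair.unlock.
  by move/eqP; rewrite addrC addr_eq0 dpairC => /eqP.
move=> du dv dw uv vw wu.
have half (a b c : 'rV[R]_n -> 'rV[C]_(n + n)) : cdifferentiable a x -> cdifferentiable b x ->
      cdifferentiable c x ->
    (\near x, dpair (a x) (b x) = 0) -> (\near x, dpair (c x) (a x) = 0) ->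
    courant_form a b x (c x) = dpair (dC (lsubmx (a x)) b x) (c x) +
      dpair (dC (lsubmx (b x)) c x) (a x) + dpair (dC (lsubmx (c x)) a x) (b x).
  move=> da db dc ab ca; rewrite /courant_form (D0 _ a b) // opprK half_double.
  by rewrite dpairBl (D0 _ c a) // opprK.
by rewrite (half u v w) // (half v w u) // [RHS]addrC addrA.
Qed.

End CyclicForm.

Lemma d_formZ a (W : 'rV[R]_n -> 'M[C]_n) x X Y Z : cdifferentiable W x ->
  d_form (fun y => a *: W y) x X Y Z = a *: d_form W x X Y Z.
Proof.
move=> dW; rewrite /d_form !dCZ // !scalerDr.
by rewrite -!scalemxAr -!scalemxAl.
Qed.

(** * Closedness of L1 in coordinates *)

Section LocalClosed.
Variables (E J K : 'rV[R]_n -> 'M[R]_n) (x : 'rV[R]_n).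
Hypotheses (dE : differentiable E x) (dEV : differentiable (fun y => invmx (E y)) x)
  (dJ : differentiable J x) (dK : differentiable K x).
Hypotheses (Esk : \near x, (E x)^T = - E x) (EU : \near x, E x \in unitmx)
  (J2 : \near x, J x *m J x = - 1%:M) (K2 : \near x, K x *m K x = - 1%:M)
  (KE : \near x, K x *m E x = (J x *m E x)^T).
Hypotheses (closedE : forall X Y Z, d_form (fun y => toC (E y)) x X Y Z = 0)
  (NJ : forall a b, nijenhuis_form J x a b = 0)
  (NK : forall a b, nijenhuis_form K x a b = 0).

Definition scaled_graph s y : 'M[C]_(n, n + n) := graph_mx (s *: toC (E y)).

(* L1 in terms of eps: the parts of L+ and L- over X are X + i eps X and
   X - i eps X. *)
Definition in_L1 y (w : 'rV[C]_(n + n)) := exists X Y, [/\ X *m toC (J y) = iC *: X,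
  Y *m toC (K y) = iC *: Y & w = X *m scaled_graph iC y + Y *m scaled_graph (- iC) y].

(** Each graph is isotropic because eps is skew. Across the two graphs the pairing is a multiple of
    eps(X, Y), and [K E = (J E)^T] with skewness gives eps(X, KY) = -eps(JX, Y); for i-eigenvectors
    X of J and Y of K this reads i eps(X, Y) = -i eps(X, Y). *)
Lemma isotropic_L1 y v w : (E y)^T = - E y -> K y *m E y = (J y *m E y)^T ->
  in_L1 y v -> in_L1 y w -> dpair v w = 0.
Proof.
move=> Ey KEy.
have EyC a : (a *: toC (E y))^T = - (a *: toC (E y)).
  by rewrite linearZ /= -toC_tr Ey toCN scalerN.
have EC : (toC (E y))^T = - toC (E y) by rewrite -toC_tr Ey toCN.
have mixed (X Y : 'rV[C]_n) : X *m toC (J y) = iC *: X -> Y *m toC (K y) = iC *: Y ->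
    dpair (X *m scaled_graph iC y) (Y *m scaled_graph (- iC) y) = 0.
  move=> XJ YK; rewrite dpair_mul dpair_row trmx1 mulmx1 mul1mx EyC scaleNr opprK.
  rewrite mulmxDr mulmxDl -scalemxAr -scalemxAl -!scalerDr.
  suff -> : X *m toC (E y) *m Y^T = 0 by rewrite addr0 scaler0.
  apply: eq_oppr0; apply: (@scalerI _ _ iC).
    by rewrite eq_complex /= oner_eq0 andbF.
  rewrite scalerN {1}scalemxAl {1}scalemxAl -XJ [in RHS]scalemxAr -linearZ /= -YK.
  rewrite trmx_mul !mulmxA -(mulmxA X) -(mulmxA X (toC (E y))) -toCM.
  have -> : toC (E y) *m (toC (K y))^T = - toC (J y *m E y).
    have E0 : E y = - (E y)^T by rewrite Ey opprK.
    by rewrite -toC_tr -toCM -toCN {1}E0 mulNmx -trmx_mul KEy trmxK.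
  by rewrite mulmxN mulNmx opprK.
move=> [X [Y [XJ YK ->]]] [X' [Y' [XJ' YK' ->]]].
have h1 := mixed _ _ XJ YK'; have h2 := mixed _ _ XJ' YK.
have h3 := dpair_graph X X' (EyC iC); have h4 := dpair_graph Y Y' (EyC (- iC)).
move: h1 h2 h3 h4; rewrite -!/(scaled_graph _ _).
move: (X *m scaled_graph iC y) (Y *m scaled_graph (- iC) y)
  (X' *m scaled_graph iC y) (Y' *m scaled_graph (- iC) y) => a b c d h1 h2 h3 h4.
by rewrite !dpairDl !dpairDr h3 h1 (dpairC b c) h2 h4 !addr0.
Qed.

Lemma cdifferentiable_scaled_graph s (X : 'rV[R]_n -> 'rV[C]_n) : cdifferentiable X x ->
  cdifferentiable (fun y => X y *m scaled_graph s y) x.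
Proof.
move=> dX; apply: cdifferentiable_mulmx dX _; apply: cdifferentiable_graph.
exact/cdifferentiableZ/cdifferentiable_toC.
Qed.

Lemma courant_form_scaled_graph s (X Y : 'rV[R]_n -> 'rV[C]_n) w :
  cdifferentiable X x -> cdifferentiable Y x ->
  courant_form (fun y => X y *m scaled_graph s y) (fun y => Y y *m scaled_graph s y) x w =
  dpair ((dC (X x) Y x - dC (Y x) X x) *m scaled_graph s x) w.
Proof.
move=> dX dY; have dEC := cdifferentiable_toC dE.
rewrite courant_form_graph //; last 2 first.
- exact: cdifferentiableZ.
- by apply: filterS Esk => y Ey; rewrite linearZ /= -toC_tr Ey toCN scalerN.
by rewrite d_formZ // closedE scaler0 addr0.
Qed.

(** Since eps is closed, the bracket is the element of the graph over the Lie bracket of the vector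
    parts. That Lie bracket stays in the eigenbundle, so the Courant bracket lies in L1, which is
    isotropic. *)
Lemma courant_form_Lplus (X Y : 'rV[R]_n -> 'rV[C]_n) w :
  cdifferentiable X x -> cdifferentiable Y x ->
  (\near x, X x *m toC (J x) = iC *: X x) -> (\near x, Y x *m toC (J x) = iC *: Y x) ->
  in_L1 x w ->
  courant_form (fun y => X y *m scaled_graph iC y) (fun y => Y y *m scaled_graph iC y) x w = 0.
Proof.
move=> dX dY XJ YJ; rewrite courant_form_scaled_graph //.
apply: isotropic_L1; [exact: nbhs_singleton Esk|exact: nbhs_singleton KE|].
exists (dC (X x) Y x - dC (Y x) X x), 0.
by rewrite !mul0mx scaler0 addr0; split=> //; exact: involutive_eig.
Qed.

Lemma courant_form_Lminus (X Y : 'rV[R]_n -> 'rV[C]_n) w :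
  cdifferentiable X x -> cdifferentiable Y x ->
  (\near x, X x *m toC (K x) = iC *: X x) -> (\near x, Y x *m toC (K x) = iC *: Y x) ->
  in_L1 x w ->
  courant_form (fun y => X y *m scaled_graph (- iC) y)
    (fun y => Y y *m scaled_graph (- iC) y) x w = 0.
Proof.
move=> dX dY XK YK; rewrite courant_form_scaled_graph //.
apply: isotropic_L1; [exact: nbhs_singleton Esk|exact: nbhs_singleton KE|].
exists 0, (dC (X x) Y x - dC (Y x) X x).
by rewrite !mul0mx scaler0 add0r; split=> //; exact: involutive_eig.
Qed.

(** With X and Y the vector parts of the two components, [Z] is X + Y, and applying i eps^-1 to the
    covector part i eps(X - Y) gives [T], which is Y - X. So X and Y are half of [Z - T] and
    [Z + T], formulas that are differentiable with [u] and the inverse of [E]. *)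
Lemma L1_split (u : 'rV[R]_n -> 'rV[C]_(n + n)) : cdifferentiable u x ->
  (\near x, in_L1 x (u x)) ->
  exists X Y, [/\ cdifferentiable X x, cdifferentiable Y x,
    \near x, X x *m toC (J x) = iC *: X x, \near x, Y x *m toC (K x) = iC *: Y x
    & \near x, u x = X x *m scaled_graph iC x + Y x *m scaled_graph (- iC) x].
Proof.
move=> du uL.
pose Z y := lsubmx (u y); pose T y := iC *: (rsubmx (u y) *m toC (invmx (E y))).
have dZ : cdifferentiable Z x.
  rewrite /Z; under eq_fun do rewrite lsubmx_mul.
  exact: cdifferentiable_mulmx du (cdifferentiable_cst _ _).
have dT : cdifferentiable T x.
  apply: cdifferentiableZ; apply: cdifferentiable_mulmx; last exact: cdifferentiable_toC.
  under eq_fun do rewrite rsubmx_mul.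
  exact: cdifferentiable_mulmx du (cdifferentiable_cst _ _).
have E1 : \near x, forall X Y, u x = X *m scaled_graph iC x + Y *m scaled_graph (- iC) x ->
    2^-1 *: (Z x - T x) = X /\ 2^-1 *: (Z x + T x) = Y.
  apply: filterS EU => y Ey X Y uy.
  have : [/\ lsubmx (X *m scaled_graph iC y) = X,
      rsubmx (X *m scaled_graph iC y) = X *m (iC *: toC (E y)),
      lsubmx (Y *m scaled_graph (- iC) y) = Y
    & rsubmx (Y *m scaled_graph (- iC) y) = Y *m (- iC *: toC (E y))].
    by split; [exact: lsub_graph|exact: rsub_graph|exact: lsub_graph|exact: rsub_graph].
  move: (X *m scaled_graph iC y) (Y *m scaled_graph (- iC) y) uy => a b uy [aX aE bY bE].
  have -> : Z y = X + Y.
    by rewrite /Z uy lsubmxD aX bY.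
  have -> : T y = Y - X.
    rewrite /T uy rsubmxD aE bE scaleNr mulmxN -mulmxBl.
    rewrite -scalemxAr -scalemxAl scalerA mulii -mulmxA -toCM mulmxV // toC1 mulmx1.
    by rewrite scaleN1r opprB.
  split; first by rewrite opprB addrACA subrr addr0 half_double.
  by rewrite addrC addrA subrK half_double.
exists (fun y => 2^-1 *: (Z y - T y)), (fun y => 2^-1 *: (Z y + T y)).
split; [|by apply: cdifferentiableZ; exact: cdifferentiableD| | |].
- apply: cdifferentiableZ; apply: cdifferentiableD => //.
  by under eq_fun do rewrite -scaleN1r; exact: cdifferentiableZ.
- by apply: filterS2 E1 uL => y Ey [X [Y [XJ YK /Ey[-> _]]]].
- by apply: filterS2 E1 uL => y Ey [X [Y [XJ YK /Ey[_ ->]]]].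
- by apply: filterS2 E1 uL => y Ey [X [Y [XJ YK uy]]]; have [-> ->] := Ey _ _ uy.
Qed.

(** The projections of a constant vector to the i-eigenspaces of [J y] and [K y] are eigenvectors at
    nearby points and return the given eigenvectors at [x]. *)
Lemma L1_extend w : in_L1 x w ->
  exists X Y, [/\ cdifferentiable X x, cdifferentiable Y x,
    \near x, X x *m toC (J x) = iC *: X x, \near x, Y x *m toC (K x) = iC *: Y x
    & w = X x *m scaled_graph iC x + Y x *m scaled_graph (- iC) x].
Proof.
move=> [X [Y [XJ YK ->]]].
have cd (H : 'rV[R]_n -> 'M[R]_n) (A : 'rV[C]_n) : differentiable H x ->
    cdifferentiable (fun y => eig_proj (H y) A) x.
  move=> dH; apply: cdifferentiableZ; apply: cdifferentiableD; first exact: cdifferentiable_cst.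
  under eq_fun do rewrite -scaleNr; apply: cdifferentiableZ.
  exact: cdifferentiable_mulmx (cdifferentiable_cst _ _) (cdifferentiable_toC dH).
have fixed (H : 'M[R]_n) (A : 'rV[C]_n) : A *m toC H = iC *: A -> eig_proj H A = A.
  by move=> AH; rewrite /eig_proj AH scalerA mulii scaleN1r opprK half_double.
exists (fun y => eig_proj (J y) X), (fun y => eig_proj (K y) Y); split.
- exact: cd.
- exact: cd.
- by apply: filterS J2 => y Jy; exact: eig_projE.
- by apply: filterS K2 => y Ky; exact: eig_projE.
- by rewrite !fixed.
Qed.

Lemma courant_form_L1 u v w : cdifferentiable u x -> cdifferentiable v x ->
  (\near x, in_L1 x (u x)) -> (\near x, in_L1 x (v x)) -> in_L1 x w ->
  courant_form u v x w = 0.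
Proof.
move=> du dv /(L1_split du)[X [Y [dX dY XJ YK uE]]] /(L1_split dv)[X' [Y' [dX' dY' XJ' YK' vE]]].
move=> /L1_extend[X'' [Y'' [dX'' dY'' XJ'' YK'' ->]]].
rewrite (courant_form_near_eq _ uE vE).
pose sp (X : 'rV[R]_n -> 'rV[C]_n) y := X y *m scaled_graph iC y.
pose sm (X : 'rV[R]_n -> 'rV[C]_n) y := X y *m scaled_graph (- iC) y.
have csp A : cdifferentiable A x -> cdifferentiable (sp A) x.
  exact: cdifferentiable_scaled_graph.
have csm A : cdifferentiable A x -> cdifferentiable (sm A) x.
  exact: cdifferentiable_scaled_graph.
have Lp A : (\near x, A x *m toC (J x) = iC *: A x) -> \near x, in_L1 x (sp A x).
  by apply: filterS => y Ay; exists (A y), 0; rewrite !mul0mx scaler0 addr0.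
have Lm A : (\near x, A x *m toC (K x) = iC *: A x) -> \near x, in_L1 x (sm A x).
  by apply: filterS => y Ay; exists 0, (A y); rewrite !mul0mx scaler0 add0r.
have iso a b : (\near x, in_L1 x (a x)) -> (\near x, in_L1 x (b x)) ->
    \near x, dpair (a x) (b x) = 0.
  move=> La Lb; apply: (filterS _ (filterI (filterI Esk KE) (filterI La Lb))).
  by move=> y [[e ke] [la lb]]; exact: (isotropic_L1 e ke la lb).
have cyc a b c : cdifferentiable a x -> cdifferentiable b x -> cdifferentiable c x ->
    (\near x, in_L1 x (a x)) -> (\near x, in_L1 x (b x)) -> (\near x, in_L1 x (c x)) ->
    courant_form a b x (c x) = courant_form b c x (a x).
  move=> da db dc la lb lc.
  exact: (courant_form_cyclic da db dc (iso _ _ la lb) (iso _ _ lb lc) (iso _ _ lc la)).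
have pp A B z : cdifferentiable A x -> cdifferentiable B x ->
    (\near x, A x *m toC (J x) = iC *: A x) -> (\near x, B x *m toC (J x) = iC *: B x) ->
    in_L1 x z -> courant_form (sp A) (sp B) x z = 0.
  exact: courant_form_Lplus.
have mm A B z : cdifferentiable A x -> cdifferentiable B x ->
    (\near x, A x *m toC (K x) = iC *: A x) -> (\near x, B x *m toC (K x) = iC *: B x) ->
    in_L1 x z -> courant_form (sm A) (sm B) x z = 0.
  exact: courant_form_Lminus.
have pm A B z : cdifferentiable A x -> cdifferentiable B x ->
    (\near x, A x *m toC (J x) = iC *: A x) -> (\near x, B x *m toC (K x) = iC *: B x) ->
    z = sp X'' \/ z = sm Y'' -> courant_form (sp A) (sm B) x (z x) = 0.
  move=> dA dB AJ BK; have lA := Lp _ AJ; have lB := Lm _ BK.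
  have cA := csp _ dA; have cB := csm _ dB; case=> ->.
    (* Two cyclic shifts bring the two sections of L+ together into the bracket; when the third
       section is in L-, one shift brings the two sections of L- together. *)
    apply: etrans (cyc _ _ _ cA cB (csp _ dX'') lA lB (Lp _ XJ'')) _.
    apply: etrans (cyc _ _ _ cB (csp _ dX'') cA lB (Lp _ XJ'') lA) _.
    by apply: pp => //; exact: (nbhs_singleton lB).
  apply: etrans (cyc _ _ _ cA cB (csm _ dY'') lA lB (Lm _ YK'')) _.
  by apply: mm => //; exact: (nbhs_singleton lA).
have Lw : in_L1 x (sp X'' x) /\ in_L1 x (sm Y'' x).
  by split; [exact: nbhs_singleton (Lp _ XJ'')|exact: nbhs_singleton (Lm _ YK'')].
rewrite -[LHS]/(courant_form (fun y => sp X y + sm Y y) (fun y => sp X' y + sm Y' y) x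
  (sp X'' x + sm Y'' x)).
have e1 : courant_form (sp X) (sm Y') x (sp X'' x) = 0 by apply: pm => //; left.
have e2 : courant_form (sp X) (sm Y') x (sm Y'' x) = 0 by apply: pm => //; right.
(* The terms whose first section lies in L- and second in L+ are treated in the opposite order; the
   skew symmetry of [courant_form] restores them in the final sum. *)
have e3 : courant_form (sp X') (sm Y) x (sp X'' x) = 0 by apply: pm => //; left.
have e4 : courant_form (sp X') (sm Y) x (sm Y'' x) = 0 by apply: pm => //; right.
have e5 := pp _ _ _ dX dX' XJ XJ' Lw.1; have e6 := pp _ _ _ dX dX' XJ XJ' Lw.2.
have e7 := mm _ _ _ dY dY' YK YK' Lw.1; have e8 := mm _ _ _ dY dY' YK YK' Lw.2.
have cY := csm _ dY; have cX := csp _ dX; have cY' := csm _ dY'; have cX' := csp _ dX'.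
move: (sp X) (sm Y) (sp X') (sm Y') (sp X'' x) (sm Y'' x) cX cY cX' cY' e1 e2 e3 e4 e5 e6 e7 e8.
move=> a b a' b' c d ca cb ca' cb' e1 e2 e3 e4 e5 e6 e7 e8.
rewrite courant_formD !(courant_formDl _ _ ca cb) !(courant_formDr _ _ ca' cb').
by rewrite !(courant_formC a' b) e1 e2 e3 e4 e5 e6 e7 e8 !oppr0 !addr0.
Qed.

End LocalClosed.

End LocalCourant.

(** * Fields and bundles on the manifold *)

Section FieldsInCharts.
Variables (R : realType) (n : nat) (M : manifold R n).
Local Notation C := R[i].
Local Notation iC := ('i%C : C).
Implicit Types (c : chart R n M) (p q : M) (U : set M).

Lemma near_chart_img c U q (P : 'rV[R]_n -> Prop) : open U -> U q -> chart_dom c q ->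
  (forall q', U q' -> chart_dom c q' -> P (c q')) -> \forall x \near c q, P x.
Proof.
move=> oU Uq cq UP; have cx : (c @` (U `&` chart_dom c)) (c q) by exists q.
apply: (filterS _ (open_nbhs_nbhs (conj (@open_chart_img _ _ _ c _ oU) cx))).
by move=> _ [q' [Uq' cq'] <-]; exact: UP.
Qed.

Lemma near_chart c q (P : 'rV[R]_n -> Prop) : chart_dom c q ->
  (\forall x \near c q, P x) -> \forall q' \near q, P (c q').
Proof.
move=> cq nP; have cc : {for q, continuous c}.
  have := @chart_cont _ _ _ c; rewrite continuous_open_subspace; last exact: chart_dom_open.
  by apply; rewrite inE.
exact: cc.
Qed.

Lemma smooth_on_chart c U m k (f g : 'rV[R]_n -> 'M[R]_(m, k)) : open U ->
  (forall q, U q -> chart_dom c q -> f (c q) = g (c q)) ->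
  smooth_on (c @` (U `&` chart_dom c)) f -> smooth_on (c @` (U `&` chart_dom c)) g.
Proof.
move=> oU fg; apply: smooth_on_eq; first exact: open_chart_img.
by move=> x; rewrite inE => -[q [Uq cq] <-]; exact: fg.
Qed.

Lemma smooth_on_chart_dom c m k (f g : 'rV[R]_n -> 'M[R]_(m, k)) :
  (forall q, chart_dom c q -> f (c q) = g (c q)) ->
  smooth_on (c @` chart_dom c) f -> smooth_on (c @` chart_dom c) g.
Proof.
move=> fg; apply: smooth_on_eq; first exact: chart_img_open.
by move=> x; rewrite inE => -[q cq <-]; exact: fg.
Qed.

Let oimg c : open (c @` chart_dom c) := @chart_img_open _ _ _ c.

Lemma smooth_form_mul (A E : M -> 'M[R]_n) : smooth_endo A -> smooth_form E ->
  smooth_form (fun q => A q *m E q).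
Proof.
move=> sA sE c ac; apply: (smooth_on_chart_dom _ (smooth_on_mulmx (@oimg c) (sA c ac) (sE c ac))).
by move=> q cq; rewrite form_in_mul.
Qed.

Lemma smooth_formD (E F : M -> 'M[R]_n) : smooth_form E -> smooth_form F ->
  smooth_form (fun q => E q + F q).
Proof.
move=> sE sF c ac; apply: (smooth_on_chart_dom _ (smooth_onD (@oimg c) (sE c ac) (sF c ac))).
by move=> q cq; rewrite form_inD.
Qed.

Lemma smooth_formN (E : M -> 'M[R]_n) : smooth_form E -> smooth_form (fun q => - E q).
Proof.
move=> sE c ac; apply: (smooth_on_chart_dom _ (smooth_onN (@oimg c) (sE c ac))).
by move=> q cq; rewrite form_inN.
Qed.

Lemma smooth_formZ a (E : M -> 'M[R]_n) : smooth_form E -> smooth_form (fun q => a *: E q).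
Proof.
move=> sE c ac; apply: (smooth_on_chart_dom _ (smooth_onZ a (@oimg c) (sE c ac))).
by move=> q cq; rewrite form_inZ.
Qed.

Lemma smooth_form_tr (E : M -> 'M[R]_n) : smooth_form E -> smooth_form (fun q => (E q)^T).
Proof.
move=> sE c ac; apply: (smooth_on_chart_dom _ (smooth_on_trmx (@oimg c) (sE c ac))).
by move=> q cq; rewrite form_in_tr.
Qed.

Lemma smooth_endoD (A B : M -> 'M[R]_n) : smooth_endo A -> smooth_endo B ->
  smooth_endo (fun q => A q + B q).
Proof.
move=> sA sB c ac; apply: (smooth_on_chart_dom _ (smooth_onD (@oimg c) (sA c ac) (sB c ac))).
by move=> q cq; rewrite endo_inD.
Qed.

Lemma smooth_endoN (A : M -> 'M[R]_n) : smooth_endo A -> smooth_endo (fun q => - A q).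
Proof.
move=> sA c ac; apply: (smooth_on_chart_dom _ (smooth_onN (@oimg c) (sA c ac))).
by move=> q cq; rewrite endo_inN.
Qed.

Lemma smooth_endo_inv (A : M -> 'M[R]_n) : (forall q, A q \in unitmx) ->
  smooth_endo A -> smooth_endo (fun q => invmx (A q)).
Proof.
move=> uA sA c ac.
have uAc x : (c @` chart_dom c) x -> endo_in c A x \in unitmx.
  by move=> [q cq <-]; exact: endo_in_unit.
apply: (smooth_on_chart_dom _ (smooth_on_invmx (@oimg c) uAc (sA c ac))).
by move=> q cq; rewrite endo_in_inv.
Qed.

Lemma smooth_form_inv c (E : M -> 'M[R]_n) : atlas c -> nondegenerate_form E ->
  smooth_form E -> smooth_on (c @` chart_dom c) (fun x => invmx (form_in c E x)).
Proof.
move=> ac nE sE; apply: smooth_on_invmx (sE c ac) => //.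
by move=> _ [q cq <-]; exact: form_in_unit.
Qed.

Lemma smooth_endo_conj (E J : M -> 'M[R]_n) : nondegenerate_form E -> smooth_form E ->
  smooth_endo J -> smooth_endo (conj_endo E J).
Proof.
move=> nE sE sJ c ac.
apply: (smooth_on_chart_dom _ (smooth_on_mulmx (@oimg c)
  (smooth_on_mulmx (@oimg c) (sE c ac) (smooth_on_trmx (@oimg c) (sJ c ac)))
  (smooth_form_inv ac nE sE))).
by move=> q cq; rewrite endo_in_conj.
Qed.

Lemma smooth_vec_mul U X A : open U -> smooth_vec U X -> smooth_endo A ->
  smooth_vec U (fun q => X q *m A q).
Proof.
move=> oU sX sA c ac; have oA := @open_chart_img _ _ _ c _ oU.
have sA' : smooth_on (c @` (U `&` chart_dom c)) (endo_in c A).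
  by apply: smooth_on_sub (sA c ac) => _ [q [_ cq] <-]; exists q.
apply: (smooth_on_chart oU _ (smooth_on_mulmx oA (sX c ac) sA')).
by move=> q Uq cq; rewrite vec_in_mul.
Qed.

Lemma smooth_vec0 U : open U -> smooth_vec U (fun=> 0 : 'rV[R]_n).
Proof.
move=> oU c ac; apply: (smooth_on_chart oU _ (smooth_on_cst _ 0)) => q _ cq.
by rewrite /vec_in mul0mx.
Qed.

Lemma gen_in_row c q (X Y : M -> 'rV[R]_n) E : atlas c -> chart_dom c q ->
  gen_in c (fun q => row_mx (X q) (Y q *m E q)) (c q) =
  row_mx (vec_in c X (c q)) (vec_in c Y (c q) *m form_in c E (c q)).
Proof.
move=> ac cq; rewrite /gen_in /vec_in /form_in chart_funK //.
pattern (jac_to c q), (jac_from c q); apply: in_chartP => // P Q PQ QP.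
rewrite mul_row_block !mulmx0 addr0 add0r.
by rewrite !mulmxA -(mulmxA _ P) PQ mulmx1.
Qed.

Lemma smooth_gen_row U (X Y : M -> 'rV[R]_n) E : open U -> smooth_vec U X ->
  smooth_vec U Y -> smooth_form E -> smooth_gen U (fun q => row_mx (X q) (Y q *m E q)).
Proof.
move=> oU sX sY sE c ac; have oA := @open_chart_img _ _ _ c _ oU.
have sE' : smooth_on (c @` (U `&` chart_dom c)) (form_in c E).
  by apply: smooth_on_sub (sE c ac) => _ [q [_ cq] <-]; exists q.
apply: (smooth_on_chart oU _ (smooth_on_row_mx oA (sX c ac) (smooth_on_mulmx oA (sY c ac) sE'))).
by move=> q Uq cq; rewrite gen_in_row.
Qed.

(** The vector field with constant components [a] in the chart [c], written in [chart_at q] at each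
    point. *)
Definition const_vec c (a : 'rV[R]_n) q : 'rV[R]_n := a *m chart_change c (chart_at q) q.

Lemma vec_in_const c c' a q : atlas c -> atlas c' -> chart_dom c q -> chart_dom c' q ->
  vec_in c' (const_vec c a) (c' q) = a *m chart_change c c' q.
Proof.
move=> ac ac' cq cq'; rewrite /vec_in (chart_funK cq') jac_toE -mulmxA.
by rewrite (chart_change_comp ac (chart_at_atlas q) ac' cq (chart_at_dom q) cq').
Qed.

Lemma smooth_const_vec c a : atlas c -> smooth_vec (chart_dom c) (const_vec c a).
Proof.
move=> ac c' ac'; have oA := @open_chart_img2 _ _ _ c' c.
have -> : c' @` (chart_dom c `&` chart_dom c') = c' @` (chart_dom c' `&` chart_dom c).
  by rewrite setIC.
apply: (@smooth_on_eq _ _ _ _ (fun x => a *m chart_change c c' (chart_inv c' x)) _ oA).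
  move=> x; rewrite inE => -[q [cq' cq] <-].
  by rewrite (vec_in_const _ ac ac' cq cq') (chart_funK cq').
apply: smooth_on_mulmx (smooth_on_cst _ _) _ => //.
exact: smooth_chart_change_inv.
Qed.

Definition genC_in c m (u : M -> 'M[C]_(m, n + n)) x : 'M[C]_(m, n + n) :=
  cplx (gen_in c (fun q => mxRe (u q)) x) (gen_in c (fun q => mxIm (u q)) x).

Lemma genC_in_cdifferentiable c U m (u : M -> 'M[C]_(m, n + n)) q : atlas c -> U q ->
  chart_dom c q -> smooth_genC U u -> cdifferentiable (genC_in c u) (c q).
Proof.
move=> ac Uq cq [s0 s1]; have cx : (c @` (U `&` chart_dom c)) (c q) by exists q.
apply: cdifferentiableE.
  exact: (smooth_on_differentiable (s0 c ac) cx).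
exact: (smooth_on_differentiable (s1 c ac) cx).
Qed.

Lemma courantC_form U u v p w : U p -> smooth_genC U u -> smooth_genC U v ->
  dpair (courantC u v p) w = courant_form (genC_in (chart_at p) u)
    (genC_in (chart_at p) v) (chart_at p p) w.
Proof.
move=> Up [u0 u1] [v0 v1]; have cp := chart_at_dom p; have ac := chart_at_atlas p.
have cx : (chart_at p @` (U `&` chart_dom (chart_at p))) (chart_at p p) by exists p.
exact: (courant_form_cplx w (smooth_on_differentiable (u0 _ ac) cx)
  (smooth_on_differentiable (u1 _ ac) cx) (smooth_on_differentiable (v0 _ ac) cx)
  (smooth_on_differentiable (v1 _ ac) cx)).
Qed.

Lemma lsub_courant (u v : M -> 'rV[R]_(n + n)) p : lsubmx (courant u v p) =
  lie_bracket (fun q => lsubmx (u q)) (fun q => lsubmx (v q)) p.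
Proof.
have E (w : M -> 'rV[R]_(n + n)) : (fun y => lsubmx (gen_in (chart_at p) w y)) =
    vec_in (chart_at p) (fun q => lsubmx (w q)).
  apply/funext => x; rewrite /gen_in /vec_in; set q := chart_inv _ x.
  move: (jac_to _ q) (jac_from _ q) => P Q.
  by rewrite -{1}[w q]hsubmxK mul_row_block row_mxKl mulmx0 addr0.
by rewrite /courant /courant_Rn row_mxKl !E.
Qed.

Section AtPoint.
Variables (c : chart R n M) (q : M) (ac : atlas c) (cq : chart_dom c q).

Lemma genC_inE m (u : M -> 'M[C]_(m, n + n)) :
  genC_in c u (c q) = u q *m toC (block_mx (jac_to c q) 0 0 (jac_from c q)^T).
Proof.
rewrite /genC_in /gen_in (chart_funK cq); move: (block_mx _ _ _ _) => D.
by rewrite -{3}[u q]cplx_ReIm toCE cplxM !mulmx0 subr0 add0r.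
Qed.

Lemma graph_coord (W : 'M[C]_n) :
  graph_mx W *m toC (block_mx (jac_to c q) 0 0 (jac_from c q)^T) =
  toC (jac_to c q) *m graph_mx (toC (jac_from c q) *m W *m (toC (jac_from c q))^T).
Proof.
pattern (jac_to c q), (jac_from c q); apply: in_chartP => // P Q PQ QP.
have -> : toC (block_mx P 0 0 Q^T) = block_mx (toC P) 0 0 (toC Q)^T.
  by rewrite /toC map_block_mx !map_mx0 -[map_mx _ Q^T]/(toC _) toC_tr.
rewrite /graph_mx mul_row_block mul_mx_row !(mulmx0, mul1mx, mulmx1, addr0, add0r).
by rewrite !mulmxA -toCM PQ toC1 mul1mx.
Qed.

Lemma genC_in_graph (u : M -> 'rV[C]_(n + n)) X A B :
  u q = X *m graph_mx (cplx (A q) (B q)) ->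
  genC_in c u (c q) = X *m toC (jac_to c q) *m
    graph_mx (cplx (form_in c A (c q)) (form_in c B (c q))).
Proof.
move=> uq; rewrite genC_inE uq -mulmxA graph_coord mulmxA; congr (_ *m graph_mx _).
rewrite /form_in (chart_funK cq); move: (jac_from c q) => Q.
by rewrite -toC_tr !toCE !cplxM !(mulmx0, mul0mx, subr0, addr0, add0r).
Qed.

Lemma eig_coord (X : 'rV[C]_n) A : X *m toC (A q) = iC *: X ->
  X *m toC (jac_to c q) *m toC (endo_in c A (c q)) = iC *: (X *m toC (jac_to c q)).
Proof.
move=> XA; rewrite /endo_in (chart_funK cq).
pattern (jac_to c q), (jac_from c q); apply: in_chartP => // P Q PQ QP.
rewrite !toCM !mulmxA -(mulmxA X) -toCM PQ toC1 mulmx1 XA.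
by rewrite -scalemxAl.
Qed.

End AtPoint.

Lemma jac_to_at p : jac_to (chart_at p) p = 1%:M.
Proof.
by rewrite jac_toE chart_change_id //; [exact: chart_at_atlas|exact: chart_at_dom].
Qed.

Lemma jac_from_at p : jac_from (chart_at p) p = 1%:M.
Proof.
by rewrite jac_fromE chart_change_id //; [exact: chart_at_atlas|exact: chart_at_dom].
Qed.

Lemma form_in_at p E : form_in (chart_at p) E (chart_at p p) = E p.
Proof.
have cp := chart_at_dom p; rewrite /form_in (chart_funK cp) jac_from_at.
by rewrite trmx1 mul1mx mulmx1.
Qed.

Lemma endo_in_at p A : endo_in (chart_at p) A (chart_at p p) = A p.
Proof.
have cp := chart_at_dom p; rewrite /endo_in (chart_funK cp) jac_from_at jac_to_at.
by rewrite mul1mx mulmx1.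
Qed.

End FieldsInCharts.

(** * Smooth frames of eigenbundles *)

Section EigenFrames.
Variables (R : realType) (n : nat).
Local Notation C := R[i].
Local Notation iC := ('i%C : C).
Variables (JJ : 'M[R]_(n + n)) (JJ2 : JJ *m JJ = - 1%:M).

Lemma rank_eig_half : \rank (eigenspace (toC JJ) iC) = n.
Proof.
by apply: double_inj; rewrite -!addnn; exact: rank_eig JJ2.
Qed.

(** A row t of [T] yields t - i tJ, twice its projection to the i-eigenspace. Independence over R of
    the rows of [T] and [T *m JJ] is independence over C of these n vectors, and n is the rank of
    the eigenspace. *)
Lemma frame_eig (T : 'M[R]_(n, n + n)) : col_mx T (T *m JJ) \in unitmx ->
  let s := cplx T (- (T *m JJ)) in
  row_free s /\ (s == eigenspace (toC JJ) iC)%MS.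
Proof.
move=> u s; have fs : row_free s.
  apply: row_free_rV0 => v; rewrite -[v]cplx_ReIm cplxM mulmxN opprK -[0 in RHS]cplx_ReIm.
  move=> /cplx_inj[+ _]; rewrite [mxRe 0](_ : _ = 0); last by apply/matrixP => i j; rewrite !mxE.
  rewrite -mul_row_col => /(congr1 (mulmx^~ (invmx (col_mx T (T *m JJ))))).
  rewrite mulmxK // mul0mx -[0 in RHS]row_mx0 => /eq_row_mx[-> ->].
  by apply/matrixP => i j; rewrite !mxE.
split=> //; have sL : (s <= eigenspace (toC JJ) iC)%MS.
  apply/eigenspaceP; rewrite toCE cplxM !mulmx0 subr0 add0r cplxi opprK.
  by rewrite mulNmx -mulmxA JJ2 mulmxN mulmx1 opprK.
have := mxrank_leqif_eq sL; rewrite rank_eig_half => -[_ <-].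
by rewrite (eqP fs).
Qed.

(** The real part of a complex basis [S] of the eigenspace works: as Re S J = -Im S, a real relation
    between the rows of Re S and of Re S J is the real part of a complex relation between the rows
    of [S], and applying J gives its imaginary part. *)
Lemma exists_frame : exists T : 'M[R]_(n, n + n), col_mx T (T *m JJ) \in unitmx.
Proof.
have : exists S : 'M[C]_(\rank (eigenspace (toC JJ) iC), n + n),
    row_free S /\ (S <= eigenspace (toC JJ) iC)%MS.
  exists (row_base (eigenspace (toC JJ) iC)); split; first exact: row_base_free.
  by rewrite eq_row_base.
rewrite rank_eig_half => -[S [fS /eigenspaceP ES]].
exists (mxRe S); rewrite -row_free_unit; apply: row_free_rV0 => v.
rewrite -[v]hsubmxK mul_row_col; set a := lsubmx v; set b := rsubmx v => ab0.
have E1 : mxRe S *m JJ = - mxIm S.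
  move: ES; rewrite -[S]cplx_ReIm toCE cplxM cplxi !mulmx0 subr0 add0r => /cplx_inj[].
  by rewrite !(mxRe_cplx, mxIm_cplx).
have E2 : mxIm S *m JJ = mxRe S.
  apply: oppr_inj; rewrite -mulNmx -E1 -mulmxA JJ2 mulmxN mulmx1 //.
have z : cplx a b *m S = 0.
  rewrite -[S]cplx_ReIm cplxM; move: ab0; rewrite E1 mulmxN => ab0.
  have -> : a *m mxIm S + b *m mxRe S = 0.
    have : (a *m mxRe S - b *m mxIm S) *m JJ = 0 by rewrite ab0 mul0mx.
    rewrite mulmxBl -!mulmxA E1 E2 mulmxN -opprD => /eqP.
    by rewrite oppr_eq0 => /eqP.
  by rewrite ab0; apply/matrixP => i j; rewrite !mxE.
have : cplx a b = 0.
  by have := row_free_inj fS (_ : cplx a b *m S = 0 *m S); rewrite z mul0mx; apply.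
move=> E0; have [-> ->] : a = 0 /\ b = 0.
  by apply: cplx_inj; rewrite E0; apply/matrixP => i j; rewrite !mxE.
by rewrite row_mx0.
Qed.

End EigenFrames.

Section SubbundleOfEndo.
Variables (R : realType) (n : nat) (M : manifold R n).
Local Notation C := R[i].
Local Notation iC := ('i%C : C).
Implicit Types (c : chart R n M) (p q : M) (U : set M).

Definition gendo_in c (JJ : M -> 'M[R]_(n + n)) x : 'M[R]_(n + n) :=
  let q := chart_inv c x in
  gen_change c (chart_at q) q *m JJ q *m gen_change (chart_at q) c q.

Lemma gen_inE m c (u : M -> 'M[R]_(m, n + n)) q : chart_dom c q ->
  gen_in c u (c q) = u q *m gen_change (chart_at q) c q.
Proof. by move=> cq; rewrite /gen_in (chart_funK cq) jac_toE jac_fromE. Qed.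

Lemma gen_change_atK c q : atlas c -> chart_dom c q ->
  gen_change (chart_at q) c q *m gen_change c (chart_at q) q = 1%:M.
Proof.
by move=> ac cq; exact: (gen_changeK (chart_at_atlas q) ac (chart_at_dom q) cq).
Qed.

Lemma gen_in_mul m c (u : M -> 'M[R]_(m, n + n)) JJ q : atlas c -> chart_dom c q ->
  gen_in c (fun q => u q *m JJ q) (c q) = gen_in c u (c q) *m gendo_in c JJ (c q).
Proof.
move=> ac cq; rewrite !(gen_inE _ cq) /gendo_in (chart_funK cq).
have := gen_change_atK ac cq.
move: (gen_change _ _ _) (gen_change _ _ _) => P Q PQ.
by rewrite !mulmxA -(mulmxA (u q) Q) PQ mulmx1.
Qed.

Lemma gen_in_const_id m c (T : 'M[R]_(m, n + n)) q : atlas c -> chart_dom c q ->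
  gen_in c (const_gen c T) (c q) = T.
Proof.
by move=> ac cq; rewrite (gen_in_const T ac ac cq cq) gen_change_id // mulmx1.
Qed.

(** A frame at [p] is extended with constant components in [chart_at p], then projected to the
    eigenspaces of the nearby endomorphisms. The projection remains a frame as long as [T] and its
    image under the endomorphism span, which is an open condition. *)
Lemma subbundle_of_endo (JJ : M -> 'M[R]_(n + n)) (L : subspaces M) :
  (forall c, atlas c -> smooth_on (c @` chart_dom c) (gendo_in c JJ)) ->
  (forall p, JJ p *m JJ p = - 1%:M) ->
  (forall p, (eigenspace (toC (JJ p)) iC == L p)%MS) -> subbundle L.
Proof.
move=> sJJ JJ2 JJL; exists n => p.
have ac := chart_at_atlas p; have cp := chart_at_dom p; set c := chart_at p in ac cp *.
have [T Tu] := exists_frame (JJ2 p).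
pose u := const_gen c T; pose N x := col_mx T (T *m gendo_in c JJ x).
have NE q : chart_dom c q ->
    N (c q) = col_mx (u q) (u q *m JJ q) *m gen_change (chart_at q) c q.
  move=> cq; rewrite /N mul_col_mx -!(gen_inE _ cq) (gen_in_const_id _ ac cq).
  by rewrite -(gen_inE (fun q => u q *m JJ q) cq) (gen_in_mul _ _ ac cq) (gen_in_const_id _ ac cq).
have Nu q : chart_dom c q -> (N (c q) \in unitmx) = (col_mx (u q) (u q *m JJ q) \in unitmx).
  move=> cq; rewrite NE // unitmx_mul.
  by have [-> _] := mulmx1_unit (gen_change_atK ac cq); rewrite andbT.
have up : u p = T by rewrite /u /const_gen -/c gen_change_id // mulmx1.
have oA := @chart_img_open _ _ _ c.
have sN : smooth_on (c @` chart_dom c) N.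
  apply: smooth_on_col_mx (smooth_on_cst _ _) _ => //.
  by apply: smooth_on_mulmx (smooth_on_cst _ _) (sJJ c ac).
have cx : (c @` chart_dom c) (c p) by exists p.
(* The determinant is continuous and does not vanish at [p], by the choice of [T]. *)
have nN : \forall x \near c p, \det (N x) != 0.
  have dN := smooth_on_differentiable (smooth_on_det oA sN) cx.
  apply: (cvgr_neq0 _ (differentiable_continuous dN)).
  by rewrite -unitfE -unitmxE Nu // up.
have : nbhs p [set q | chart_dom c q /\ col_mx (u q) (u q *m JJ q) \in unitmx].
  have nc : \forall q \near p, chart_dom c q.
    by apply: open_nbhs_nbhs; split=> //; exact: chart_dom_open.
  apply: filterS2 nc (near_chart cp nN) => q cq.
  by rewrite -unitfE -unitmxE Nu.
rewrite nbhsE => -[U [oU Up] UP].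
exists U, (fun q => cplx (u q) (- (u q *m JJ q))); split=> //; last first.
  by move=> q /UP[cq uq]; have [fs sL] := frame_eig (JJ2 q) uq; split=> //;
    apply/eqmxP; exact: eqmx_trans (eqmxP sL) (eqmxP (JJL q)).
have Uc : U `<=` chart_dom c by move=> q /UP[].
have su : smooth_gen U u := smooth_const_gen T ac oU Uc.
split.
  by under eq_fun do rewrite mxRe_cplx.
under eq_fun do rewrite mxIm_cplx -mulNmx.
move=> c' ac'; have oA' := @open_chart_img _ _ _ c' _ oU.
have sJ' : smooth_on (c' @` (U `&` chart_dom c')) (gendo_in c' JJ).
  by apply: smooth_on_sub (sJJ c' ac') => _ [q [_ cq] <-]; exists q.
apply: (smooth_on_chart oU _ (smooth_onN oA' (smooth_on_mulmx oA' (su c' ac') sJ'))).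
move=> q Uq cq; rewrite (gen_in_mul (fun q => - u q) _ ac' cq) -mulNmx.
by rewrite !(gen_inE _ cq) (mulNmx (u q)).
Qed.

End SubbundleOfEndo.

(** * The bundles of a Hermitian quadruple *)

Section QuadrupleBundles.
Variables (R : realType) (n : nat) (M : manifold R n).
Local Notation C := R[i].
Local Notation iC := ('i%C : C).
Implicit Types (c : chart R n M) (p q : M) (U : set M).

Lemma bilinear_ext (A B : 'M[R]_n) :
  (forall X Y : 'rV[R]_n, (X *m A *m Y^T) 0 0 = (X *m B *m Y^T) 0 0) -> A = B.
Proof.
move=> h; apply/matrixP => i j; have := h (delta_mx 0 i) (delta_mx 0 j).
by rewrite !trmx_delta -!colE -!rowE !mxE.
Qed.

Lemma positive_unit (g : 'M[R]_n) :
  (forall X : 'rV[R]_n, X != 0 -> 0 < (X *m g *m X^T) 0 0) -> g \in unitmx.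
Proof.
move=> gpos; rewrite -row_free_unit; apply: row_free_rV0 => v vg.
by apply/eqP; apply: contraT => /gpos; rewrite vg mul0mx mxE ltxx.
Qed.

Lemma hermitian_mul (g J : 'M[R]_n) : (forall X Y : 'rV[R]_n,
  ((X *m J) *m g *m (Y *m J)^T) 0 0 = (X *m g *m Y^T) 0 0) -> J *m g *m J^T = g.
Proof.
by move=> h; apply: bilinear_ext => X Y; rewrite -h trmx_mul !mulmxA.
Qed.

(** The form is real, so conjugation only replaces the i-eigenspace of J by its conjugate, the
    i-eigenspace of -J. This gives L2 the same shape as L1, with -J- for J-. *)
Lemma mem_mxconj_graph m (E J : 'M[R]_n) (w : 'M[C]_(m, n + n)) :
  (w <= mxconj (eigenspace (toC J) iC *m row_mx 1%:M (toC E)))%MS <->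
  (w <= eigenspace (toC (- J)) iC *m row_mx 1%:M (toC E))%MS.
Proof.
rewrite sub_mxconj; split=> /mem_graph[E1 E2]; apply/mem_graph; split.
- rewrite toCN mulmxN -[lsubmx w]mxconjK -lsub_mxconj -{1}(mxconj_toC J) -mxconjM E1 mxconjZ.
  by rewrite conj_i scaleNr opprK.
- by rewrite -[rsubmx w]mxconjK -rsub_mxconj E2 mxconjM mxconj_toC lsub_mxconj mxconjK.
- move: E1; rewrite toCN mulmxN lsub_mxconj => /(congr1 -%R); rewrite opprK => E1.
  by rewrite -{1}(mxconj_toC J) -mxconjM E1 -scaleNr mxconjZ conj_Ni.
- by rewrite rsub_mxconj E2 mxconjM mxconj_toC lsub_mxconj.
Qed.

Section Pointwise.
Variables (g b Jp Jm : M -> 'M[R]_n).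

Definition quad_L (K : M -> 'M[R]_n) p : 'M[C]_(n + n) :=
  (Lplus g b Jp p + graph_on_eigen (fun p => b p - g p) K p)%MS.

Lemma quad_L1E p : quad_L1 g b Jp Jm p = quad_L Jm p. Proof. by []. Qed.

Lemma quad_L2E p : (quad_L2 g b Jp Jm p :=: quad_L (fun p => - Jm p) p)%MS.
Proof.
apply: adds_eqmx => //; apply/eqmxP; apply/andP.
by split; apply/rV_subP => w /mem_mxconj_graph.
Qed.

Lemma mem_quad_L K p m (w : 'M[C]_(m, n + n)) : (w <= quad_L K p)%MS <->
  exists X Y, [/\ X *m toC (Jp p) = iC *: X, Y *m toC (K p) = iC *: Y
    & w = X *m row_mx 1%:M (toC (b p + g p)) + Y *m row_mx 1%:M (toC (b p - g p))].
Proof. exact: mem_two_graphs. Qed.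

Hypothesis hq : hermitian_quadruple g b Jp Jm.

Lemma metric_unit p : g p \in unitmx.
Proof. by case: hq => -[_ _ gpos] _ _ _; exact: positive_unit (gpos p). Qed.

Lemma metric_sym p : (g p)^T = g p. Proof. by case: hq => -[]. Qed.

Lemma skew_b p : (b p)^T = - b p. Proof. by case: hq => _ []. Qed.

Lemma Jp_sqr p : Jp p *m Jp p = - 1%:M. Proof. by case: hq => _ _ [[]]. Qed.

Lemma Jm_sqr p : Jm p *m Jm p = - 1%:M. Proof. by case: hq => _ _ _ [[]]. Qed.

Lemma Jp_hermitian p : Jp p *m g p *m (Jp p)^T = g p.
Proof. by case: hq => _ _ [_ h] _; exact: hermitian_mul (h p). Qed.

Lemma Jm_hermitian p : Jm p *m g p *m (Jm p)^T = g p.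
Proof. by case: hq => _ _ _ [_ h]; exact: hermitian_mul (h p). Qed.

Definition quad_endo_field (K : M -> 'M[R]_n) p : 'M[R]_(n + n) :=
  quad_endo (b p + g p) (b p - g p) (Jp p) (K p).

Let FEu p : (b p - g p) - (b p + g p) \in unitmx.
Proof. exact: graphs_sub_unit (metric_unit p). Qed.

(** The construction commutes with changes of coordinates, so the endomorphism field inherits
    smoothness from g, b, J+ and [K]. *)
Lemma gendo_in_quad K c q : atlas c -> chart_dom c q ->
  gendo_in c (quad_endo_field K) (c q) =
  quad_endo (form_in c (fun p => b p + g p) (c q)) (form_in c (fun p => b p - g p) (c q))
    (endo_in c Jp (c q)) (endo_in c K (c q)).
Proof.
move=> ac cq; set E' := form_in _ _ _; set F' := form_in _ _ _.
have FE' : F' - E' \in unitmx.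
  rewrite -[F' - E'](form_inB c q).
  by apply: (form_in_unit ac cq (E := fun p => b p - g p - (b p + g p))); exact: FEu.
have Tu := two_graphs_unit FE'.
apply: (can_inj (mulKmx Tu)); rewrite quad_endoE // /gendo_in (chart_funK cq).
have TD : two_graphs E' F' = block_mx (jac_from c q) 0 0 (jac_from c q) *m
    two_graphs (b q + g q) (b q - g q) *m gen_change (chart_at q) c q.
  rewrite /gen_change -jac_toE -jac_fromE /two_graphs mulmx_block.
  rewrite !(mul0mx, mulmx1, addr0, add0r) mulmx_block !(mulmx0, addr0, add0r).
  rewrite /E' /F' /form_in (chart_funK cq).
  by rewrite !(jac_fromK ac cq).
have QE := quad_endoE (Jp q) (K q) (FEu q); rewrite -/(quad_endo_field K q) in QE.
have := gen_change_atK ac cq; rewrite TD; move: (quad_endo_field K q) QE => Q QE.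
move: (gen_change (chart_at q) c q) (gen_change c (chart_at q) q) => D D' DD.
rewrite !mulmxA -(mulmxA _ D D') DD mulmx1 -(mulmxA _ (two_graphs _ _) Q) QE !mulmxA.
congr (_ *m _ *m _).
rewrite !mulmx_block !(mulmx0, mul0mx, addr0, add0r) /endo_in (chart_funK cq) -!mulmxA.
have := jac_toK ac cq; move: (jac_to c q) (jac_from c q) => P S PS.
by rewrite PS !mulmx1.
Qed.

Hypotheses (K : M -> 'M[R]_n) (K2 : forall p, K p *m K p = - 1%:M)
  (Kh : forall p, K p *m g p *m (K p)^T = g p) (sK : smooth_endo K).

Lemma quad_endo_field_eig p :
  (eigenspace (toC (quad_endo_field K p)) iC == quad_L K p)%MS.
Proof. exact: quad_endo_eig (FEu p). Qed.

Lemma quad_endo_field_sqr p : quad_endo_field K p *m quad_endo_field K p = - 1%:M.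
Proof. by apply: quad_endo2; [exact: FEu|exact: Jp_sqr|exact: K2]. Qed.

Lemma quad_endo_field_orthogonal p :
  dpair (quad_endo_field K p) (quad_endo_field K p) = dpair 1%:M 1%:M.
Proof.
apply: quad_endo_orthogonal (Kh p); [exact: metric_unit|exact: metric_sym|exact: skew_b|].
exact: Jp_hermitian.
Qed.

(** Serves for L1 with [K] = J- and for L2 with [K] = -J-; everything is transported from the
    i-eigenbundle of [quad_endo_field]. *)
Lemma gen_almost_complex_quad_L (L : subspaces M) :
  (forall p, (quad_L K p == L p)%MS) -> gen_almost_complex L.
Proof.
move=> KL; have eL p : (eigenspace (toC (quad_endo_field K p)) iC :=: L p)%MS.
  by apply: eqmx_trans (eqmxP (KL p)); apply/eqmxP; exact: quad_endo_field_eig.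
split.
- apply: (subbundle_of_endo _ quad_endo_field_sqr) => [c ac|p]; last exact/eqmxP.
  have oA := @chart_img_open _ _ _ c.
  have [[sg _ _] [sb _] [[sJ _] _] _] := hq.
  have sE : smooth_form (fun p => b p + g p) by exact: smooth_formD.
  have sF : smooth_form (fun p => b p - g p) by apply: smooth_formD => //; exact: smooth_formN.
  have sT := smooth_on_block_mx oA (smooth_on_cst _ (1%:M : 'M[R]_n)) (sE c ac)
    (smooth_on_cst _ (1%:M : 'M[R]_n)) (sF c ac).
  have Tu x : (c @` chart_dom c) x -> two_graphs (form_in c (fun p => b p + g p) x)
      (form_in c (fun p => b p - g p) x) \in unitmx.
    move=> [q cq <-]; apply: two_graphs_unit; rewrite -(form_inB c q).
    by apply: (form_in_unit ac cq (E := fun p => b p - g p - (b p + g p))); exact: FEu.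
  apply: (smooth_on_chart_dom _ (smooth_on_mulmx oA (smooth_on_mulmx oA
    (smooth_on_invmx oA Tu sT) (smooth_on_block_mx oA (sJ c ac) (smooth_on_cst _ 0)
      (smooth_on_cst _ 0) (sK ac))) sT)).
  by move=> q cq; rewrite gendo_in_quad.
- move=> p; have [iL mL] := maximal_isotropic_eig (quad_endo_field_sqr p)
    (quad_endo_field_orthogonal p).
  split=> [u v|A' iA']; first by rewrite -!eL; exact: iL.
  by rewrite -!eL; exact: mL.
- move=> p; apply/eqP/rowV0P => v; rewrite sub_capmx sub_mxconj -!eL -sub_mxconj.
  rewrite -sub_capmx (eig_cap_conj (quad_endo_field K p)) submx0.
  by move/eqP.
Qed.

End Pointwise.

End QuadrupleBundles.

(** * From tamed symplectic to generalized Kähler *)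

Section ClosedForms.
Variables (R : realType) (n : nat).
Local Notation C := R[i].

Lemma trilinear_expand (A : 'I_n -> 'M[C]_n) (a b c : 'rV[C]_n) :
  (b *m (\sum_i a 0 i *: A i) *m c^T) 0 0 =
  \sum_i \sum_j \sum_k a 0 i * b 0 j * c 0 k * A i j k.
Proof.
rewrite mulmx_sumr mulmx_suml summxE; apply: eq_bigr => i _.
rewrite -scalemxAr -scalemxAl mxE [X in _ * X]mxE mulr_sumr exchange_big /=.
apply: eq_bigr => k _; rewrite mxE mulr_suml mulr_sumr; apply: eq_bigr => j _.
by rewrite [c^T _ _]mxE mulrA mulrA mulrAC -!mulrA.
Qed.

Lemma cyclic_product (K : comPzRingType) (x y z a b c : K) : a + b + c = 0 ->
  x * y * z * a + (y * z * x * b + z * x * y * c) = 0.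
Proof. by move=> abc; rewrite -[RHS](mulr0 (x * y * z)) -abc; ring. Qed.

Lemma d_form_eq0 (W : 'rV[R]_n -> 'M[C]_n) x :
  (forall i j k, cderive (basis_vec R i) W x j k + cderive (basis_vec R j) W x k i
    + cderive (basis_vec R k) W x i j = 0) ->
  forall X Y Z, d_form W x X Y Z = 0.
Proof.
move=> W0 X Y Z; apply/matrixP => r s; rewrite !ord1 [RHS]mxE /d_form !dCE.
rewrite mxE [X in X + _]mxE !trilinear_expand.
(* The second and third sums are reindexed so that all three carry the product of X_i, Y_j and Z_k,
   and the components of dW appear as a common cofactor. *)
rewrite [X in _ + X + _](_ : _ = \sum_i \sum_j \sum_k
    Y 0 j * Z 0 k * X 0 i * cderive (basis_vec R j) W x k i); last first.
  by rewrite [RHS]exchange_big; apply: eq_bigr => j _; rewrite exchange_big.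
rewrite [X in _ + X](_ : _ = \sum_i \sum_j \sum_k
    Z 0 k * X 0 i * Y 0 j * cderive (basis_vec R k) W x i j); last first.
  by rewrite exchange_big; apply: eq_bigr => i _; rewrite exchange_big.
rewrite -!big_split big1 // => i _; rewrite -!big_split big1 // => j _.
rewrite -!big_split big1 // => k _ /=.
rewrite -addrA; exact: cyclic_product.
Qed.

End ClosedForms.

Section FromSymplectic.
Variables (R : realType) (n : nat) (M : manifold R n).
Local Notation C := R[i].
Local Notation iC := ('i%C : C).
Implicit Types (c : chart R n M) (p q : M) (U : set M).
Variables (eps J : M -> 'M[R]_n).
Local Notation Jm := (J_minus eps J).
Local Notation g := (sym_part eps J).
Local Notation b := (skew_part eps J).

Lemma skew_add_sym p : b p + g p = J p *m eps p.
Proof. by rewrite /skew_part /sym_part -scalerDr addrACA addNr addr0 half_double. Qed.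

Lemma skew_sub_sym p : b p - g p = - (J p *m eps p)^T.
Proof.
rewrite /skew_part /sym_part -scalerBr opprD addrACA subrr add0r -opprD scalerN.
by rewrite half_double.
Qed.

Lemma sym_part_self p (X : 'rV[R]_n) :
  X *m g p *m X^T = (X *m J p) *m eps p *m X^T.
Proof.
rewrite -(mulmxA X (J p)) /sym_part -scalemxAr -scalemxAl mulmxDr mulmxDl.
have -> : X *m (J p *m eps p)^T *m X^T = (X *m (J p *m eps p) *m X^T)^T.
  by rewrite !trmx_mul trmxK mulmxA.
by rewrite mx11_tr half_double.
Qed.

Hypotheses (eps2 : two_form eps) (epsU : nondegenerate_form eps) (acJ : almost_complex J).

(** The source of the symmetry between J+ and J-: eps J+ and eps J- are transposes of each other, so
    g is the symmetric part of both, and b - g = -J- eps in row notation. It rests on eps being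
    skew. *)
Lemma J_minus_mul p : Jm p *m eps p = (J p *m eps p)^T.
Proof.
rewrite /J_minus /conj_endo mulNmx mulmxKV // trmx_mul (proj2 eps2 p).
by rewrite mulNmx.
Qed.

Lemma J_minus_sqr p : Jm p *m Jm p = - 1%:M.
Proof.
rewrite /J_minus /conj_endo mulNmx mulmxN opprK !mulmxA mulmxKV //.
rewrite -(mulmxA (eps p)) -trmx_mul (proj2 acJ p) oppmx1 tr_scalar_mx mul_mx_scalar.
by rewrite scaleN1r mulNmx mulmxV // -oppmx1.
Qed.

(** Conjugation by [K] exchanges the two summands, since K (K E) K^T = -E K^T = (K E)^T. It applies
    to J+ and to J- alike. *)
Lemma hermitian_sym_part (E K : 'M[R]_n) : E^T = - E -> K *m K = - 1%:M ->
  K *m (K *m E + (K *m E)^T) *m K^T = K *m E + (K *m E)^T.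
Proof.
move=> ET K2; rewrite mulmxDr mulmxDl mulmxA K2 trmx_mul ET !mulNmx mul1mx mulmxN !mulNmx.
rewrite -(mulmxA K (E *m K^T)) -(mulmxA E) -trmx_mul K2 oppmx1 tr_scalar_mx.
by rewrite mul_mx_scalar scaleN1r mulmxN opprK addrC.
Qed.

Lemma smooth_J_eps : smooth_form (fun p => J p *m eps p).
Proof. by apply: smooth_form_mul; [case: acJ|case: eps2]. Qed.

Lemma smooth_J_minus : smooth_endo Jm.
Proof. by apply: smooth_endoN; apply: smooth_endo_conj => //; [case: eps2|case: acJ]. Qed.

Lemma skew_part_two_form : two_form b.
Proof.
split=> [|p].
  apply: smooth_formZ; apply: smooth_formD smooth_J_eps _.
  exact/smooth_formN/smooth_form_tr/smooth_J_eps.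
by rewrite /skew_part linearZ linearB /= trmxK -scalerN opprB.
Qed.

Lemma hermitian_quadruple_of_tamed :
  (forall p (X : 'rV[R]_n), X != 0 -> 0 < ((X *m J p) *m eps p *m X^T) 0 0) ->
  hermitian_quadruple g b J Jm.
Proof.
move=> tame; have hermE (K : M -> 'M[R]_n) : (forall p, K p *m g p *m (K p)^T = g p) ->
    forall p (X Y : 'rV[R]_n),
    ((X *m K p) *m g p *m (Y *m K p)^T) 0 0 = (X *m g p *m Y^T) 0 0.
  move=> Kg p X Y; rewrite trmx_mul !mulmxA -(mulmxA X) -(mulmxA X) Kg.
  by [].
split; first split.
- apply: smooth_formZ; apply: smooth_formD smooth_J_eps _.
  exact/smooth_form_tr/smooth_J_eps.
- by move=> p; rewrite /sym_part linearZ linearD /= trmxK addrC.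
- by move=> p X X0; rewrite sym_part_self; exact: tame.
- exact: skew_part_two_form.
- split=> //; apply: hermE => p; rewrite /sym_part -scalemxAr -scalemxAl.
  by rewrite hermitian_sym_part //; [case: eps2|case: acJ].
- split; first by split; [exact: smooth_J_minus|exact: J_minus_sqr].
  apply: hermE => p; rewrite /sym_part -scalemxAr -scalemxAl addrC -J_minus_mul.
  have -> : J p *m eps p = (Jm p *m eps p)^T by rewrite J_minus_mul trmxK.
  by rewrite hermitian_sym_part //; [case: eps2|exact: J_minus_sqr].
Qed.

Lemma eig_graph (X : 'rV[C]_n) (K E : 'M[R]_n) : X *m toC K = iC *: X ->
  X *m row_mx 1%:M (toC (K *m E)) = X *m graph_mx (iC *: toC E).
Proof.
by move=> XK; rewrite !mul_mx_row toCM mulmxA XK -scalemxAl -scalemxAr.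
Qed.

Lemma mem_L1_graphs p (w : 'rV[C]_(n + n)) : (w <= quad_L1 g b J Jm p)%MS <->
  exists X Y, [/\ X *m toC (J p) = iC *: X, Y *m toC (Jm p) = iC *: Y
    & w = X *m graph_mx (iC *: toC (eps p)) + Y *m graph_mx (- iC *: toC (eps p))].
Proof.
have F (Y : 'rV[C]_n) : Y *m toC (Jm p) = iC *: Y ->
    Y *m row_mx 1%:M (toC (b p - g p)) = Y *m graph_mx (- iC *: toC (eps p)).
  move=> YJ; rewrite skew_sub_sym -J_minus_mul -mulmxN (eig_graph (- eps p) YJ).
  by congr (_ *m graph_mx _); rewrite toCN scalerN scaleNr.
have E (X : 'rV[C]_n) : X *m toC (J p) = iC *: X ->
    X *m row_mx 1%:M (toC (b p + g p)) = X *m graph_mx (iC *: toC (eps p)).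
  by move=> XJ; rewrite skew_add_sym (eig_graph (eps p) XJ).
rewrite quad_L1E; split=> [/mem_quad_L[X [Y [XJ YJ ->]]]|[X [Y [XJ YJ ->]]]].
  by exists X, Y; rewrite (E X XJ) (F Y YJ).
by apply/mem_quad_L; exists X, Y; rewrite (E X XJ) (F Y YJ).
Qed.

(** Transports L1 from the manifold to the model [in_L1], on which the coordinate computation is
    done; an eigenvector and the graph over it are carried along by the same Jacobian. *)
Lemma in_L1_coord c q (u : M -> 'rV[C]_(n + n)) : atlas c -> chart_dom c q ->
  (u q <= quad_L1 g b J Jm q)%MS ->
  in_L1 (form_in c eps) (endo_in c J) (endo_in c Jm) (c q) (genC_in c u (c q)).
Proof.
move=> ac cq /mem_L1_graphs[X [Y [XJ YJ uq]]].
exists (X *m toC (jac_to c q)), (Y *m toC (jac_to c q)); split.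
- exact: eig_coord.
- exact: eig_coord.
have G s : graph_mx (s *: toC (eps q)) *m toC (block_mx (jac_to c q) 0 0 (jac_from c q)^T) =
    toC (jac_to c q) *m scaled_graph (form_in c eps) s (c q).
  rewrite (graph_coord ac cq); congr (_ *m graph_mx _).
  rewrite -scalemxAr -scalemxAl -toC_tr -!toCM /form_in (chart_funK cq).
  by [].
rewrite (genC_inE cq) uq; move: (G iC) (G (- iC)).
move: (toC (block_mx _ _ _ _)) (graph_mx (iC *: toC (eps q))) (graph_mx (- iC *: toC (eps q)))
  (scaled_graph (form_in c eps) iC (c q)) (scaled_graph (form_in c eps) (- iC) (c q)).
by move=> D A B A' B' GA GB; rewrite mulmxDl -!mulmxA GA GB.
Qed.

End FromSymplectic.

(** * Integrability in coordinates *)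

Section NijenhuisInChart.
Variables (R : realType) (n : nat) (M : manifold R n).
Local Notation C := R[i].
Local Notation iC := ('i%C : C).
Implicit Types (c : chart R n M) (p q : M) (U : set M).

Lemma nijenhuis_form_toC (J : 'rV[R]_n -> 'M[R]_n) x a b : differentiable J x ->
  nijenhuis_form J x (toC a) (toC b) = toC (b *m 'D_(a *m J x) J x
    - a *m 'D_(b *m J x) J x + a *m 'D_b J x *m J x - b *m 'D_a J x *m J x).
Proof.
move=> dJ; have dCJ h := dC_toC_fun h dJ; rewrite /nijenhuis_form.
rewrite -(toCM a (J x)) -(toCM b (J x)) !dCJ -!toCM.
by rewrite -toCB -toCD -toCB.
Qed.

(** Integrability is tested on vector fields with constant components in the chart, for which only
    the derivatives of J remain. This gives the real vectors, and complex bilinearity gives the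
    rest. *)
Lemma nijenhuis_form_eq0 (J : M -> 'M[R]_n) p : smooth_endo J -> integrable_acs J ->
  forall a a', nijenhuis_form (endo_in (chart_at p) J) (chart_at p p) a a' = 0.
Proof.
move=> sJ iJ; have ac := chart_at_atlas p; have cp := chart_at_dom p.
set c := chart_at p in ac cp *; set x := c p.
have cx : (c @` chart_dom c) x by exists p.
have dJ : differentiable (endo_in c J) x := smooth_on_differentiable (sJ c ac) cx.
have oc := @chart_dom_open _ _ _ c.
have nearc (f g : 'rV[R]_n -> 'rV[R]_n) : (forall q, chart_dom c q -> f (c q) = g (c q)) ->
    \near x, f x = g x.
  by move=> fg; apply: (near_chart_img oc cp cp) => q cq _; exact: fg.
have real a b : nijenhuis_form (endo_in c J) x (toC a) (toC b) = 0.
  have vX d q : chart_dom c q -> vec_in c (const_vec c d) (c q) = d.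
    by move=> cq; rewrite (vec_in_const d ac ac cq cq) chart_change_id // mulmx1.
  have vJ d q : chart_dom c q ->
      vec_in c (fun q => const_vec c d q *m J q) (c q) = d *m endo_in c J (c q).
    by move=> cq; rewrite (vec_in_mul ac cq) vX.
  have D0 h d : 'D_h (vec_in c (const_vec c d)) x = 0.
    rewrite (@near_eq_derive _ _ _ _ (fun=> d)); first exact: derive_cst.
    by apply: nearc => q cq; rewrite vX.
  have D1 h d : 'D_h (vec_in c (fun q => const_vec c d q *m J q)) x = d *m 'D_h (endo_in c J) x.
    rewrite (@near_eq_derive _ _ _ _ (fun y => d *m endo_in c J y)); last first.
      by apply: nearc => q cq; rewrite vJ.
    by rewrite (derive_mulmx _ (differentiable_cst d x) dJ) derive_cst mul0mx add0r.
  have := iJ _ _ _ oc (smooth_const_vec a ac) (smooth_const_vec b ac) p cp.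
  rewrite /nijenhuis /lie_bracket /lie_bracket_Rn -/c -/x !D0 !D1 !vX // !vJ // -/x.
  rewrite -(endo_in_at p J) -/c -/x => N.
  rewrite (nijenhuis_form_toC a b dJ); move: N; set j := endo_in c J x.
  move: ('D_(a *m j) (endo_in c J) x) ('D_(b *m j) (endo_in c J) x)
    ('D_a (endo_in c J) x) ('D_b (endo_in c J) x) => P Q S T N.
  rewrite -[RHS](toC0 R 1 n) -N; congr toC.
  by rewrite sub0r !subr0 mulNmx opprK.
have lin1 a' b : nijenhuis_form (endo_in c J) x a' (toC b) = 0.
  rewrite -[a']cplx_ReIm cplxE addrC nijenhuis_form_linear !real.
  by rewrite scaler0 addr0.
move=> a a'; rewrite -[a']cplx_ReIm cplxE addrC nijenhuis_formC nijenhuis_form_linear.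
by rewrite ![nijenhuis_form _ _ (toC _) a]nijenhuis_formC !lin1 oppr0 scaler0 addr0 oppr0.
Qed.

End NijenhuisInChart.

(** * Closed forms and brackets of sections of graphs *)

Section ClosedInChart.
Variables (R : realType) (n : nat) (M : manifold R n).
Local Notation C := R[i].
Local Notation iC := ('i%C : C).
Implicit Types (c : chart R n M) (p q : M) (U : set M) (A B E : M -> 'M[R]_n).

Lemma smooth_form_differentiable E c q : atlas c -> chart_dom c q -> smooth_form E ->
  differentiable (form_in c E) (c q).
Proof. by move=> ac cq sE; apply: smooth_on_differentiable (sE c ac) _; exists q. Qed.

Lemma smooth_endo_differentiable E c q : atlas c -> chart_dom c q -> smooth_endo E ->
  differentiable (endo_in c E) (c q).
Proof. by move=> ac cq sE; apply: smooth_on_differentiable (sE c ac) _; exists q. Qed.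

Lemma d2_RnE (E : 'rV[R]_n -> 'M[R]_n) x i j k : differentiable E x ->
  d2_Rn E x i j k = 'D_(basis_vec R i) E x j k + 'D_(basis_vec R j) E x k i
    + 'D_(basis_vec R k) E x i j.
Proof.
by move=> dE; congr (_ + _ + _); apply: esym; apply: (derive_mxE _ _ _ dE).
Qed.

Definition form_cplx A B c y : 'M[C]_n := cplx (form_in c A y) (form_in c B y).

Lemma cderive_cplx_d2 (A B : 'rV[R]_n -> 'M[R]_n) x i j k :
  differentiable A x -> differentiable B x ->
  cderive (basis_vec R i) (fun y => cplx (A y) (B y)) x j k
  + cderive (basis_vec R j) (fun y => cplx (A y) (B y)) x k i
  + cderive (basis_vec R k) (fun y => cplx (A y) (B y)) x i j
  = (d2_Rn A x i j k +i* d2_Rn B x i j k)%C.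
Proof.
move=> dA dB; rewrite (d2_RnE i j k dA) (d2_RnE i j k dB).
have P v l m : cderive v (fun y => cplx (A y) (B y)) x l m = ('D_v A x l m +i* 'D_v B x l m)%C.
  by rewrite (cderiveE v A B x) mxE.
by apply: etrans (congr2 +%R (congr2 +%R (P (basis_vec R i) j k) (P (basis_vec R j) k i))
  (P (basis_vec R k) i j)) _.
Qed.

Lemma d_form_basis (W : 'rV[R]_n -> 'M[C]_n) x i j k :
  d_form W x (toC (basis_vec R i)) (toC (basis_vec R j)) (toC (basis_vec R k)) 0 0 =
  cderive (basis_vec R i) W x j k + cderive (basis_vec R j) W x k i
  + cderive (basis_vec R k) W x i j.
Proof.
have entry (P : 'M[C]_n) (l m : 'I_n) :
    (toC (basis_vec R l) *m P *m (toC (basis_vec R m))^T) 0 0 = P l m.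
  have tb s : toC (basis_vec R s) = delta_mx 0 s by exact: map_delta_mx.
  by rewrite !tb -rowE trmx_delta -colE !mxE.
have dCb l : dC (toC (basis_vec R l)) W x = cderive (basis_vec R l) W x.
  rewrite dCE (bigD1 l) //= big1 ?addr0 => [|m ml].
    by rewrite !mxE !eqxx scale1r.
  by rewrite !mxE eqxx (negbTE ml) scale0r.
by rewrite /d_form !dCb mxE [X in X + _]mxE !entry.
Qed.

Lemma d_form_cplx A B p : smooth_form A -> smooth_form B -> closed_form A -> closed_form B ->
  forall X Y Z, d_form (form_cplx A B (chart_at p)) (chart_at p p) X Y Z = 0.
Proof.
move=> sA sB clA clB; apply: d_form_eq0 => i j k.
have dA := smooth_form_differentiable (chart_at_atlas p) (chart_at_dom p) sA.
have dB := smooth_form_differentiable (chart_at_atlas p) (chart_at_dom p) sB.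
by apply: etrans (cderive_cplx_d2 i j k dA dB) _; rewrite clA clB.
Qed.

Lemma closed_form_cplx A B : smooth_form A -> smooth_form B ->
  (forall p i j k, d_form (form_cplx A B (chart_at p)) (chart_at p p)
     (toC (basis_vec R i)) (toC (basis_vec R j)) (toC (basis_vec R k)) = 0) ->
  closed_form A /\ closed_form B.
Proof.
move=> sA sB W0.
suff H p i j k : d2_Rn (form_in (chart_at p) A) (chart_at p p) i j k = 0 /\
    d2_Rn (form_in (chart_at p) B) (chart_at p p) i j k = 0.
  by split=> p i j k; have [] := H p i j k.
have dA := smooth_form_differentiable (chart_at_atlas p) (chart_at_dom p) sA.
have dB := smooth_form_differentiable (chart_at_atlas p) (chart_at_dom p) sB.
have := congr1 (fun P : 'M[C]_1 => P 0 0) (W0 p i j k); rewrite d_form_basis [RHS]mxE.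
by move=> /(etrans (esym (cderive_cplx_d2 i j k dA dB)))[].
Qed.

Lemma closed_form0 : closed_form ((fun=> 0) : M -> 'M[R]_n).
Proof.
move=> p i j k; rewrite /d2_Rn.
have E l m : (fun y => form_in (chart_at p) (fun=> 0 : 'M[R]_n) y l m) = cst 0.
  by apply/funext => y; rewrite /form_in mulmx0 mul0mx mxE.
by rewrite !E !derive_cst !addr0.
Qed.

Lemma smooth_form0 : smooth_form ((fun=> 0) : M -> 'M[R]_n).
Proof.
move=> c _; rewrite (_ : form_in _ _ = cst 0); first exact: smooth_on_cst.
by apply/funext => y; rewrite /form_in mulmx0 mul0mx.
Qed.

(** Here V is the Lie bracket of the vector parts in the chart at [p]; only its existence matters,
    since it is either an arbitrary vector of the graph or is eliminated by testing against
    covectors. *)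
Lemma courantC_graph A B U (u v : M -> 'rV[C]_(n + n)) p :
  two_form A -> two_form B -> open U -> U p -> smooth_genC U u -> smooth_genC U v ->
  (forall q, U q -> u q = lsubmx (u q) *m graph_mx (cplx (A q) (B q))) ->
  (forall q, U q -> v q = lsubmx (v q) *m graph_mx (cplx (A q) (B q))) ->
  exists V : 'rV[C]_n, forall w, dpair (courantC u v p) w =
    dpair (V *m graph_mx (cplx (A p) (B p))) w +
    d_form (form_cplx A B (chart_at p)) (chart_at p p) (lsubmx (u p)) (lsubmx (v p)) (lsubmx w).
Proof.
move=> [sA tA] [sB tB] oU Up su sv uE vE.
have ac := chart_at_atlas p; have cp := chart_at_dom p; set c := chart_at p in ac cp *.
set W := form_cplx A B c.
have dW : cdifferentiable W (c p).
  by apply: cdifferentiableE; exact: smooth_form_differentiable.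
have Wsk : \forall y \near c p, (W y)^T = - W y.
  apply: (near_chart_img oU Up cp) => q _ cq.
  by rewrite /W /form_cplx cplx_tr -!form_in_tr // cplxN /form_in tA tB !(mulmxN, mulNmx).
have cd (f : M -> 'rV[C]_(n + n)) : smooth_genC U f ->
    cdifferentiable (fun y => lsubmx (genC_in c f y)) (c p).
  move=> sf; have df := genC_in_cdifferentiable ac Up cp sf.
  under eq_fun do rewrite lsubmx_mul.
  exact: (cdifferentiable_mulmx df (cdifferentiable_cst _ _)).
have near (f : M -> 'rV[C]_(n + n)) :
    (forall q, U q -> f q = lsubmx (f q) *m graph_mx (cplx (A q) (B q))) ->
    \forall y \near c p, genC_in c f y = lsubmx (genC_in c f y) *m graph_mx (W y).
  move=> fE; apply: (near_chart_img oU Up cp) => q Uq cq.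
  by rewrite (genC_in_graph ac cq (fE q Uq)) lsub_graph.
have at_p (f : M -> 'rV[C]_(n + n)) : genC_in c f (c p) = f p.
  by rewrite (genC_inE cp) jac_to_at jac_from_at trmx1 -scalar_mx_block toC1 mulmx1.
have Wp : W (c p) = cplx (A p) (B p) by rewrite /W /form_cplx !form_in_at.
exists (dC (lsubmx (u p)) (fun y => lsubmx (genC_in c v y)) (c p)
  - dC (lsubmx (v p)) (fun y => lsubmx (genC_in c u y)) (c p)) => w.
rewrite (courantC_form w Up su sv) (courant_form_near_eq w (near u uE) (near v vE)).
by rewrite (courant_form_graph w (cd u su) (cd v sv) dW Wsk) !at_p Wp.
Qed.
End ClosedInChart.

(** * Closedness of L1 on the manifold *)

Section ClosednessL1.
Variables (R : realType) (n : nat) (M : manifold R n).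
Local Notation C := R[i].
Local Notation iC := ('i%C : C).
Variables (eps J : M -> 'M[R]_n).
Local Notation Jm := (J_minus eps J).
Local Notation g := (sym_part eps J).
Local Notation b := (skew_part eps J).

(** Every term contains J twice. Hence the integrability of eps^-1 J* eps, which is -J-, can be used
    for J-. *)
Lemma nijenhuis_formN (K : 'rV[R]_n -> 'M[R]_n) x a a' : differentiable K x ->
  nijenhuis_form (fun y => - K y) x a a' = nijenhuis_form K x a a'.
Proof.
move=> dK; have dKC := cdifferentiable_toC dK; rewrite /nijenhuis_form.
have -> : (fun y => toC (- K y)) = fun y => - toC (K y) by apply/funext => y; rewrite toCN.
have D h : dC h (fun y => - toC (K y)) x = - dC h (fun y => toC (K y)) x by apply: dCN.
have DN h : dC (- h) (fun y => toC (K y)) x = - dC h (fun y => toC (K y)) x.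
  by rewrite -scaleN1r dC_dirZ scaleN1r.
rewrite (D (a *m toC (- K x))) (D (a' *m toC (- K x))) (D a) (D a') (toCN (K x)).
rewrite (mulmxN a (toC (K x))) (mulmxN a' (toC (K x))).
rewrite (DN (a *m toC (K x))) (DN (a' *m toC (K x))).
move: (dC (a *m toC (K x)) (fun y => toC (K y)) x) (dC (a' *m toC (K x)) (fun y => toC (K y)) x)
  (dC a (fun y => toC (K y)) x) (dC a' (fun y => toC (K y)) x) (toC (K x)) => P Q S T V.
by rewrite !mulmxN !mulNmx !opprK.
Qed.

Hypothesis tame : tamed_symplectic eps J.
Let eps2 : two_form eps. Proof. by case: tame => -[]. Qed.
Let epsU : nondegenerate_form eps. Proof. by case: tame => -[]. Qed.
Let acJ : almost_complex J. Proof. by case: tame => -[]. Qed.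

Lemma hermitian_quadruple_tamed : hermitian_quadruple g b J Jm.
Proof. by case: tame => -[*]; exact: hermitian_quadruple_of_tamed. Qed.

Lemma courant_closed_L1 : courant_closed (quad_L1 g b J Jm).
Proof.
have hq := hermitian_quadruple_tamed.
have [_ NJ NK clE] := tame; have [sE tE] := eps2; have [sJ J2] := acJ.
have sK := smooth_J_minus eps2 epsU acJ; have K2 := J_minus_sqr epsU acJ.
move=> U u v oU [su uL] [sv vL] p Up.
have ac := chart_at_atlas p; have cp := chart_at_dom p.
have /andP[e1 e2] := quad_endo_field_eig hq Jm p; rewrite quad_L1E; apply: (submx_trans _ e1).
have Kh : forall p, Jm p *m g p *m (Jm p)^T = g p.
  by move=> q; apply: (Jm_hermitian hq).
(* By maximal isotropy it suffices that the bracket pairs to zero with every vector of L1 at [p]. *)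
apply: (perp_eig (quad_endo_field_sqr hq K2 p) (quad_endo_field_orthogonal hq Kh p)) => w wE.
have wL : (w <= quad_L1 g b J Jm p)%MS by rewrite quad_L1E; exact: submx_trans wE e1.
rewrite (courantC_form w Up su sv).
have near (f : M -> 'rV[C]_(n + n)) : (forall q, U q -> (f q <= quad_L1 g b J Jm q)%MS) ->
    \forall y \near chart_at p p, in_L1 (form_in (chart_at p) eps) (endo_in (chart_at p) J)
      (endo_in (chart_at p) Jm) y (genC_in (chart_at p) f y).
  move=> fL; apply: (near_chart_img oU Up cp) => q Uq cq.
  exact: (in_L1_coord eps2 epsU ac cq (fL q Uq)).
have at_p (P : _ -> Prop) : (forall q, chart_dom (chart_at p) q -> P (chart_at p q)) ->
    \forall y \near chart_at p p, P y.
  by move=> H; apply: (near_chart_img (chart_dom_open _) cp cp) => q _; exact: H.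
apply: (courant_form_L1 (smooth_form_differentiable ac cp sE) _
  (smooth_endo_differentiable ac cp sJ) (smooth_endo_differentiable ac cp sK)).
- by apply: smooth_on_differentiable (smooth_form_inv ac epsU sE) _; exists p.
- by apply: at_p => q cq; rewrite -form_in_tr // /form_in tE mulmxN mulNmx.
- by apply: at_p => q cq; apply: form_in_unit.
- by apply: at_p => q cq; rewrite -(endo_in_mul ac cq) (funext J2) oppmx1 (endo_in_scalar ac cq).
- by apply: at_p => q cq; rewrite -(endo_in_mul ac cq) (funext K2) oppmx1 (endo_in_scalar ac cq).
- apply: at_p => q cq; rewrite -(form_in_mul ac cq) -(form_in_mul ac cq) -form_in_tr //.
  by rewrite /form_in (J_minus_mul J eps2 epsU).
(* The real form eps is taken as the complex form with zero imaginary part. *)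
- move=> X Y Z; have := d_form_cplx p sE (@smooth_form0 _ _ M) clE (@closed_form0 _ _ M) X Y Z.
  rewrite (_ : form_cplx _ _ _ = fun y => toC (form_in (chart_at p) eps y)) //.
  by apply/funext => y; rewrite toCE /form_cplx {2}/form_in mulmx0 mul0mx.
- by move=> a a'; exact: nijenhuis_form_eq0 sJ NJ a a'.
- have sC : smooth_endo (conj_endo eps J) by apply: smooth_endo_conj.
  move=> a a'; have := nijenhuis_form_eq0 p sC NK a a'.
  rewrite -(nijenhuis_formN a a' (smooth_endo_differentiable ac cp sC)).
  rewrite (_ : (fun y => - _) = endo_in (chart_at p) Jm) //.
  by apply/funext => y; rewrite /endo_in mulmxN mulNmx.
- exact: genC_in_cdifferentiable ac Up cp su.
- exact: genC_in_cdifferentiable ac Up cp sv.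
- exact: near uL.
- exact: near vL.
have := in_L1_coord (u := fun=> w) eps2 epsU ac cp wL.
by rewrite (genC_inE cp) jac_to_at jac_from_at trmx1 -scalar_mx_block toC1 mulmx1.
Qed.

End ClosednessL1.

Lemma row_vec_ext (F : pzRingType) n (V W : 'rV[F]_n) :
  (forall r, V *m (delta_mx 0 r : 'rV_n)^T = W *m (delta_mx 0 r : 'rV_n)^T) -> V = W.
Proof.
move=> VW; apply/rowP => r; have /matrixP/(_ 0 0) := VW r.
by rewrite trmx_delta -!colE !mxE.
Qed.

Lemma d_form0 (R : realType) n (W : 'rV[R]_n -> 'M[R[i]]_n) x X Y : d_form W x X Y 0 = 0.
Proof.
rewrite /d_form trmx0 mulmx0 !mul0mx !add0r -(scale0r 0) dC_dirZ scale0r.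
by rewrite mulmx0 mul0mx.
Qed.

(** * L2 as the graph of a complex two-form *)

Section GraphL2.
Variables (R : realType) (n : nat) (M : manifold R n).
Local Notation C := R[i].
Local Notation iC := ('i%C : C).
Variables (g b Jp Jm A eps : M -> 'M[R]_n).
Hypotheses (hq : hermitian_quadruple g b Jp Jm)
  (Ask : forall p, (A p)^T = - A p) (esk : forall p, (eps p)^T = - eps p)
  (HE : forall p, b p + g p = A p + Jp p *m eps p)
  (HF : forall p, b p - g p = A p - Jm p *m eps p).

(** Evaluating on eigenvectors gives one inclusion, of L2 in the graph of A + i eps. The graph is
    isotropic because A and eps are skew, so the maximality of L2 gives the other. *)
Lemma mem_quad_L2 p (w : 'rV[C]_(n + n)) : (w <= quad_L2 g b Jp Jm p)%MS <->
  w = lsubmx w *m graph_mx (cplx (A p) (eps p)).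
Proof.
have G m (v : 'M[C]_(m, n + n)) : (v <= quad_L g b Jp (fun q => - Jm q) p)%MS ->
    v = lsubmx v *m graph_mx (cplx (A p) (eps p)).
  move=> /mem_quad_L[X [Y [XJ YJ ->]]].
  have gr (Z : 'M[C]_(m, n)) (K : 'M[R]_n) : Z *m toC K = iC *: Z ->
      Z *m row_mx 1%:M (toC (A p + K *m eps p)) = Z *m graph_mx (cplx (A p) (eps p)).
    move=> ZK; rewrite !mul_mx_row; congr row_mx.
    by rewrite cplxE toCD toCM !mulmxDr mulmxA ZK -scalemxAl -scalemxAr.
  by rewrite HE HF -mulNmx (gr X _ XJ) (gr Y _ YJ) -mulmxDl lsub_graph.
have K2 q : - Jm q *m - Jm q = - 1%:M by rewrite mulmxN mulNmx opprK (Jm_sqr hq).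
have Kh q : - Jm q *m g q *m (- Jm q)^T = g q.
  by rewrite linearN /= mulmxN !mulNmx opprK (Jm_hermitian hq).
rewrite (quad_L2E g b Jp Jm p); split=> [|wE]; first exact: G.
have /andP[e1 e2] := quad_endo_field_eig hq (fun q => - Jm q) p.
have [_ maxE] := maximal_isotropic_eig (quad_endo_field_sqr hq K2 p)
  (quad_endo_field_orthogonal hq Kh p).
set Om := cplx (A p) (eps p) in G wE *.
have Osk : Om^T = - Om by rewrite /Om cplx_tr Ask esk cplxN.
(* Zero rows pad the basis of the graph to a square matrix, the form in which [maximal_isotropic]
   takes its subspaces. *)
pose T : 'M[C]_(n + n) := col_mx (graph_mx Om) 0.
have TE m (D : 'M[C]_(m, n + n)) : D *m T = lsubmx D *m graph_mx Om.
  by rewrite -{1}(hsubmxK D) mul_row_col mulmx0 addr0.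
have isoT : isotropic T.
  move=> u v /submxP[D ->] /submxP[D' ->].
  by rewrite pairing_dpair !TE dpair_graph // mxE mulr0.
apply: (submx_trans _ e1); apply: (submx_trans _ (maxE T isoT _)).
  by rewrite wE; apply/submxP; exists (row_mx (lsubmx w) 0); rewrite TE row_mxKl.
apply: (submx_trans e1 _); have /G -> := submx_refl (quad_L g b Jp (fun q => - Jm q) p).
by apply/submxP; exists (row_mx (lsubmx (quad_L g b Jp (fun q => - Jm q) p)) 0);
  rewrite TE row_mxKl.
Qed.

Lemma courant_closed_L2 : smooth_form A -> smooth_form eps -> closed_form A -> closed_form eps ->
  courant_closed (quad_L2 g b Jp Jm).
Proof.
move=> sA sE clA clE U u v oU [su uL] [sv vL] p Up.
have [||||V VE] := courantC_graph (A := A) (B := eps) (u := u) (v := v) _ _ oU Up su sv.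
- by [].
- by [].
- by move=> q Uq; apply/mem_quad_L2/uL.
- by move=> q Uq; apply/mem_quad_L2/vL.
apply/mem_quad_L2.
have -> : courantC u v p = V *m graph_mx (cplx (A p) (eps p)).
  by apply: dpair_inj => w; rewrite VE d_form_cplx // addr0.
by rewrite lsub_graph.
Qed.

(** The graph elements over the coordinate vector fields are smooth sections of L2. Their bracket
    lies in the graph, so its deviation from the graph, which is d(A + i eps) on the coordinate
    fields, must vanish. *)
Lemma closed_of_courant_closed_L2 : smooth_form A -> smooth_form eps ->
  courant_closed (quad_L2 g b Jp Jm) -> closed_form A /\ closed_form eps.
Proof.
move=> sA sE cl; apply: closed_form_cplx => // p i j k.
have ac := chart_at_atlas p; have cp := chart_at_dom p; set c := chart_at p in ac cp *.
pose e l := const_vec c (basis_vec R l).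
pose u l q := cplx (row_mx (e l q) (e l q *m A q)) (row_mx 0 (e l q *m eps q)).
have oc : open (chart_dom c) := @chart_dom_open _ _ _ c.
have lsubu l q : lsubmx (u l q) = toC (e l q) by rewrite /u -cplx_row row_mxKl toCE.
have uE l q : u l q = lsubmx (u l q) *m graph_mx (cplx (A q) (eps q)).
  by rewrite lsubu /u -cplx_row mul_mx_row mulmx1 !toCE cplxM !mul0mx subr0 addr0.
have su l : smooth_genC (chart_dom c) (u l).
  have se : smooth_vec (chart_dom c) (e l) := smooth_const_vec (basis_vec R l) ac.
  split.
    rewrite (_ : (fun _ => _) = fun q => row_mx (e l q) (e l q *m A q)).
      exact: (smooth_gen_row oc se se sA).
    by apply/funext => q; rewrite mxRe_cplx.
  rewrite (_ : (fun _ => _) = fun q => row_mx 0 (e l q *m eps q)).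
    exact: (smooth_gen_row oc (smooth_vec0 oc) se sE).
  by apply/funext => q; rewrite mxIm_cplx.
have sec l : section_on (chart_dom c) (quad_L2 g b Jp Jm) (u l).
  by split=> // q _; apply/mem_quad_L2.
have [V VE] := courantC_graph (conj sA Ask) (conj sE esk) oc cp (su i) (su j)
  (fun q _ => uE i q) (fun q _ => uE j q).
have /mem_quad_L2 := cl _ _ _ oc (sec i) (sec j) p cp; set V' := lsubmx _ => V'E.
have ep l : lsubmx (u l p) = toC (basis_vec R l).
  by rewrite lsubu /e -[const_vec _ _ _]vec_in_chart_at (vec_in_const _ ac ac cp cp)
    chart_change_id ?mulmx1.
move: VE; rewrite V'E !ep => VE.
(* Covector tests see only vector parts, and the [d_form] term vanishes on them; so the bracket has
   vector part V. Testing against coordinate vectors then isolates the exterior derivative. *)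
have VV : V' = V.
  apply: row_vec_ext => r; have := VE (row_mx 0 (delta_mx 0 r)).
  by rewrite row_mxKl d_form0 addr0 !dpairE !lsub_graph row_mxKl row_mxKr trmx0 !mulmx0 !addr0.
have := VE (row_mx (toC (basis_vec R k)) 0).
by rewrite VV row_mxKl => /eqP; rewrite addrC -subr_eq subrr eq_sym => /eqP.
Qed.

End GraphL2.

(** * Generalized Kähler structures from quadruples, and intersections of their bundles *)

Section QuadrupleToKahler.
Variables (R : realType) (n : nat) (M : manifold R n).
Local Notation C := R[i].
Local Notation iC := ('i%C : C).
Variables (g b Jp Jm : M -> 'M[R]_n).
Hypothesis hq : hermitian_quadruple g b Jp Jm.

(** Closedness is the only differential condition; the remaining requirements hold for the bundles
    of any Hermitian quadruple. *)
Lemma gen_kahler_quad : courant_closed (quad_L1 g b Jp Jm) ->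
  courant_closed (quad_L2 g b Jp Jm) ->
  gen_kahler (quad_L1 g b Jp Jm) (quad_L2 g b Jp Jm).
Proof.
move=> cl1 cl2; have [[sg gT gpos] [_ bT] _ [[sm m2] _]] := hq.
have N2 q : - Jm q *m - Jm q = - 1%:M by rewrite mulmxN mulNmx opprK m2.
have Nh q : - Jm q *m g q *m (- Jm q)^T = g q.
  by rewrite linearN /= mulmxN !mulNmx opprK (Jm_hermitian hq).
have FE p : b p - g p - (b p + g p) \in unitmx by apply: graphs_sub_unit (metric_unit hq p).
have L2E p : (quad_L g b Jp (fun q => - Jm q) p == quad_L2 g b Jp Jm p)%MS.
  by apply/eqmxP/eqmx_sym; exact: quad_L2E.
split.
- split=> //; apply: (gen_almost_complex_quad_L hq m2 (Jm_hermitian hq) sm) => p.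
  by rewrite quad_L1E !submx_refl.
- by split=> //; apply: (gen_almost_complex_quad_L hq N2 Nh (smooth_endoN sm) L2E).
exists (quad_endo_field g b Jp Jm), (quad_endo_field g b Jp (fun q => - Jm q)); split.
- move=> p; split; first exact: (quad_endo_field_sqr hq m2 p).
  by rewrite quad_L1E; exact: (quad_endo_field_eig hq Jm p).
- move=> p; split; first exact: (quad_endo_field_sqr hq N2 p).
  apply/eqmxP; apply: eqmx_trans (eqmxP (L2E p)).
  exact/eqmxP/(quad_endo_field_eig hq (fun q => - Jm q) p).
- move=> p; rewrite /quad_endo_field !quad_endo_mul //.
  by rewrite mulmxN mulNmx.
move=> p v v0; rewrite /quad_endo_field quad_endo_mul // (Jp_sqr hq) mulmxN m2 opprK.
exact: quad_endo_negative (metric_unit hq p) (gT p) (bT p) (gpos p) v v0.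
Qed.

Lemma eig_opp_eq0 m (X : 'M[C]_(m, n)) (K : 'M[R]_n) :
  X *m toC K = iC *: X -> X *m toC (- K) = iC *: X -> X = 0.
Proof.
move=> XK; rewrite toCN mulmxN XK => /esym/eq_oppr0/eqP.
rewrite scaler_eq0 => /orP[/eqP i0|/eqP//].
by have := mulii R; rewrite i0 mul0r => /eqP; rewrite eq_sym oppr_eq0 oner_eq0.
Qed.

(** The graphs of b + g and b - g are complementary because their difference 2g is invertible. *)
Lemma two_graphs_rep_inj p m (X Y X' Y' : 'M[C]_(m, n)) :
  X *m row_mx 1%:M (toC (b p + g p)) + Y *m row_mx 1%:M (toC (b p - g p)) =
  X' *m row_mx 1%:M (toC (b p + g p)) + Y' *m row_mx 1%:M (toC (b p - g p)) ->
  X = X' /\ Y = Y'.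
Proof.
have FE : b p - g p - (b p + g p) \in unitmx by apply: graphs_sub_unit (metric_unit hq p).
have G (Z W : 'M[C]_(m, n)) : row_mx Z W *m toC (two_graphs (b p + g p) (b p - g p)) =
    Z *m row_mx 1%:M (toC (b p + g p)) + W *m row_mx 1%:M (toC (b p - g p)).
  rewrite /two_graphs /toC map_block_mx !map_mx1 mul_row_block !mul_mx_row !mulmx1.
  by rewrite add_row_mx.
have u : toC (two_graphs (b p + g p) (b p - g p)) \in unitmx.
  by rewrite map_unitmx two_graphs_unit.
by rewrite -!G => /(can_inj (mulmxK u)) /eq_row_mx.
Qed.

(** By uniqueness of the decomposition, the component over b - g of a common vector is an
    i-eigenvector of both J- and -J-, hence zero. *)
Lemma cap_quad_L1_L2 p m (w : 'M[C]_(m, n + n)) :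
  (w <= quad_L1 g b Jp Jm p)%MS /\ (w <= quad_L2 g b Jp Jm p)%MS <->
  (w <= Lplus g b Jp p)%MS.
Proof.
rewrite quad_L1E (quad_L2E g b Jp Jm p); split=> [[/mem_quad_L[X [Y [XJ YJ ->]]]]|wL].
  move=> /mem_quad_L[X' [Y' [_ + /two_graphs_rep_inj[_ YY']]]].
  rewrite -YY' => E; have Y0 : Y = 0 by exact: eig_opp_eq0 YJ E.
  by rewrite Y0 mul0mx addr0; apply/mem_graph; rewrite mul_mx_row row_mxKl row_mxKr mulmx1.
by split; apply: submx_trans wL (addsmxSl _ _).
Qed.

(** The graphs are real, so conjugating L1 changes the sign of both complex structures and keeps the
    shape of the bundle. *)
Lemma mem_mxconj_quad_L1 p m (w : 'M[C]_(m, n + n)) :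
  (w <= mxconj (quad_L1 g b Jp Jm p))%MS <->
  (w <= quad_L g b (fun q => - Jp q) (fun q => - Jm q) p)%MS.
Proof.
have conjJ (X : 'M[C]_(m, n)) (J : 'M[R]_n) : mxconj X *m toC (- J) = iC *: mxconj X <->
    X *m toC J = iC *: X.
  split=> E.
    apply: (can_inj (@mxconjK R m n)); rewrite mxconjM mxconj_toC mxconjZ conj_i.
    by rewrite scaleNr -E toCN mulmxN opprK.
  by rewrite toCN mulmxN -(mxconj_toC J) -mxconjM E mxconjZ conj_i scaleNr opprK.
have conjG (X : 'M[C]_(m, n)) (E : 'M[R]_n) :
    mxconj (X *m row_mx 1%:M (toC E)) = mxconj X *m row_mx 1%:M (toC E).
  by rewrite -(toC1 R) -toC_row mxconjM mxconj_toC.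
rewrite sub_mxconj quad_L1E; split=> /mem_quad_L[X [Y [XJ YJ wE]]]; apply/mem_quad_L.
  exists (mxconj X), (mxconj Y); split; [exact/conjJ|exact/conjJ|].
  by rewrite -[w]mxconjK wE mxconjD !conjG.
exists (mxconj X), (mxconj Y); rewrite wE mxconjD !conjG; split=> //.
  by apply/conjJ; rewrite mxconjK.
by apply/conjJ; rewrite mxconjK.
Qed.

(** The intersection is the conjugate of L-, a graph over the i-eigenbundle of -J-; the component
    over b + g would be an i-eigenvector of both J+ and -J+. *)
Lemma cap_quad_L2_conj_L1 p m (w : 'M[C]_(m, n + n)) :
  (w <= quad_L2 g b Jp Jm p)%MS /\ (w <= mxconj (quad_L1 g b Jp Jm p))%MS <->
  (w <= graph_on_eigen (fun q => b q - g q) (fun q => - Jm q) p)%MS.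
Proof.
rewrite mem_mxconj_quad_L1 (quad_L2E g b Jp Jm p).
split=> [[/mem_quad_L[X [Y [XJ YJ ->]]]]|wL].
  move=> /mem_quad_L[X' [Y' [+ _ /two_graphs_rep_inj[XX' _]]]].
  rewrite -XX' => E; have X0 : X = 0 by exact: eig_opp_eq0 XJ E.
  by rewrite X0 mul0mx add0r; apply/mem_graph; rewrite mul_mx_row row_mxKl row_mxKr mulmx1.
by split; apply: submx_trans wL (addsmxSr _ _).
Qed.

End QuadrupleToKahler.

Section TamedToKahler.
Variables (R : realType) (n : nat) (M : manifold R n).
Variables (eps J : M -> 'M[R]_n).

(** The composite of J+ + J- with eps is 2g, and g is invertible by positivity. *)
Lemma J_plus_J_minus_unit : two_form eps -> nondegenerate_form eps ->
  riemannian_metric (sym_part eps J) -> forall p, J p + J_minus eps J p \in unitmx.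
Proof.
move=> eps2 epsU [_ _ gpos] p; have gu := positive_unit (gpos p).
have : (J p + J_minus eps J p) *m eps p = (2 : R) *: sym_part eps J p.
  rewrite mulmxDl (J_minus_mul J eps2 epsU) /sym_part scalerA mulfV ?scale1r //.
move=> E; have : (2 : R) *: sym_part eps J p \in unitmx by rewrite unitmxZ // unitfE pnatr_eq0.
by rewrite -E unitmx_mul => /andP[].
Qed.

Lemma quad_gen_kahler_tamed : tamed_symplectic eps J ->
  quad_gen_kahler (sym_part eps J) (skew_part eps J) J (J_minus eps J) /\
  forall p, J p + J_minus eps J p \in unitmx.
Proof.
move=> tame; have hq := hermitian_quadruple_tamed tame; have [gm _ _ _] := hq.
have [[[sE tE] epsU _ _] _ _ clE] := tame.
split; last exact: J_plus_J_minus_unit.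
split=> //; apply: gen_kahler_quad => //; first exact: courant_closed_L1.
apply: (courant_closed_L2 (A := fun=> 0) (eps := eps) hq) => //.
- by move=> p; rewrite trmx0 oppr0.
- by move=> p; rewrite add0r skew_add_sym.
- by move=> p; rewrite add0r skew_sub_sym J_minus_mul.
- exact: smooth_form0.
- exact: closed_form0.
Qed.

End TamedToKahler.

(** * From generalized Kähler to tamed symplectic *)

Section ConjugateBundles.
Variables (R : realType) (n : nat) (M : manifold R n).
Local Notation C := R[i].
Local Notation iC := ('i%C : C).

(* Since this is [i * conj u], closedness passes to conjugate bundles without
   any differentiability of the sections. *)
Definition swap_ReIm (u : M -> 'rV[C]_(n + n)) q := cplx (mxIm (u q)) (mxRe (u q)).

Lemma swap_ReImE u q : swap_ReIm u q = iC *: mxconj (u q).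
Proof. by rewrite -[u q in RHS]cplx_ReIm mxconj_cplx cplxi opprK. Qed.

Lemma courantC_swap u v p :
  courantC (swap_ReIm u) (swap_ReIm v) p = - mxconj (courantC u v p).
Proof.
have re w : (fun q => mxRe (swap_ReIm w q)) = fun q => mxIm (w q).
  by apply/funext => q; rewrite mxRe_cplx.
have im w : (fun q => mxIm (swap_ReIm w q)) = fun q => mxRe (w q).
  by apply/funext => q; rewrite mxIm_cplx.
rewrite /courantC !re !im mxconjD mxconjZ !mxconj_toC conj_i scaleNr opprD opprK.
move: (courant _ _ p) (courant _ _ p) (courant _ _ p) (courant _ _ p) => P Q S T.
by rewrite -toCN opprB (addrC Q).
Qed.

Lemma courant_closed_conj (L : subspaces M) : courant_closed L ->
  courant_closed (fun p => mxconj (L p)).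
Proof.
move=> cl U u v oU su sv p Up.
have sw w : section_on U (fun p => mxconj (L p)) w -> section_on U L (swap_ReIm w).
  move=> [[s0 s1] wL]; split; last first.
    by move=> q Uq; rewrite swap_ReImE scalemx_sub // -sub_mxconj wL.
  split.
    by rewrite (_ : (fun _ => _) = fun q => mxIm (w q)) //; apply/funext => q; rewrite mxRe_cplx.
  by rewrite (_ : (fun _ => _) = fun q => mxRe (w q)) //; apply/funext => q; rewrite mxIm_cplx.
have := cl U _ _ oU (sw u su) (sw v sv) p Up.
by rewrite courantC_swap eqmx_opp -sub_mxconj.
Qed.

(** For a real field X the vector XK + iX = i (X - i XK) is an i-eigenvector of [K]. The bracket of
    two such fields has real part [XK, YK] - [X, Y] and imaginary part [XK, Y] + [X, YK]. It is an
    i-eigenvector exactly when the real part is the image under [K] of the imaginary one, which is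
    the vanishing of the Nijenhuis tensor. The bundles enter only through their intersection. *)
Lemma integrable_of_closed (E K : M -> 'M[R]_n) (L L' : subspaces M) :
  smooth_form E -> almost_complex K -> courant_closed L -> courant_closed L' ->
  (forall p (w : 'rV[C]_(n + n)), (w <= L p)%MS /\ (w <= L' p)%MS <->
    (w <= graph_on_eigen E K p)%MS) ->
  integrable_acs K.
Proof.
move=> sE [sK K2] clL clL' LL' U X Y oU sX sY p Up.
pose u (X : M -> 'rV[R]_n) q := cplx (row_mx (X q *m K q) (X q *m K q *m E q))
  (row_mx (X q) (X q *m E q)).
have re Z : (fun q => mxRe (u Z q)) = fun q => row_mx (Z q *m K q) (Z q *m K q *m E q).
  by apply/funext => q; rewrite mxRe_cplx.
have im Z : (fun q => mxIm (u Z q)) = fun q => row_mx (Z q) (Z q *m E q).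
  by apply/funext => q; rewrite mxIm_cplx.
have sec Z : smooth_vec U Z -> section_on U L (u Z) /\ section_on U L' (u Z).
  move=> sZ; have sZK := smooth_vec_mul oU sZ sK.
  have su : smooth_genC U (u Z).
    split; rewrite ?re ?im.
      exact: (smooth_gen_row oU sZK sZK sE).
    exact: (smooth_gen_row oU sZ sZ sE).
  have uL q : (u Z q <= L q)%MS /\ (u Z q <= L' q)%MS.
    apply/LL'/mem_graph; rewrite /u -cplx_row row_mxKl row_mxKr; split.
      by rewrite (toCE (K q)) cplxM !mulmx0 subr0 add0r -mulmxA K2 mulmxN mulmx1 cplxi.
    by rewrite (toCE (E q)) cplxM !mulmx0 subr0 add0r.
  by split; split=> // q _; have [] := uL q.
have /LL'/mem_graph[] : (courantC (u X) (u Y) p <= L p)%MS /\ (courantC (u X) (u Y) p <= L' p)%MS.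
  have [uX uX'] := sec X sX; have [uY uY'] := sec Y sY.
  by split; [exact: clL oU uX uY p Up|exact: clL' oU uX' uY' p Up].
rewrite /courantC !re !im => + _.
have lsubC (P Q : 'rV[R]_(n + n)) : lsubmx (toC P + iC *: toC Q) = cplx (lsubmx P) (lsubmx Q).
  by rewrite -(cplxE P Q); apply/matrixP => i j; rewrite !mxE.
have lsubN (P Q : 'rV[R]_(n + n)) : lsubmx (P - Q) = lsubmx P - lsubmx Q.
  by rewrite lsubmxD; congr (_ + _); apply/matrixP => i j; rewrite !mxE.
have lb (Z W Z' W' : M -> 'rV[R]_n) :
    lsubmx (courant (fun q => row_mx (Z q) (W q)) (fun q => row_mx (Z' q) (W' q)) p) =
    lie_bracket Z Z' p.
  rewrite lsub_courant (_ : (fun q => _) = Z); last by apply/funext => q; rewrite row_mxKl.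
  by rewrite (_ : (fun q => _) = Z') //; apply/funext => q; rewrite row_mxKl.
pose XK q := X q *m K q; pose YK q := Y q *m K q.
have := lb X (fun q => X q *m E q) Y (fun q => Y q *m E q).
have := lb X (fun q => X q *m E q) YK (fun q => YK q *m E q).
have := lb XK (fun q => XK q *m E q) Y (fun q => Y q *m E q).
have := lb XK (fun q => XK q *m E q) YK (fun q => YK q *m E q).
rewrite /nijenhuis -/XK -/YK => <- <- <- <-.
move: (courant (fun q => row_mx (XK q) (XK q *m E q)) (fun q => row_mx (YK q) (YK q *m E q)) p)
  (courant (fun q => row_mx (XK q) (XK q *m E q)) (fun q => row_mx (Y q) (Y q *m E q)) p)
  (courant (fun q => row_mx (X q) (X q *m E q)) (fun q => row_mx (YK q) (YK q *m E q)) p)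
  (courant (fun q => row_mx (X q) (X q *m E q)) (fun q => row_mx (Y q) (Y q *m E q)) p)
  => P Q S T.
rewrite lsubC lsubN lsubmxD.
rewrite (toCE (K p)) cplxM !mulmx0 subr0 add0r cplxi => /cplx_inj[_].
rewrite mulmxDl addrAC (addrAC (lsubmx P)) => <-.
by rewrite -addrA -opprD subrr.
Qed.

End ConjugateBundles.

Section KahlerToTamed.
Variables (R : realType) (n : nat) (M : manifold R n).
Local Notation C := R[i].
Local Notation iC := ('i%C : C).

Lemma courant_closed_same (L L' : subspaces M) : same_subspaces L L' ->
  courant_closed L -> courant_closed L'.
Proof.
move=> LL' cl U u v oU [su uL] [sv vL] p Up.
have [_ le] := andP (LL' p); have [ge _] := andP (LL' p).
apply: (submx_trans _ ge); apply: (cl U) => //; split=> // q Uq; have [_ leq] := andP (LL' q).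
  exact: submx_trans (uL q Uq) leq.
exact: submx_trans (vL q Uq) leq.
Qed.

Lemma integrable_quad (g b Jp Jm : M -> 'M[R]_n) : hermitian_quadruple g b Jp Jm ->
  courant_closed (quad_L1 g b Jp Jm) -> courant_closed (quad_L2 g b Jp Jm) ->
  integrable_acs Jp /\ integrable_acs (fun p => - Jm p).
Proof.
move=> hq cl1 cl2; have [[sg _ _] [sb _] [acp _] [[sm m2] _]] := hq; split.
  apply: (integrable_of_closed (E := fun p => b p + g p) _ acp cl1 cl2).
    exact: smooth_formD.
  by move=> p w; exact: cap_quad_L1_L2.
apply: (integrable_of_closed (E := fun p => b p - g p) _ _ cl2 (courant_closed_conj cl1)).
- exact/smooth_formD/smooth_formN.
- split; first exact: smooth_endoN.
  by move=> p; rewrite mulmxN mulNmx opprK m2.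
- by move=> p w; exact: cap_quad_L2_conj_L1.
Qed.

Lemma tamed_of_quad_gen_kahler (eps J : M -> 'M[R]_n) :
  two_form eps -> nondegenerate_form eps -> almost_complex J ->
  quad_gen_kahler (sym_part eps J) (skew_part eps J) J (J_minus eps J) ->
  tamed_symplectic eps J.
Proof.
move=> eps2 epsU acJ [hq [[_ cl1] [_ cl2] _]]; have [sE tE] := eps2.
have [iJ iK] := integrable_quad hq cl1 cl2.
split=> //.
- split=> // p X X0; rewrite -sym_part_self.
  by have [[_ _ gpos] _ _ _] := hq; exact: gpos.
- rewrite (_ : conj_endo eps J = fun p => - J_minus eps J p) //.
  by apply/funext => p; rewrite /J_minus opprK.
have [] // := closed_of_courant_closed_L2 (A := fun=> 0) (eps := eps) hq _ tE _ _ _ sE cl2.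
- by move=> p; rewrite trmx0 oppr0.
- by move=> p; rewrite add0r skew_add_sym.
- by move=> p; rewrite add0r skew_sub_sym J_minus_mul.
- exact: smooth_form0.
Qed.

Lemma closed_formN (A : M -> 'M[R]_n) : smooth_form A -> closed_form A ->
  closed_form (fun p => - A p).
Proof.
move=> sA clA p i j k.
have dA := smooth_form_differentiable (chart_at_atlas p) (chart_at_dom p) sA.
have -> : form_in (chart_at p) (fun p => - A p) = fun y => - form_in (chart_at p) A y.
  by apply/funext => y; rewrite /form_in mulmxN mulNmx.
rewrite d2_RnE; last exact: differentiableN.
have D v : 'D_v (fun y => - form_in (chart_at p) A y) (chart_at p p) =
    - 'D_v (form_in (chart_at p) A) (chart_at p p).
  by apply: deriveN; exact: diff_derivable.
have := clA p i j k; rewrite (d2_RnE i j k dA) !D.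
move: ('D_(basis_vec R i) _ _) ('D_(basis_vec R j) _ _) ('D_(basis_vec R k) _ _) => P Q S E.
by rewrite !mxE -!opprD E oppr0.
Qed.

(** The rows of K + i are i-eigenvectors of [K]. If their graph elements lie in the second bundle,
    the imaginary parts of the eigenvector equation and of the graph equation give the two
    equalities, so one inclusion is enough. *)
Lemma graph_on_eigen_inj (E K E' K' : M -> 'M[R]_n) p : K p *m K p = - 1%:M ->
  (graph_on_eigen E K p <= graph_on_eigen E' K' p)%MS -> K p = K' p /\ E p = E' p.
Proof.
move=> K2; rewrite /graph_on_eigen => le.
pose w := row_mx (cplx (K p) 1%:M) (cplx (K p *m E p) (E p)).
have /mem_graph[] : (w <= eigenspace (toC (K' p)) iC *m row_mx 1%:M (toC (E' p)))%MS.
  apply: submx_trans le; apply/mem_graph; rewrite /w row_mxKl row_mxKr; split.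
    by rewrite toCE cplxM !mulmx0 subr0 add0r K2 mul1mx cplxi.
  by rewrite toCE cplxM !mulmx0 subr0 add0r mul1mx.
rewrite /w row_mxKl row_mxKr !toCE !cplxM !mulmx0 !subr0 !add0r !mul1mx cplxi.
by move=> /cplx_inj[_ ->] /cplx_inj[_ ->].
Qed.

Lemma hermitian_anti (g K : 'M[R]_n) : K *m K = - 1%:M -> K *m g *m K^T = g ->
  g *m K^T = - (K *m g).
Proof.
by move=> K2 Kg; rewrite -[in RHS]Kg !mulmxA K2 !mulNmx mul1mx opprK.
Qed.

End KahlerToTamed.

(** * B-field transformations *)

Section BFieldTransform.
Variables (R : realType) (n : nat) (M : manifold R n).
Local Notation C := R[i].
Local Notation iC := ('i%C : C).
Variables (g b Jp Jm B : M -> 'M[R]_n).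

Let expB_graph m p (A : 'M[C]_(m, n)) (E : 'M[R]_n) :
  A *m row_mx 1%:M (toC E) *m toC (block_mx 1%:M (B p) 0 1%:M) =
  A *m row_mx 1%:M (toC (B p + E)).
Proof.
rewrite -mulmxA; congr (_ *m _); rewrite /toC map_block_mx !map_mx1 map_mx0 mul_row_block.
by rewrite !mul1mx mulmx0 addr0 mulmx1 map_mxD.
Qed.

Lemma Lplus_expB p : Lplus g b Jp p *m toC (block_mx 1%:M (B p) 0 1%:M) =
  Lplus g (fun p => B p + b p) Jp p.
Proof. by rewrite /Lplus /graph_on_eigen expB_graph addrA. Qed.

Lemma Lminus_expB p : Lminus g b Jm p *m toC (block_mx 1%:M (B p) 0 1%:M) =
  Lminus g (fun p => B p + b p) Jm p.
Proof. by rewrite /Lminus /graph_on_eigen expB_graph addrA. Qed.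

Lemma same_expB (L L' : subspaces M) : same_subspaces L L' ->
  same_subspaces (expB B L) (expB B L').
Proof. by move=> LL' p; have /andP[e e'] := LL' p; rewrite /expB !submxMr. Qed.

Lemma expB_quad_L1 : same_subspaces (expB B (quad_L1 g b Jp Jm))
  (quad_L1 g (fun p => B p + b p) Jp Jm).
Proof.
move=> p; apply/eqmxP; apply: eqmx_trans (addsmxMr _ _ _) _.
by rewrite Lplus_expB Lminus_expB; exact: eqmx_refl.
Qed.

Lemma expB_quad_L2 : same_subspaces (expB B (quad_L2 g b Jp Jm))
  (quad_L2 g (fun p => B p + b p) Jp Jm).
Proof.
move=> p; apply/eqmxP; apply: eqmx_trans (addsmxMr _ _ _) _.
(* [B] is real, so its exponential commutes with conjugation. *)
by rewrite -(mxconj_toC (block_mx _ _ _ _)) -mxconjM mxconj_toC Lplus_expB Lminus_expB;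
  exact: eqmx_refl.
Qed.

End BFieldTransform.

(** * Recovering the quadruple from the pair of bundles *)

Section QuadrupleUnique.
Variables (R : realType) (n : nat) (M : manifold R n).
Variables (g b Jp Jm g' b' Jp' Jm' : M -> 'M[R]_n).

(** The intersection of L1 and L2 determines J+ and b + g, that of L2 and conj(L1) determines -J-
    and b - g; half the difference of the two forms is g. *)
Lemma quadruple_inj : hermitian_quadruple g b Jp Jm -> hermitian_quadruple g' b' Jp' Jm' ->
  same_subspaces (quad_L1 g b Jp Jm) (quad_L1 g' b' Jp' Jm') ->
  same_subspaces (quad_L2 g b Jp Jm) (quad_L2 g' b' Jp' Jm') ->
  [/\ g = g', b = b', Jp = Jp' & Jm = Jm'].
Proof.
move=> hq hq' e1 e2.
have P p : Jp p = Jp' p /\ b p + g p = b' p + g' p.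
  apply: (@graph_on_eigen_inj _ _ _ (fun p => b p + g p) Jp (fun p => b' p + g' p) Jp').
    exact: (Jp_sqr hq).
  have [l1 l2] := (cap_quad_L1_L2 hq p (Lplus g b Jp p)).2 (submx_refl _).
  have /andP[m1 _] := e1 p; have /andP[m2 _] := e2 p.
  apply/(cap_quad_L1_L2 hq' p (Lplus g b Jp p)).
  by split; [exact: submx_trans l1 m1|exact: submx_trans l2 m2].
have N p : - Jm p = - Jm' p /\ b p - g p = b' p - g' p.
  apply: (@graph_on_eigen_inj _ _ _ (fun p => b p - g p) (fun p => - Jm p)
    (fun p => b' p - g' p) (fun p => - Jm' p)).
    by rewrite mulmxN mulNmx opprK (Jm_sqr hq).
  set D := graph_on_eigen _ _ p.
  have [l2 l1] := (cap_quad_L2_conj_L1 hq p D).2 (submx_refl _).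
  have /andP[m1 _] := e1 p; have /andP[m2 _] := e2 p.
  apply/(cap_quad_L2_conj_L1 hq' p D).
  by split; [exact: submx_trans l2 m2|apply: submx_trans l1 _; rewrite mxconj_sub].
have gE p : g p = g' p.
  have [_ E] := P p; have [_ F] := N p.
  have : 2^-1 *: ((b p + g p) - (b p - g p)) = 2^-1 *: ((b' p + g' p) - (b' p - g' p)).
    by rewrite E F.
  have D (x y : 'M[R]_n) : x + y - (x - y) = y + y by rewrite opprB addrC addrA subrK.
  by rewrite !D !half_double.
split; apply/funext => p.
- exact: gE.
- by have [_] := P p; rewrite gE => /addIr.
- by have [] := P p.
- by have [/oppr_inj] := N p.
Qed.

End QuadrupleUnique.

(** * The symplectic form of a generalized Kähler structure *)

Section SymplecticFromKahler.
Variables (R : realType) (n : nat) (M : manifold R n).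
Variables (g b Jp Jm : M -> 'M[R]_n).
Hypotheses (hq : hermitian_quadruple g b Jp Jm) (SU : forall p, Jp p + Jm p \in unitmx).

(* The symmetric part of eps J being g means [(Jp + Jm) eps = 2 g]. *)
Definition symplectic_of p := (2 : R) *: (invmx (Jp p + Jm p) *m g p).
Local Notation eps := symplectic_of.

(** Both complex structures are skew for g, hence so is S = J+ + J-, that is, g S^T = -S g. This
    makes 2 S^-1 g a skew form. *)
Lemma two_form_symplectic : two_form eps.
Proof.
have [[sg gT _] _ [[sp _] _] [[sm _] _]] := hq; split.
  apply: smooth_formZ; apply: smooth_form_mul => //.
  exact: (smooth_endo_inv SU (smooth_endoD sp sm)).
move=> p; set S := Jp p + Jm p; have uS : S \in unitmx := SU p.
have gS : g p *m S^T = - (S *m g p).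
  rewrite linearD /= mulmxDr mulmxDl opprD.
  by rewrite (hermitian_anti (Jp_sqr hq p) (Jp_hermitian hq p))
    (hermitian_anti (Jm_sqr hq p) (Jm_hermitian hq p)).
rewrite /symplectic_of -/S linearZ /= trmx_mul gT trmx_inv -scalerN; congr (_ *: _).
apply: (can_inj (mulmxK (_ : S^T \in unitmx))); first by rewrite unitmx_tr.
by rewrite mulmxKV ?unitmx_tr // mulNmx -mulmxA gS mulmxN mulKmx // opprK.
Qed.

Lemma nondegenerate_symplectic : nondegenerate_form eps.
Proof.
move=> p; rewrite /symplectic_of unitmxZ ?unitfE ?pnatr_eq0 //.
by rewrite unitmx_mul unitmx_inv SU (metric_unit hq).
Qed.

Lemma J_plus_minus_symplectic p : (Jp p + Jm p) *m eps p = (2 : R) *: g p.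
Proof. by rewrite /symplectic_of -scalemxAr mulKVmx. Qed.

(** With S = [Jp + Jm] one has Jp S = S Jm, both sides being Jp Jm - 1. So S^-1 conjugates [Jp] to
    [Jm], and the skewness of [Jp] for g turns this into the formula defining [J_minus]. *)
Lemma J_minus_symplectic : J_minus eps Jp = Jm.
Proof.
apply/funext => p; set S := Jp p + Jm p; have uS : S \in unitmx := SU p.
have comm : invmx S *m Jp p = Jm p *m invmx S.
  apply: (can_inj (mulKmx uS)); rewrite mulKVmx //.
  apply: (can_inj (mulmxK uS)); rewrite mulmxA mulmxKV //.
  by rewrite /S mulmxDl mulmxDr (Jp_sqr hq) (Jm_sqr hq) addrC.
apply: (can_inj (mulmxK (nondegenerate_symplectic p))).
rewrite /J_minus /conj_endo mulNmx mulmxKV ?nondegenerate_symplectic //.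
rewrite /symplectic_of -/S -scalemxAl -scalemxAr -scalerN; congr (_ *: _).
rewrite -mulmxA (hermitian_anti (Jp_sqr hq p) (Jp_hermitian hq p)) mulmxN opprK.
by rewrite !mulmxA comm.
Qed.

Lemma sym_part_symplectic : sym_part eps Jp = g.
Proof.
apply/funext => p; rewrite /sym_part.
rewrite -(J_minus_mul Jp two_form_symplectic nondegenerate_symplectic) J_minus_symplectic.
rewrite -mulmxDl J_plus_minus_symplectic scalerA mulVf ?scale1r // pnatr_eq0.
Qed.

Lemma almost_complex_plus : almost_complex Jp.
Proof. by case: hq => _ _ []. Qed.

(** The equality of symmetric parts makes A = b - [skew_part eps Jp] satisfy the two decompositions
    of b + g and b - g, so the closedness of L2 yields both dA = 0 and d eps = 0. Positivity of g is
    the taming condition. *)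
Lemma tamed_of_symplectic : courant_closed (quad_L1 g b Jp Jm) ->
  courant_closed (quad_L2 g b Jp Jm) ->
  tamed_symplectic eps Jp /\ closed_form (fun p => skew_part eps Jp p - b p).
Proof.
move=> cl1 cl2; have [iJ iK] := integrable_quad hq cl1 cl2.
have [sE tE] := two_form_symplectic; have uE := nondegenerate_symplectic.
have [sS tS] := skew_part_two_form two_form_symplectic almost_complex_plus.
have [[_ _ gpos] [sb tb] _ _] := hq.
have sA : smooth_form (fun p => b p - skew_part eps Jp p) by exact/smooth_formD/smooth_formN.
have [|||clA clE] := closed_of_courant_closed_L2
  (A := fun p => b p - skew_part eps Jp p) (eps := eps) hq _ tE _ _ sA sE cl2.
- by move=> p; rewrite linearB /= tb tS opprB opprK addrC.
- move=> p; rewrite -(skew_add_sym eps Jp) sym_part_symplectic.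
  by rewrite addrA subrK.
- move=> p; rewrite -[in RHS]J_minus_symplectic (J_minus_mul Jp two_form_symplectic uE).
  by rewrite -(skew_sub_sym eps Jp) sym_part_symplectic addrA subrK.
split; last first.
  have := closed_formN sA clA; congr closed_form; apply/funext => p; exact: opprB.
split=> //.
  split=> //; first exact: almost_complex_plus.
  by move=> p X X0; rewrite -sym_part_self sym_part_symplectic gpos.
rewrite (_ : conj_endo eps Jp = fun p => - Jm p) //.
by apply/funext => p; rewrite -J_minus_symplectic /J_minus opprK.
Qed.

End SymplecticFromKahler.

Theorem theorem6p2 (R : realType) (n : nat) (M : manifold R n) :
  (forall eps J : M -> 'M[R]_n,
     two_form eps -> nondegenerate_form eps -> almost_complex J ->
     let Jp := J_plus eps J in
     let Jm := J_minus eps J in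
     let g := sym_part eps J in
     let b := skew_part eps J in
     tamed_symplectic eps J <->
     (quad_gen_kahler g b Jp Jm /\ forall p : M, Jp p + Jm p \in unitmx))
  /\
  (forall (L1 L2 : subspaces M) (g b Jp Jm : M -> 'M[R]_n),
     gen_kahler L1 L2 ->
     given_by_quadruple L1 L2 g b Jp Jm ->
     (forall p : M, Jp p + Jm p \in unitmx) ->
     exists! B : M -> 'M[R]_n,
       [/\ two_form B, closed_form B
         & exists eps J : M -> 'M[R]_n,
             tamed_symplectic eps J /\
             given_by_quadruple (expB B L1) (expB B L2)
               (sym_part eps J) (skew_part eps J)
               (J_plus eps J) (J_minus eps J)]).
Proof.
split=> [eps J eps2 epsU acJ Jp Jm g b|L1 L2 g b Jp Jm [[_ cl1] [_ cl2] _] [hq e1 e2] SU].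
  split; first exact: quad_gen_kahler_tamed.
  by move=> [qk _]; exact: tamed_of_quad_gen_kahler.
pose eps := symplectic_of g Jp Jm; pose b' := skew_part eps Jp.
have [tame clB] := tamed_of_symplectic hq SU (courant_closed_same e1 cl1)
  (courant_closed_same e2 cl2).
have [sb tb] : two_form b by case: hq.
have [sb' tb'] := skew_part_two_form (two_form_symplectic hq SU) (almost_complex_plus hq).
have same_trans (L L' L'' : subspaces M) : same_subspaces L L' -> same_subspaces L' L'' ->
    same_subspaces L L''.
  by move=> e e' p; apply/eqmxP; exact: eqmx_trans (eqmxP (e p)) (eqmxP (e' p)).
have expE B : same_subspaces (expB B L1) (quad_L1 g (fun p => B p + b p) Jp Jm) /\
    same_subspaces (expB B L2) (quad_L2 g (fun p => B p + b p) Jp Jm).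
  split.
    exact: same_trans _ _ _ (same_expB B e1) (expB_quad_L1 g b Jp Jm B).
  exact: same_trans _ _ _ (same_expB B e2) (expB_quad_L2 g b Jp Jm B).
have hqt := hermitian_quadruple_tamed tame.
(* The transformation adds [B] to b and fixes g, J+ and J-, so [B] has to move b to the skew part of
   the eps J obtained from the structure. *)
exists (fun p => b' p - b p); split.
  split=> //.
    split; first exact/smooth_formD/smooth_formN.
    by move=> p; rewrite linearB /= tb' tb opprB opprK addrC.
  exists eps, Jp; split=> //; have [E1 E2] := expE (fun p => b' p - b p).
  have bE : (fun p => b' p - b p + b p) = b' by apply/funext => p; rewrite subrK.
  move: E1 E2 hqt; rewrite bE (J_minus_symplectic hq SU) (sym_part_symplectic hq SU).
  by move=> E1 E2 hqt; split.
(* Uniqueness: the transformed pair has the quadruple (g, B + b, J+, J-), which must be that of the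
   second tamed structure. The composite of J+ + J- with [eps'] is then 2g as well, so [eps'] is
   [eps], and comparing the skew forms gives [B]. *)
move=> B [[sB tB] clB' [eps' [J' [tame' [hq' E1' E2']]]]].
have hqB : hermitian_quadruple g (fun p => B p + b p) Jp Jm.
  have [gm _ hp hm] := hq; split=> //; split; first exact: smooth_formD.
  by move=> p; rewrite linearD /= tB tb opprD.
have same_sym (L L' : subspaces M) : same_subspaces L L' -> same_subspaces L' L.
  by move=> e p; apply/eqmxP/eqmx_sym/eqmxP.
have [E1 E2] := expE B.
have [gE bE JE KE] := quadruple_inj hqB hq' (same_trans _ _ _ (same_sym _ _ E1) E1')
  (same_trans _ _ _ (same_sym _ _ E2) E2').
have [[eps2' epsU' _ _] _ _ _] := tame'.
have epsE p : (Jp p + Jm p) *m eps' p = (2 : R) *: g p.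
  rewrite KE JE gE mulmxDl (J_minus_mul J' eps2' epsU') /sym_part scalerA mulfV ?scale1r //.
have eE : eps' = eps.
  apply/funext => p; apply: (can_inj (mulKmx (SU p))).
  by rewrite epsE (J_plus_minus_symplectic _ SU).
have JJ : J' = Jp by rewrite JE.
apply/funext => p; apply: (addIr (b p)); rewrite subrK.
have := congr1 (fun f : M -> 'M[R]_n => f p) bE; rewrite eE JJ => /= ->.
by [].
Qed.
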